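(* Let $\sigma>0$, $1/2<H<3/4$, $\alpha\in(0,1)$, $\Delta_n=n^{-\alpha}$, $p=2H-1\in(0,1/2)$, $\gamma_n=\sigma^2\Delta_n^{p}$ (so $\gamma_n\to0$), and $v_n=\sqrt n\,\Delta_n^{p}$. Let $X_n\sim\mathcal N(0,V_n(\sigma,H))$, $S_{\sigma,n}=\partial_\sigma\ell_n(\sigma,H)$, $S_{H,n}=\partial_H\ell_n(\sigma,H)$ and $R_{H,n}=S_{H,n}-\sigma\ln(\Delta_n)S_{\sigma,n}$, as defined in the context. Then, as $n\to\infty$, $$\frac1{v_n}\binom{S_{\sigma,n}}{R_{H,n}}\ \Rightarrow\ \mathcal N\bigl(0,I^{(<)}(\sigma,H)\bigr),$$ where $$I^{(<)}(\sigma,H)=\begin{pmatrix}\frac{2\sigma^2}{\pi}\int_0^\pi f_H(\lambda)^2\,d\lambda&\frac{\sigma^3}{\pi}\int_0^\pi f_H(\lambda)\dot f_H(\lambda)\,d\lambda\\[2mm]\frac{\sigma^3}{\pi}\int_0^\pi f_H(\lambda)\dot f_H(\lambda)\,d\lambda&\frac{\sigma^4}{2\pi}\int_0^\pi\dot f_H(\lambda)^2\,d\lambda\end{pmatrix}.$$ Equivalently, with $M_n^{(1)}=\begin{pmatrix}1&0\\-\sigma\ln(\Delta_n)&1\end{pmatrix}$, $$\frac1{v_n}M_n^{(1)}\binom{S_{\sigma,n}}{S_{H,n}}\ \Rightarrow\ \mathcal N\bigl(0,I^{(<)}(\sigma,H)\bigr).$$ Moreover, $I^{(<)}(\sigma,H)$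 is non-singular.
   Context: Let $\rho_H(k)=\frac12(|k+1|^{2H}-2|k|^{2H}+|k-1|^{2H})$ be the autocovariance of standard fractional Gaussian noise and $f_H$ its spectral density, normalized by $\rho_H(k)=\frac1{2\pi}\int_{-\pi}^{\pi}e^{ik\lambda}f_H(\lambda)\,d\lambda$; explicitly $f_H(\lambda)=\kappa_H(1-\cos\lambda)\sum_{j\in\mathbb Z}|\lambda+2\pi j|^{-2H-1}$ for $\lambda\in[-\pi,\pi]\setminus\{0\}$, with $\kappa_H>0$ determined by $\rho_H(0)=1$. $\dot f_H=\partial_Hf_H$. $T_n(H)=(\rho_H(j-k))_{1\le j,k\le n}$, $\dot T_n(H)=\partial_HT_n(H)$. $X_n$ is the vector of $n$ increments over mesh $\Delta_n$ of $\sigma B^H+B$ ($B^H$ standard fractional Brownian motion, $B$ independent standard Brownian motion); its law is $\mathcal N(0,V_n(\sigma,H))$ with $V_n(\sigma,H)=\Delta_n(I_n+\gamma_nT_n(H))$. The log-likelihood is $\ell_n(\sigma,H)=-\frac n2\ln(2\pi)-\frac12\ln\det V_n-\frac12X_n^\top V_n^{-1}X_n$. Equivalently, with $A_n=I_n+\gamma_nT_n(H)$, $Z_n=\Delta_n^{-1/2}A_n^{-1/2}X_n\sim\mathcal N(0,I_n)$ and $D_n=A_n^{-1/2}\dot T_n(H)A_n^{-1/2}$, one has $R_{H,n}=\frac{\gamma_n}2(Z_n^\top D_nZ_n-\operatorname{tr}(D_n))$. $\Rightarrow$ denotes convergence in distribution. *)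

(* Defs.v *)
From HB Require Import structures.
From mathcomp Require Import all_boot all_order all_algebra.
From mathcomp Require Import all_classical all_reals all_analysis.

Set Implicit Arguments.
Unset Strict Implicit.
Unset Printing Implicit Defensive.

Import Order.TTheory GRing.Theory Num.Theory.
Import numFieldNormedType.Exports.

Local Open Scope classical_set_scope.
Local Open Scope ring_scope.

Section FractionalGaussianNoise.
Context {R : realType}.
Implicit Types (H lambda : R).

Definition fgn_acov H (k : int) : R :=
  2^-1 * (`|k%:~R + 1| `^ (2 * H) - 2 * `|k%:~R| `^ (2 * H)
          + `|k%:~R - 1| `^ (2 * H)).

Definition fgn_mx (n : nat) H : 'M[R]_n :=
  \matrix_(j < n, k < n) fgn_acov H (j%:Z - k%:Z).

(* At [lambda = 0] the factor [1 - cos lambda] makes this 0; the spectral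
   density is only meant off this null set. *)
Definition fgn_spec_shape H lambda : R :=
  (1 - cos lambda) *
  fine (\esum_(j in [set: int])
          (`|lambda + 2 * pi * j%:~R| `^ (- (2 * H) - 1))%:E).

(* The constant for which the spectral density integrates to
   [2 * pi * fgn_acov H 0 = 2 * pi] over [-pi, pi]. *)
Definition fgn_spec_const H : R :=
  2 * pi / \int[lebesgue_measure]_(lambda in `[- pi, pi])
             fgn_spec_shape H lambda.

Definition fgn_spec H lambda : R :=
  fgn_spec_const H * fgn_spec_shape H lambda.

Definition fgn_dspec H lambda : R := (fun h : R => fgn_spec h lambda)^`()%classic H.

End FractionalGaussianNoise.

Section MixedFractionalBrownianMotion.
Context {R : realType}.
Implicit Types (delta sigma H : R) (n : nat).

Definition mfbm_cov n delta sigma H : 'M[R]_n :=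
  delta *: (1%:M + (sigma ^+ 2 * delta `^ (2 * H - 1)) *: fgn_mx n H).

Definition mfbm_loglik n delta sigma H (x : 'cV[R]_n) : R :=
  - (n%:R / 2) * ln (2 * pi)
  - 2^-1 * ln (\det (mfbm_cov n delta sigma H))
  - 2^-1 * (x^T *m invmx (mfbm_cov n delta sigma H) *m x) ord0 ord0.

Definition score_sigma n delta sigma H (x : 'cV[R]_n) : R :=
  (fun s : R => mfbm_loglik delta s H x)^`()%classic sigma.

Definition score_H n delta sigma H (x : 'cV[R]_n) : R :=
  (fun h : R => mfbm_loglik delta sigma h x)^`()%classic H.

End MixedFractionalBrownianMotion.

Section GaussianVectors.
Context {R : realType}.

(* [normal_prob m 0] is not a point mass in the library, hence the case
   distinction. *)
Definition centered_normal (v : R) (A : set R) : \bar R :=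
  if v == 0 then \d_(0 : R) A else normal_prob 0 (Num.sqrt v) A.

(* [X] has law N(0, V) when every linear combination [u^T X] of its components
   has law N(0, u^T V u). *)
Definition gaussian_vector d (T : measurableType d) (P : probability T R)
    (n : nat) (X : T -> 'cV[R]_n) (V : 'M[R]_n) : Prop :=
  [/\ V^T = V,
      forall u : 'cV[R]_n, 0 <= (u^T *m V *m u) ord0 ord0,
      forall i : 'I_n, measurable_fun [set: T] (fun w => X w i ord0) &
      forall (u : 'cV[R]_n) (A : set R), measurable A ->
        P [set w | A ((u^T *m X w) ord0 ord0)] =
        centered_normal ((u^T *m V *m u) ord0 ord0) A].

(* Convergence in distribution, against bounded continuous test functions;
   the [n]-th random vector may live on its own probability space. *)
Definition cvg_in_distribution (k : nat) (d : nat -> measure_display)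
    (T : forall n, measurableType (d n)) (P : forall n, probability (T n) R)
    (Y : forall n, T n -> 'cV[R]_k)
    (d' : measure_display) (T' : measurableType d') (Q : probability T' R)
    (G : T' -> 'cV[R]_k) : Prop :=
  (forall n i, measurable_fun [set: T n] (fun w => Y n w i ord0)) /\
  forall g : 'cV[R]_k -> R, continuous g -> (exists M : R, forall y, `|g y| <= M) ->
    ('E_(P n)[g \o Y n] @[n --> \oo] --> 'E_Q[g \o G])%E.

Definition cvg_to_gaussian (k : nat) (d : nat -> measure_display)
    (T : forall n, measurableType (d n)) (P : forall n, probability (T n) R)
    (Y : forall n, T n -> 'cV[R]_k) (Gamma : 'M[R]_k) : Prop :=
  exists (d' : measure_display) (T' : measurableType d')
    (Q : probability T' R) (G : T' -> 'cV[R]_k),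
    gaussian_vector Q G Gamma /\ cvg_in_distribution P Y Q G.

End GaussianVectors.

Section TwoByTwo.
Context {R : realType}.

Definition col2 (a b : R) : 'cV[R]_2 := \col_(i < 2) (if i == 0 then a else b).

Definition mx2 (a b c d : R) : 'M[R]_2 :=
  \matrix_(i < 2, j < 2)
    if i == 0 then (if j == 0 then a else b) else (if j == 0 then c else d).

Definition fisher_lt (sigma H : R) : 'M[R]_2 :=
  let Iff := \int[lebesgue_measure]_(x in `[0, pi]) (fgn_spec H x ^+ 2) in
  let Ifd := \int[lebesgue_measure]_(x in `[0, pi])
               (fgn_spec H x * fgn_dspec H x) in
  let Idd := \int[lebesgue_measure]_(x in `[0, pi]) (fgn_dspec H x ^+ 2) in
  mx2 (2 * sigma ^+ 2 / pi * Iff) (sigma ^+ 3 / pi * Ifd)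
      (sigma ^+ 3 / pi * Ifd) (sigma ^+ 4 / (2 * pi) * Idd).

End TwoByTwo.

(* Main.v *)
Require Import Defs.
From HB Require Import structures.
From mathcomp Require Import all_boot all_order all_algebra.
From mathcomp Require Import all_classical all_reals all_analysis.
From mathcomp Require Import perm complex.
From mathcomp Require Import measurable_realfun probability_measure measurable_function.
From mathcomp Require Import ring lra zify.
Import Order.TTheory GRing.Theory Num.Theory.
Import numFieldNormedType.Exports.
Local Open Scope classical_set_scope.
Local Open Scope ring_scope.
Set Implicit Arguments.
Unset Strict Implicit.
Unset Printing Implicit Defensive.

(* Fix a direction u = (a, b). Simultaneous diagonalization gives C with C A_n C^T = 1 and
   C S C^T = diag(l), where S is the Toeplitz matrix with entries s_k = (2a/sigma) rho_H(k)
   + b rho'_H(k). Then C X_n / sqrt(Delta_n) is standard normal and u^T (S_sigma, R_H) =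
   (gamma_n / 2) sum_i l_i (Z_i^2 - 1), a sum of independent centred chi-squares. After
   division by v_n its characteristic function is exp(- sigma^4 sum_i l_i^2 / (4 n)) up to
   an error of order n^(-3/2) sum_i |l_i|^3. Since gamma_n -> 0, truncating S to a band
   shows sum_i l_i^2 / n -> L = s_0^2 + 2 sum_{k>0} s_k^2 and max_i |l_i| = o(sqrt n).
   The s_k are the Fourier coefficients of g = (2a/sigma) f_H + b f'_H, which is square
   integrable because H < 3/4, so Parseval turns L into (1/pi) int_0^pi g^2 and sigma^4 L / 2
   is the quadratic form of I^(<) at u; it is positive by Bessel with s_0 and s_1.

   That f_H has Fourier coefficients rho_H follows by unfolding the sum over j into
   int_0^oo (1 - cos(m x)) x^(-2H-1) dx, which scales as m^(2H), and expanding
   (1 - cos x) cos(k x) into a second difference of such terms. Convergence in law is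
   deduced from E cos(u^T Y_n + c) by approximating bounded continuous functions by
   trigonometric polynomials, tightness coming from 1 - E cos(t Y) <= K t^2. *)

(** * Trigonometric approximation *)

(** The obstacle is that the symbol [g] is in general unbounded at 0: for H > 1/2 the density grows
    there like |x|^(1 - 2H), and its derivative in H carries an extra logarithm. The operator norms
    of the matrices S are then not bounded in n. The splitting of S repairs this: a fixed band has
    bounded operator norm, and the other entries are small in Frobenius norm, of order sqrt(n *
    eps). The combination R_H removes from the H-score the matrix 2 ln(Delta_n) T_n, which is
    proportional to the matrix of the sigma-score. The probabilistic part stays real: E cos(W + c)
    for all phases c carries the content of a complex characteristic function. Independence is
    therefore also expressed through cosines, and sums of chi-squares are handled by an induction
    over the coordinates. Derivatives in H of infinite sums and of integrals are obtained from
    remainder bounds K t^2, which can be summed and integrated term by term. *)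

Section Fejer.
Context {R : realType}.
Implicit Types (t c : R).

Lemma cosM (a b : R) : cos a * cos b = 2^-1 * (cos (a + b) + cos (a - b)).
Proof. by rewrite cosD cosB; field. Qed.

Lemma cosD2pin (a : R) (n : nat) : cos (a + 2 * pi * n%:R) = cos a.
Proof.
have -> : 2 * pi * n%:R = (pi *+ 2) *+ n :> R by rewrite -[RHS]mulr_natr -[pi *+ 2]mulr_natl.
by rewrite (periodicn (@cosD2pi R)).
Qed.

Lemma sinD2pin (a : R) (n : nat) : sin (a + 2 * pi * n%:R) = sin a.
Proof.
have -> : 2 * pi * n%:R = (pi *+ 2) *+ n :> R by rewrite -[RHS]mulr_natr -[pi *+ 2]mulr_natl.
by rewrite (periodicn (@sinD2pi R)).
Qed.

(** Multiplied by 2 sin h with h = a pi / M, each term becomes a difference of sines, and the sum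
    telescopes over a whole number of periods. The condition 0 < a < M makes sin h nonzero. *)
Lemma sum_cos_roots (M a : nat) c : (0 < a < M)%N ->
  \sum_(p < M) cos (c + a%:R * (2 * pi * p%:R / M%:R)) = 0.
Proof.
move=> /andP[a0 aM].
have M0 : M%:R != 0 :> R by rewrite pnatr_eq0 -lt0n (leq_trans _ aM).
pose h : R := a%:R * pi / M%:R.
have h0 : 2 * sin h != 0.
  rewrite mulf_neq0 ?pnatr_eq0// gt_eqF// sin_gt0_pi// /h.
  rewrite !mulr_gt0 ?pi_gt0 ?invr_gt0 ?ltr0n//=; last exact: leq_trans aM.
  rewrite ltr_pdivrMr ?ltr0n; last exact: leq_trans aM.
  by rewrite mulrC ltr_pM2l ?pi_gt0// ltr_nat.
apply: (mulfI h0); rewrite mulr0 mulr_sumr.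
pose g (p : nat) : R := sin (c + 2 * h * p%:R - h).
rewrite (eq_bigr (fun p : 'I_M => g p.+1 - g p)); last first.
  move=> p _; rewrite /g.
  have -> : c + 2 * h * p.+1%:R - h = (c + 2 * h * p%:R) + h by rewrite -natr1; ring.
  have -> : a%:R * (2 * pi * p%:R / M%:R) = 2 * h * p%:R by rewrite /h; field.
  by rewrite sinB sinD; ring.
rewrite -(big_mkord xpredT (fun p => g p.+1 - g p)) telescope_sumr// /g.
have -> : c + 2 * h * M%:R - h = (c - h) + 2 * pi * a%:R by rewrite /h; field.
by rewrite sinD2pin mulr0 addr0 subrr.
Qed.

Lemma sum_cos_rootsz (M : nat) (d : int) c : (`|d| < M)%N ->
  \sum_(p < M) cos (c + d%:~R * (2 * pi * p%:R / M%:R)) = M%:R * (cos c * (d == 0)%:R).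
Proof.
case: (intP d) => [|a|a] dM.
- rewrite eqxx mulr1 (eq_bigr (fun=> cos c)); last by move=> p _; rewrite mul0r addr0.
  by rewrite sumr_const card_ord mulr_natl.
- by rewrite -pmulrn sum_cos_roots// !mulr0.
- rewrite oppr_eq0/= !mulr0 -[RHS](@sum_cos_roots M a.+1 (- c)); last first.
    by move: dM; rewrite abszN.
  apply: eq_bigr => p _; rewrite -cosN; congr cos.
  by rewrite mulrNz -pmulrn; ring.
Qed.

(** The Fejer kernel. The double sum displays it as a trigonometric polynomial with frequencies
    below N; it is also the squared modulus of a sum of exponentials, hence nonnegative. *)
Definition fejer (N : nat) t : R :=
  N%:R^-1 * \sum_(j < N) \sum_(l < N) cos ((j%:Z - l%:Z)%:~R * t).

(** The squared modulus of \sum_j u_j e^(ijt) without complex numbers. It also yields the positivity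
    of the covariance matrices later. *)
Lemma sum_cos_diff (N : nat) (u : 'I_N -> R) t :
  \sum_(j < N) \sum_(l < N) u j * u l * cos ((j%:Z - l%:Z)%:~R * t) =
  (\sum_(j < N) u j * cos (j%:R * t)) ^+ 2 + (\sum_(j < N) u j * sin (j%:R * t)) ^+ 2.
Proof.
rewrite !expr2 !big_distrlr/= -big_split/=; apply: eq_bigr => j _.
rewrite -big_split/=; apply: eq_bigr => l _.
by rewrite rmorphB/= mulrBl cosB -!pmulrn; ring.
Qed.

Lemma fejer_ge0 N t : 0 <= fejer N t.
Proof.
rewrite /fejer mulr_ge0 ?invr_ge0//.
have := @sum_cos_diff N (fun=> 1) t.
under eq_bigr do under eq_bigr do rewrite !mul1r.
by move=> ->; rewrite addr_ge0 ?sqr_ge0.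
Qed.

(** There are m + 2 nodes because the kernel [fejer m.+1] has frequencies up to m, and up to m + 1
    after multiplication by one more cosine; on these frequencies summation over the nodes is
    exact. *)
Definition fnode (m p : nat) : R := 2 * pi * p%:R / m.+2%:R.

Definition fweight (m : nat) t (p : nat) : R :=
  m.+2%:R^-1 * fejer m.+1 (t - fnode m p).

Lemma fweight_ge0 m t p : 0 <= fweight m t p.
Proof. by rewrite mulr_ge0 ?invr_ge0 ?fejer_ge0. Qed.

Lemma sum_cos_nodes m (d : int) t : (`|d| < m.+2)%N ->
  \sum_(p < m.+2) cos (d%:~R * (t - fnode m p)) = m.+2%:R * (d == 0)%:R.
Proof.
move=> dM; have := @sum_cos_rootsz m.+2 (- d) (d%:~R * t).
rewrite abszN => /(_ dM); rewrite oppr_eq0.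
have -> : cos (d%:~R * t) * (d == 0)%:R = (d == 0)%:R.
  by case: eqVneq => [->|]; rewrite ?mulr0// mul0r cos0 mulr1.
by move=> <-; apply: eq_bigr => p _; congr cos; rewrite /fnode rmorphN/=; ring.
Qed.

Lemma sum_fweight m t : \sum_(p < m.+2) fweight m t p = 1.
Proof.
rewrite /fweight /fejer -mulr_sumr -mulr_sumr exchange_big/=.
rewrite (eq_bigr (fun j : 'I_m.+1 => m.+2%:R)); last first.
  move=> j _; rewrite exchange_big/= (bigD1 j)//= sum_cos_nodes; last by rewrite subrr.
  rewrite subrr mulr1 big1 ?addr0// => l lj.
  rewrite sum_cos_nodes; last by have := ltn_ord j; have := ltn_ord l; lia.
  by rewrite subr_eq0 eqz_nat (inj_eq val_inj) eq_sym (negbTE lj) mulr0.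
rewrite sumr_const card_ord -[X in _ * (_ * X)]mulr_natl mulKf ?pnatr_eq0//.
by rewrite mulVf ?pnatr_eq0.
Qed.

(** The weights form a probability on the nodes, and this is their spread around t. The Fejer kernel
    has coefficient m / (m + 1) at frequency 1, which leaves 1 / (m + 1). *)
Lemma sum_fweight_1Bcos m t :
  \sum_(p < m.+2) fweight m t p * (1 - cos (t - fnode m p)) = m.+1%:R^-1.
Proof.
pose S := \sum_(p < m.+2) fejer m.+1 (t - fnode m p) * cos (t - fnode m p).
have -> : \sum_(p < m.+2) fweight m t p * (1 - cos (t - fnode m p)) = 1 - m.+2%:R^-1 * S.
  rewrite -[X in X - _](sum_fweight m t) /S mulr_sumr -sumrB.
  by apply: eq_bigr => p _; rewrite /fweight; ring.
suff -> : S = m.+1%:R^-1 * (m.+2%:R * m%:R).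
  rewrite mulrCA mulrA mulrA mulfVK ?pnatr_eq0//.
  by rewrite -(natr1 m); field; rewrite natr1 pnatr_eq0.
(* After summation over the nodes only the index pairs of frequency zero survive. With the frequency
   shifted by 1 or -1 these are the m adjacent pairs. *)
have cnt (F : nat -> nat -> int) :
    (forall j l, (j < m.+1)%N -> (l < m.+1)%N -> (`|F j l| < m.+2)%N) ->
   \sum_(p < m.+2) \sum_(j < m.+1) \sum_(l < m.+1) cos ((F j l)%:~R * (t - fnode m p)) =
   m.+2%:R * \sum_(j < m.+1) \sum_(l < m.+1) (F j l == 0)%:R.
  move=> FM; rewrite exchange_big/= mulr_sumr; apply: eq_bigr => j _.
  rewrite exchange_big/= mulr_sumr; apply: eq_bigr => l _.
  by rewrite sum_cos_nodes// FM.
have sm : \sum_(j < m.+1) \sum_(l < m.+1) ((j.+1 == l)%N%:R : R) = m%:R.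
  rewrite big_ord_recr/= [X in _ + X]big1 ?addr0; last first.
    by move=> l _; rewrite gtn_eqF.
  rewrite (eq_bigr (fun=> 1)) ?sumr_const ?card_ord// => j _.
  have jm : (j.+1 < m.+1)%N by rewrite ltnS.
  rewrite (bigD1 (Ordinal jm))//= eqxx big1 ?addr0// => l /negbTE.
  by rewrite eq_sym -(inj_eq val_inj)/= => ->.
rewrite /S /fejer; under eq_bigr do rewrite -mulrA.
rewrite -mulr_sumr; congr (_ * _).
have sp : \sum_(j < m.+1) \sum_(l < m.+1) (((j%:Z - l%:Z + 1)%Z == 0)%:R : R) = m%:R.
  rewrite -sm; apply: eq_bigr => j _; apply: eq_bigr => l _.
  by congr (nat_of_bool _)%:R; lia.
have sq : \sum_(j < m.+1) \sum_(l < m.+1) (((j%:Z - l%:Z - 1)%Z == 0)%:R : R) = m%:R.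
  rewrite -sm exchange_big/=; apply: eq_bigr => j _; apply: eq_bigr => l _.
  by congr (nat_of_bool _)%:R; lia.
transitivity (2^-1 * (m.+2%:R * m%:R + m.+2%:R * m%:R : R)); last by field.
rewrite -{1}sp -sq.
rewrite -(cnt (fun j l => j%:Z - l%:Z + 1)%Z); last by move=> j l; rewrite !ltnS => ? ?; lia.
rewrite -(cnt (fun j l => j%:Z - l%:Z - 1)%Z); last by move=> j l; rewrite !ltnS => ? ?; lia.
rewrite -big_split/= mulr_sumr; apply: eq_bigr => p _.
rewrite mulr_suml -big_split/= mulr_sumr; apply: eq_bigr => j _.
rewrite mulr_suml -big_split/= mulr_sumr; apply: eq_bigr => l _.
rewrite cosM; congr (_ * (cos _ + cos _)).
  have -> : (j%:Z - l%:Z + 1)%:~R = (j%:Z - l%:Z)%:~R + 1 :> R by rewrite intrD.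
  by rewrite mulrDl mul1r.
have -> : (j%:Z - l%:Z - 1)%:~R = (j%:Z - l%:Z)%:~R - 1 :> R by rewrite !intrB.
by rewrite mulrBl mul1r.
Qed.

End Fejer.

Section TrigPoly.
Context {R : realType}.

(** The phase [c] covers sines, so that the class is closed under products. The three constructors
    match linearity of the expectation, which permits inductions on this predicate. *)
Inductive trigpoly (k : nat) : ('cV[R]_k -> R) -> Prop :=
| trig_cos (u : 'cV[R]_k) (c : R) :
    trigpoly (fun y => cos ((u^T *m y) ord0 ord0 + c))
| trig_add f g : trigpoly f -> trigpoly g -> trigpoly (fun y => f y + g y)
| trig_scale a f : trigpoly f -> trigpoly (fun y => a * f y).

Lemma trig_cst k (a : R) : trigpoly (fun _ : 'cV[R]_k => a).
Proof.
have := trig_scale a (trig_cos (0 : 'cV[R]_k) 0).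
congr (trigpoly _); apply/funext => y.
by rewrite trmx0 mul0mx mxE addr0 cos0 mulr1.
Qed.

Lemma trig_sum k I (s : seq I) (Q : pred I) (F : I -> 'cV[R]_k -> R) :
  (forall i, trigpoly (F i)) -> trigpoly (fun y => \sum_(i <- s | Q i) F i y).
Proof.
move=> tF; elim: s => [|i s IH].
  by under eq_fun do rewrite big_nil; exact: trig_cst.
under eq_fun do rewrite big_cons.
case: (Q i) => //.
exact: trig_add.
Qed.

Lemma trig_mul k (f g : 'cV[R]_k -> R) :
  trigpoly f -> trigpoly g -> trigpoly (fun y => f y * g y).
Proof.
move=> tf; elim: tf g => [u c|f1 f2 _ IH1 _ IH2|a f1 _ IH1] g tg; first last.
- by under eq_fun do rewrite -mulrA; apply: trig_scale; exact: IH1.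
- by under eq_fun do rewrite mulrDl; apply: trig_add; [exact: IH1|exact: IH2].
elim: tg => [v e|g1 g2 _ IH1 _ IH2|a g1 _ IH1]; first last.
- by under eq_fun do rewrite mulrCA; apply: trig_scale.
- by under eq_fun do rewrite mulrDr; apply: trig_add.
under eq_fun do rewrite cosM; apply: trig_scale; apply: trig_add.
- have := trig_cos (u + v) (c + e); congr (trigpoly _); apply/funext => y.
  by rewrite linearD/= mulmxDl mxE; congr cos; ring.
- have := trig_cos (u - v) (c - e); congr (trigpoly _); apply/funext => y.
  by rewrite linearB/= mulmxBl !mxE; congr cos; ring.
Qed.

Lemma trig_prod k I (s : seq I) (Q : pred I) (F : I -> 'cV[R]_k -> R) :
  (forall i, trigpoly (F i)) -> trigpoly (fun y => \prod_(i <- s | Q i) F i y).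
Proof.
move=> tF; elim: s => [|i s IH].
  by under eq_fun do rewrite big_nil; exact: trig_cst.
under eq_fun do rewrite big_cons.
case: (Q i) => //.
exact: trig_mul.
Qed.

Lemma trig_cos_coord k (i : 'I_k) (a c : R) :
  trigpoly (fun y : 'cV[R]_k => cos (a * y i ord0 + c)).
Proof.
have := trig_cos (a *: delta_mx i (ord0 : 'I_1)) c; congr (trigpoly _).
apply/funext => y; rewrite linearZ/= trmx_delta -scalemxAl -rowE !mxE.
by congr cos.
Qed.

Lemma trig_fweight k (i : 'I_k) (th : R) m p :
  trigpoly (fun y : 'cV[R]_k => fweight m (th * y i ord0) p).
Proof.
rewrite /fweight /fejer; apply: trig_scale; apply: trig_scale.
apply: trig_sum => j; apply: trig_sum => l.
have := trig_cos_coord i ((j%:Z - l%:Z)%:~R * th) (- (j%:Z - l%:Z)%:~R * fnode m p).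
by congr (trigpoly _); apply/funext => y; congr cos; ring.
Qed.

(** The approximant is the average of h over a product grid with the product of the Fejer weights.
    Being an average, it keeps the bound B. The second hypothesis contains both periodicity and
    uniform continuity of h, in terms of a quantity whose average is known exactly. *)
Lemma trig_approx k (h : ('I_k -> R) -> R) (th B : R) :
  (forall x, `|h x| <= B) ->
  (forall e : R, 0 < e -> exists K : R, 0 <= K /\ forall x x',
    `|h x - h x'| <= e + K * \sum_i (1 - cos (x i - x' i))) ->
  forall e : R, 0 < e -> exists P : 'cV[R]_k -> R, [/\ trigpoly P,
    forall y, `|P y| <= B &
    forall y, `|P y - h (fun i => th * y i ord0)| <= e].
Proof.
move=> hB hK e e0; have [K [K0 hKe]] := hK (e / 2) (divr_gt0 e0 (ltr0n _ 2)).
(* The averaged error is e / 2 + K k / (m + 1), so m + 1 has to exceed 2 K k / e. *)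
pose m := Num.truncn (2 * K * k%:R / e).
have mE : K * (k%:R / m.+1%:R) <= e / 2.
  have := truncnS_gt (2 * K * k%:R / e); rewrite -/m ltr_pdivrMr// => /ltW.
  rewrite mulrA ler_pdivrMr ?ltr0n// => ?; lra.
pose w (y : 'cV[R]_k) (p : {ffun 'I_k -> 'I_m.+2}) := \prod_i fweight m (th * y i ord0) (p i).
pose xp (p : {ffun 'I_k -> 'I_m.+2}) := fun i => fnode m (p i) : R.
have w0 y p : 0 <= w y p by apply: prodr_ge0 => i _; exact: fweight_ge0.
have w1 y : \sum_p w y p = 1.
  rewrite /w -(bigA_distr_bigA (fun i (q : 'I_m.+2) => fweight m (th * y i ord0) q))/=.
  by rewrite big1// => i _; exact: sum_fweight.
(* In the i-th summand all factors of the product weight but the i-th one sum to 1. *)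
have wc y : \sum_p w y p * \sum_i (1 - cos (xp p i - th * y i ord0)) = k%:R / m.+1%:R.
  under eq_bigr do rewrite mulr_sumr.
  rewrite exchange_big/= (eq_bigr (fun=> m.+1%:R^-1)); last first.
    move=> i _; pose G (l : 'I_k) (q : 'I_m.+2) := fweight m (th * y l ord0) q *
      (if l == i then 1 - cos (th * y l ord0 - fnode m q) else 1).
    transitivity (\sum_(p : {ffun 'I_k -> 'I_m.+2}) \prod_l G l (p l)).
      apply: eq_bigr => p _; rewrite /G big_split/=; congr (_ * _).
      rewrite (bigD1 i)//= eqxx big1 ?mulr1; first by rewrite -cosN opprB.
      by move=> l /negbTE ->.
    rewrite -(bigA_distr_bigA G)/= (bigD1 i)//= [X in _ * X]big1 ?mulr1.
      rewrite -[RHS](sum_fweight_1Bcos m (th * y i ord0)).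
      by apply: eq_bigr => q _; rewrite /G eqxx.
    move=> l /negbTE li; rewrite -[RHS](sum_fweight m (th * y l ord0)).
    by apply: eq_bigr => q _; rewrite /G li mulr1.
  by rewrite sumr_const card_ord mulr_natl.
exists (fun y => \sum_p h (xp p) * w y p); split.
- apply: trig_sum => p; apply: trig_scale; apply: trig_prod => i; exact: trig_fweight.
- move=> y; rewrite (le_trans (ler_norm_sum _ _ _))//.
  rewrite -[B in X in _ <= X]mulr1 -(w1 y) mulr_sumr; apply: ler_sum => p _.
  by rewrite normrM (ger0_norm (w0 _ _)) ler_wpM2r.
- move=> y; rewrite -[h _]mulr1 -[X in h _ * X](w1 y) mulr_sumr -sumrB.
  rewrite (le_trans (ler_norm_sum _ _ _))//.
  apply: (@le_trans _ _ (\sum_p (e / 2 * w y p + K * (w y p * \sum_i (1 - cos (xp p i - th * y i ord0)))))).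
    apply: ler_sum => p _; rewrite -mulrBl normrM (ger0_norm (w0 _ _)).
    apply: le_trans (ler_wpM2r (w0 _ _) (hKe _ _)) _.
    by rewrite mulrDl lerD2l -mulrA (mulrC (w y p)).
  rewrite big_split/= -!mulr_sumr w1 wc mulr1.
  by apply: le_trans (lerD (lexx _) mE) _; lra.
Qed.

(** Where D vanishes the pair is on the diagonal, and continuity of g gives the bound e. Elsewhere D
    is locally bounded below, so that a large K suffices. Compactness of C x C gives a single K. *)
Lemma compact_modulus (X : topologicalType) (C : set X) (g : X -> R) (D : X * X -> R) :
  compact C -> continuous g -> continuous D -> (forall z, 0 <= D z) ->
  (forall x x', C x -> C x' -> D (x, x') = 0 -> x = x') ->
  forall e : R, 0 < e -> exists K : R, 0 <= K /\
    forall x x', C x -> C x' -> `|g x - g x'| <= e + K * D (x, x').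
Proof.
move=> cC cg cD D0 Dinj e e0.
have /compact_near_coveringP ncC := compact_setX cC cC.
have cG : continuous (fun z : X * X => `|g z.1 - g z.2|).
  move=> z; apply: (@continuous_comp _ _ _ (fun z : X * X => g z.1 - g z.2) Num.norm); last exact: norm_continuous.
  apply: cvgB.
    by apply: (@continuous_comp _ _ _ fst g); [exact: cvg_fst|exact: cg].
  by apply: (@continuous_comp _ _ _ snd g); [exact: cvg_snd|exact: cg].
have := ncC R (pinfty_nbhs R) (fun K z => `|g z.1 - g z.2| <= e + K * D z) _.
case.
  move=> z [Cz1 Cz2]; have [Dz0|Dz0] := eqVneq (D z) 0.
    have z12 : z.1 = z.2 by apply: Dinj => //; rewrite -surjective_pairing.
    near=> z' K => /=; apply: (@le_trans _ _ e); last first.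
      by rewrite lerDl mulr_ge0// ?D0//; near: K; apply: nbhs_pinfty_ge; exact: num_real.
    apply: ltW; near: z'; apply: (cvgr_lt _ (cG z)).
    by rewrite z12 subrr normr0.
  have Dz : 0 < D z by rewrite lt_neqAle D0 andbT eq_sym.
  near=> z' K => /=.
  have h1 : `|g z'.1 - g z'.2| <= `|g z.1 - g z.2| + 1.
    by apply: ltW; near: z'; apply: (cvgr_lt _ (cG z)); rewrite ltrDl.
  have h2 : D z / 2 <= D z'.
    by apply: ltW; near: z'; apply: (cvgr_gt _ (cD z)); rewrite ltr_pdivrMr// mulr_natr mulr2n ltrDl.
  have K0 : 0 <= K by near: K; apply: nbhs_pinfty_ge; exact: num_real.
  have h3 : `|g z.1 - g z.2| + 1 <= K * (D z / 2).
    by rewrite -ler_pdivrMr ?divr_gt0//; near: K; apply: nbhs_pinfty_ge; exact: num_real.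
  apply: (le_trans h1); apply: (le_trans h3); apply: le_trans (ler_wpM2l K0 h2) _.
  by rewrite lerDr ltW.
move=> K0 [_ K0P]; exists (Num.max 0 (K0 + 1)); split; first by rewrite le_max lexx.
move=> x x' xr x'r.
have := K0P (Num.max 0 (K0 + 1)); rewrite lt_max ltrDl ltr01 orbT => /(_ isT (x, x')).
exact.
Unshelve. all: end_near. Qed.

Lemma compact_unif_sqr k (g : 'cV[R]_k -> R) (r : R) : continuous g ->
  forall e : R, 0 < e -> exists K : R, 0 <= K /\
    forall x x' : 'cV[R]_k, (forall i, `|x i ord0| <= r) -> (forall i, `|x' i ord0| <= r) ->
    `|g x - g x'| <= e + K * \sum_i (x i ord0 - x' i ord0) ^+ 2.
Proof.
move=> cg e e0.
pose C := [set v : 'rV[R]_k | forall i, `[- r, r]%classic (v ord0 i)].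
have cC : compact C by apply: (@rV_compact _ _ (fun=> `[- r, r]%classic)) => i; exact: segment_compact.
have gT : continuous (fun v : 'rV[R]_k => g v^T).
  move=> v; apply: (@continuous_comp _ _ _ (fun v : 'rV[R]_k => v^T) g); last exact: cg.
  move=> A /= [P vP PA]; exists (fun i j => P j i); first by move=> i j; have := vP j i; rewrite mxE.
  by move=> N NP; apply: PA => i j; rewrite mxE; exact: NP.
pose D (z : 'rV[R]_k * 'rV[R]_k) := \sum_i (z.1 ord0 i - z.2 ord0 i) ^+ 2.
have cD : continuous D.
  move=> z; rewrite /D; apply: cvg_big => [|i _]; first exact: add_continuous.
  apply: (@continuous_comp _ _ _ (fun z : 'rV[R]_k * 'rV[R]_k => z.1 ord0 i - z.2 ord0 i) (fun x => x ^+ 2)); last exact: exprn_continuous.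
  apply: cvgB.
    by apply: (@continuous_comp _ _ _ fst (fun M : 'rV[R]_k => M ord0 i)); [exact: cvg_fst|exact: coord_continuous].
  by apply: (@continuous_comp _ _ _ snd (fun M : 'rV[R]_k => M ord0 i)); [exact: cvg_snd|exact: coord_continuous].
have D0 z : 0 <= D z by apply: sumr_ge0 => i _; exact: sqr_ge0.
have Dinj x x' : C x -> C x' -> D (x, x') = 0 -> x = x'.
  move=> _ _ /psumr_eq0P Dz0; apply/rowP => i; apply/eqP; rewrite -subr_eq0 -sqrf_eq0.
  by rewrite Dz0// => j _; exact: sqr_ge0.
have [K [K0 KP]] := compact_modulus cC gT cD D0 Dinj e0.
exists K; split => // x x' xr x'r; have := KP x^T x'^T.
rewrite /D/= !trmxK; under eq_bigr do rewrite !mxE.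
by apply => i; rewrite /= mxE in_itv/= -ler_norml.
Qed.

End TrigPoly.

Section LocalTrig.
Context {R : realType}.

(* [cut_inv th] inverts [x |-> sin (th x)] on [|th x| <= pi / 4] and is continuous everywhere. *)
Definition cut_inv (th s : R) : R := th^-1 * atan (s / Num.sqrt (Num.max (1 - s ^+ 2) (2^-1))).

Lemma continuous_cut_inv th : continuous (cut_inv th).
Proof.
move=> s; rewrite /cut_inv.
apply: cvgM; first exact: cvg_cst.
apply: (@continuous_comp _ _ _ (fun s : R => s / Num.sqrt (Num.max (1 - s ^+ 2) (2^-1))) atan); last exact: continuous_atan.
apply: cvgM; first exact: cvg_id.
apply: cvgV.
  by rewrite gt_eqF// sqrtr_gt0 lt_max invr_gt0 ltr0n orbT.
apply: (@continuous_comp _ _ _ (fun s : R => Num.max (1 - s ^+ 2) (2^-1)) Num.sqrt); last exact: sqrt_continuous.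
apply: (@continuous_max _ _ (fun s : R => 1 - s ^+ 2) (fun=> 2^-1)); last exact: cvg_cst.
by apply: cvgB; [exact: cvg_cst|exact: exprn_continuous].
Qed.

(** Up to the angle pi / 4 the squared cosine is at least 1 / 2, so the cut is inactive and the
    quotient inside [atan] is the tangent. *)
Lemma cut_invK th x : 0 < th -> `|th * x| <= pi / 4 -> cut_inv th (sin (th * x)) = x.
Proof.
move=> th0 xpi; have pi0 := @pi_gt0 R; rewrite /cut_inv.
have [] : - (pi / 4) <= th * x /\ th * x <= pi / 4 by split; move: xpi; rewrite ler_norml => /andP[].
move=> x1 x2.
have xr : -(pi / 2) < th * x < pi / 2 by apply/andP; split; lra.
have c0 := cos_gt0_pihalf xr.
have c2 : 2^-1 <= cos (th * x) ^+ 2.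
  have := @cos_mulr2n R (th * x).
  have : 0 <= cos (th * x *+ 2) by apply: cos_ge0_pihalf; apply/andP; split; rewrite -mulr_natr; lra.
  rewrite -mulr_natr => ? ?; lra.
rewrite -cos2sin2 max_l// sqrtr_sqr gtr0_norm// -/(tan _) tanK ?in_itv//.
by rewrite mulKf// gt_eqF.
Qed.

Lemma sqr_sinB (a b : R) : (sin a - sin b) ^+ 2 <= 2 * (1 - cos (a - b)).
Proof.
rewrite cosB.
have ha := cos2Dsin2 a; have hb := cos2Dsin2 b.
have := sqr_ge0 (cos a - cos b); rewrite !sqrrB => h.
by rewrite -subr_ge0; nra.
Qed.

Lemma sqr_cosB (a b : R) : (cos a - cos b) ^+ 2 <= 2 * (1 - cos (a - b)).
Proof.
rewrite cosB.
have ha := cos2Dsin2 a; have hb := cos2Dsin2 b.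
have := sqr_ge0 (sin a - sin b); rewrite !sqrrB => h.
by rewrite -subr_ge0; nra.
Qed.

Lemma continuous_colmap k (phi : R -> R) : continuous phi ->
  continuous (fun y : 'cV[R]_k => \col_i phi (y i ord0)).
Proof.
move=> cphi y A [Q yQ QA].
exists (fun i j => phi @^-1` Q i j).
  move=> i j; have := yQ i j; rewrite mxE (ord1 j) => h.
  exact: (cphi _ _ h).
move=> N NQ; apply: QA => i j; rewrite mxE.
by have := NQ i j; rewrite (ord1 j).
Qed.

(** On the box |y_i| <= L the function g coincides with a continuous function of the sin (th y_i),
    which is periodic and still bounded by B. Approximating that function keeps the bound B outside
    the box, which the tail estimates use. *)
Lemma trig_approx_local k (g : 'cV[R]_k -> R) (B L : R) : continuous g ->
  (forall y, `|g y| <= B) -> forall e : R, 0 < e ->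
  exists P : 'cV[R]_k -> R, [/\ trigpoly P, forall y, `|P y| <= B &
    forall y : 'cV[R]_k, (forall i, `|y i ord0| <= L) -> `|P y - g y| <= e].
Proof.
move=> cg gB e e0.
have pi0 := @pi_gt0 R.
pose L1 := Num.max 1 L; have L10 : 0 < L1 by rewrite lt_max ltr01.
pose th := pi / 4 / L1; have th0 : 0 < th by rewrite !divr_gt0// ltr0n.
pose G (s : 'cV[R]_k) := g (\col_i cut_inv th (s i ord0)).
have cG : continuous G.
  move=> s; apply: (@continuous_comp _ _ _ (fun s : 'cV[R]_k => \col_i cut_inv th (s i ord0)) g); last exact: cg.
  exact/continuous_colmap/continuous_cut_inv.
pose h (x : 'I_k -> R) := G (\col_i sin (x i)).
have [P [tP PB Pg]] : exists P : 'cV[R]_k -> R, [/\ trigpoly P,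
    forall y, `|P y| <= B & forall y, `|P y - h (fun i => th * y i ord0)| <= e].
  apply: trig_approx => // [x|r r0]; first exact: gB.
  have [K [K0 KP]] := compact_unif_sqr 1 cG r0.
  exists (K * 2); split; first by rewrite mulr_ge0.
  move=> x x'; apply: le_trans (KP _ _ _ _) _; try by move=> i; rewrite mxE sin_max.
  rewrite lerD2l -mulrA ler_wpM2l// mulr_sumr.
  by apply: ler_sum => i _; rewrite !mxE; exact: sqr_sinB.
exists P; split => // y yL.
have -> : g y = h (fun i => th * y i ord0); last exact: Pg.
rewrite /h /G; congr g; apply/colP => i; rewrite !mxE cut_invK//.
rewrite normrM (gtr0_norm th0) /th mulrAC ler_pdivrMr// ler_wpM2l//.
  by rewrite divr_ge0// ltW.
by rewrite le_max yL orbT.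
Qed.

Definition cospoly (f : R -> R) :=
  exists N (a : nat -> R), forall x, f x = \sum_(k < N) a k * cos (k%:R * x).

Lemma cospoly_cos (c : R) n : cospoly (fun x => c * cos (n%:R * x)).
Proof.
exists n.+1, (fun k => if k == n then c else 0) => x.
rewrite big_ord_recr/= eqxx big1 ?add0r// => i _.
by rewrite ltn_eqF// mul0r.
Qed.

Lemma cospolyD f g : cospoly f -> cospoly g -> cospoly (fun x => f x + g x).
Proof.
move=> [N [a fE]] [M [b gE]].
have widen K (d : nat -> R) x : (K <= N + M)%N ->
    \sum_(k < K) d k * cos (k%:R * x) =
    \sum_(k < N + M) (if (k < K)%N then d k else 0) * cos (k%:R * x).
  move=> KNM; rewrite (big_ord_widen _ (fun k => d k * cos (k%:R * x)) KNM) big_mkcond/=.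
  by apply: eq_bigr => i _; case: ifP => // _; rewrite mul0r.
exists (N + M)%N, (fun k => (if (k < N)%N then a k else 0) + (if (k < M)%N then b k else 0)) => x.
rewrite fE gE (widen N)// ?leq_addr// (widen M)// ?leq_addl// -big_split/=.
by apply: eq_bigr => i _; rewrite mulrDl.
Qed.

Lemma cospoly_sum I (s : seq I) (F : I -> R -> R) :
  (forall i, cospoly (F i)) -> cospoly (fun x => \sum_(i <- s) F i x).
Proof.
move=> tF; elim: s => [|i s IH].
  by exists 0%N, (fun=> 0) => x; rewrite big_nil big_ord0.
by under eq_fun do rewrite big_cons; exact: cospolyD.
Qed.

Lemma cos_absz (d : int) (x : R) : cos (`|d|%N%:R * x) = cos (d%:~R * x).
Proof.
by case: (intP d) => [|n|n]; rewrite ?abszN -?pmulrn// mulrNz mulNr cosN -pmulrn.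
Qed.

(** Composition with [acos] and [cos] extends g from [0, pi] to an even periodic function. The Fejer
    average A approximates the extension, and averaging A over x and - x leaves cosines only. *)
Lemma cospoly_approx (g : R -> R) : continuous g -> forall e : R, 0 < e ->
  exists f, cospoly f /\ forall x, 0 <= x <= pi -> `|f x - g x| <= e.
Proof.
move=> cg e e0.
have acR x : 0 <= acos (cos x) <= pi.
  by rewrite acos_ge0 ?acos_lepi ?cos_geN1 ?cos_le1.
pose h x := g (acos (cos x)).
have [K [K0 KP]] : exists K : R, 0 <= K /\ forall x x', `|h x - h x'| <= e / 2 + K * (1 - cos (x - x')).
  have e20 : 0 < e / 2 by rewrite divr_gt0.
  pose D (z : R * R) := (cos z.1 - cos z.2) ^+ 2.
  have cD : continuous D.
    move=> z; apply: (@continuous_comp _ _ _ (fun z : R * R => cos z.1 - cos z.2) (fun x => x ^+ 2)); last exact: exprn_continuous.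
    apply: cvgB.
      by apply: (@continuous_comp _ _ _ fst cos); [exact: cvg_fst|exact: continuous_cos].
    by apply: (@continuous_comp _ _ _ snd cos); [exact: cvg_snd|exact: continuous_cos].
  have D0 z : 0 <= D z by exact: sqr_ge0.
  have Dinj (x x' : R) : `[0, pi]%classic x -> `[0, pi]%classic x' -> D (x, x') = 0 -> x = x'.
    move=> xI x'I /eqP; rewrite sqrf_eq0 subr_eq0/= => /eqP; exact: cos_inj.
  have [K [K0 KP]] := compact_modulus (@segment_compact R 0 pi) cg cD D0 Dinj e20.
  exists (K * 2); split; first by rewrite mulr_ge0.
  move=> x x'; apply: le_trans (KP _ _ _ _) _; rewrite /= ?in_itv/= ?acR//.
  rewrite lerD2l -mulrA ler_wpM2l// /D/= !acosK ?in_itv/= ?cos_geN1 ?cos_le1//.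
  exact: sqr_cosB.
pose m := Num.truncn (2 * K / e).
have mE : K * m.+1%:R^-1 <= e / 2.
  have := truncnS_gt (2 * K / e); rewrite -/m ltr_pdivrMr// => /ltW.
  rewrite ler_pdivrMr ?ltr0n// => ?; lra.
pose A x := \sum_(p < m.+2) h (fnode m p) * fweight m x p.
have Ah x : `|A x - h x| <= e.
  rewrite -[h x]mulr1 -[X in h _ * X](sum_fweight m x) mulr_sumr -sumrB.
  rewrite (le_trans (ler_norm_sum _ _ _))//.
  apply: (@le_trans _ _ (\sum_(p < m.+2) (e / 2 * fweight m x p + K * (fweight m x p * (1 - cos (x - fnode m p)))))).
    apply: ler_sum => p _; rewrite -mulrBl normrM (ger0_norm (fweight_ge0 _ _ _)).
    apply: le_trans (ler_wpM2r (fweight_ge0 _ _ _) (KP _ _)) _.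
    by rewrite mulrDl lerD2l -mulrA (mulrC (fweight _ _ _)) -cosN opprB.
  rewrite big_split/= -[X in X + _]mulr_sumr -[X in _ + X]mulr_sumr.
  rewrite sum_fweight sum_fweight_1Bcos mulr1.
  by apply: le_trans (lerD (lexx _) mE) _; lra.
exists (fun x => 2^-1 * (A x + A (- x))); split.
  have -> : (fun x => 2^-1 * (A x + A (- x))) = fun x =>
      \sum_(p < m.+2) \sum_(j < m.+1) \sum_(l < m.+1)
        (h (fnode m p) * m.+2%:R^-1 * m.+1%:R^-1 * cos ((j%:Z - l%:Z)%:~R * fnode m p)) *
        cos (`|j%:Z - l%:Z|%N%:R * x).
    apply/funext => x; rewrite /A -big_split/= mulr_sumr; apply: eq_bigr => p _.
    rewrite /fweight /fejer -!mulrDr -big_split/= !mulr_sumr; apply: eq_bigr => j _.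
    rewrite -big_split/= !mulr_sumr; apply: eq_bigr => l _.
    rewrite cos_absz; move: (m.+2%:R^-1) (m.+1%:R^-1) => c1 c2.
    set d : R := (j%:Z - l%:Z)%:~R.
    have -> : d * (x - fnode m p) = d * x - d * fnode m p by ring.
    have -> : d * (- x - fnode m p) = - (d * x + d * fnode m p) by ring.
    by rewrite cosN cosB cosD; field.
  apply: cospoly_sum => p; apply: cospoly_sum => j; apply: cospoly_sum => l.
  exact: cospoly_cos.
move=> x x0pi.
have hx : h x = g x by rewrite /h cosK// in_itv.
have hNx : h (- x) = g x by rewrite /h cosN cosK// in_itv.
have := Ah x; have := Ah (- x); rewrite hx hNx !ler_norml => /andP[? ?] /andP[? ?].
apply/andP; split; lra.
Qed.

End LocalTrig.

(** * Simultaneous diagonalization and derivatives of determinants *)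

Section RealSpectral.
Context {R : realType}.

Lemma mx11_eq (A B : 'M[R]_1) : (A = B) <-> (A ord0 ord0 = B ord0 ord0).
Proof. by split => [->//|h]; apply/matrixP => i j; rewrite !ord1. Qed.

Lemma mulmx_trE n (x y : 'rV[R]_n) : (x *m y^T) ord0 ord0 = \sum_i x ord0 i * y ord0 i.
Proof. by rewrite mxE; apply: eq_bigr => i _; rewrite mxE. Qed.

(** The reflection in the hyperplane orthogonal to v - e exchanges the unit vectors e and v. When v
    = e the identity serves. *)
Lemma householder n (v : 'rV[R]_(1 + n)) : v *m v^T = 1%:M ->
  exists H : 'M[R]_(1 + n), [/\ H^T = H, H *m H = 1%:M & row_mx 1%:M 0 *m H = v].
Proof.
move=> v1; pose e : 'rV[R]_(1 + n) := row_mx 1%:M 0.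
have e1 : e *m e^T = 1%:M.
  by rewrite /e tr_row_mx mul_row_col trmx1 mulmx1 mul0mx addr0.
pose w := v - e.
have [w0|w0] := eqVneq w 0.
  exists 1%:M; rewrite trmx1 !mulmx1; split => //.
  by apply/esym/eqP; rewrite -subr_eq0; apply/eqP.
pose q := (w *m w^T) ord0 ord0.
have q0 : q != 0.
  apply: contra w0 => /eqP; rewrite /q mulmx_trE => /psumr_eq0P h.
  apply/eqP/rowP => i; rewrite [RHS]mxE.
  have /eqP := h (fun j _ => ltac:(by rewrite -expr2 sqr_ge0)) i isT.
  by rewrite mulf_eq0 orbb => /eqP.
have ww : w *m w^T = q%:M by apply/mx11_eq; rewrite [RHS]mxE eqxx mulr1n.
pose H := 1%:M - (2 / q) *: (w^T *m w).
exists H; split.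
- by rewrite /H linearB/= trmx1 linearZ/= trmx_mul trmxK.
- rewrite /H mulmxBr mulmx1 mulmxBl mul1mx -scalemxAr -scalemxAl.
  rewrite -mulmxA (mulmxA w) ww mul_scalar_mx -scalemxAr !scalerA.
  have -> : 2 / q * (2 / q) * q = 2 / q + 2 / q by field.
  by rewrite scalerDl opprB addrK subrK.
- have eww : e *m w^T = (- (q / 2))%:M.
    apply/mx11_eq; rewrite [RHS]mxE eqxx mulr1n.
    have qE : q = 2 - 2 * (e *m v^T) ord0 ord0.
      rewrite /q /w linearB/= mulmxBr !mulmxBl v1 e1.
      have -> : v *m e^T = e *m v^T.
        by apply/mx11_eq; rewrite !mulmx_trE; apply: eq_bigr => i _; rewrite mulrC.
      by rewrite !mxE eqxx mulr1n; lra.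
    have -> : (e *m w^T) ord0 ord0 = (e *m v^T) ord0 ord0 - 1.
      by rewrite /w linearB/= mulmxBr e1 mxE; congr (_ + _); rewrite !mxE eqxx.
    by rewrite qE; lra.
  rewrite -/e /H mulmxBr mulmx1 -scalemxAr mulmxA eww mul_scalar_mx scalerA.
  have -> : 2 / q * - (q / 2) = -1 by field.
  by rewrite scaleN1r opprK /w addrC subrK.
Qed.

(** An eigenvalue exists over the complex closure. Evaluating u A u^* in two ways shows that it is
    real; it is then a root of the real characteristic polynomial, which provides a real
    eigenvector. *)
Lemma sym_eigenvector n (A : 'M[R]_n.+1) : A^T = A ->
  exists (a : R) (v : 'rV[R]_n.+1), v *m A = a *: v /\ v *m v^T = 1%:M.
Proof.
move=> symA; pose f := real_complex R; pose Ac := map_mx f A.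
have [a /eigenvalueP[u uA u0]] : exists a, eigenvalue Ac a.
  exact: eigenvalue_closed.
pose uc := map_mx Num.conj u.
have AcT : map_mx Num.conj Ac^T = Ac.
  apply/matrixP => i j; rewrite !mxE.
  have -> : A j i = A i j by rewrite -{1}symA mxE.
  by rewrite conj_Creal// complex_real.
pose N := (u *m uc^T) ord0 ord0.
have NE : N = \sum_i `|u ord0 i| ^+ 2.
  by rewrite /N mxE; apply: eq_bigr => i _; rewrite !mxE normCK.
have N0 : N != 0.
  apply: contra u0; rewrite NE => /eqP/psumr_eq0P h; apply/eqP/rowP => i.
  apply/eqP; rewrite mxE -normr_eq0 -sqrf_eq0 h// => j _; exact: sqr_ge0.
have aN : a * N = a^* * N.
  have h1 : u *m Ac *m uc^T = (a * N)%:M.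
    rewrite uA -scalemxAl; apply/matrixP => i j; rewrite !ord1 !mxE eqxx mulr1n.
    by congr (_ * _); rewrite /N mxE.
  have h2 : Ac *m uc^T = a^* *: uc^T.
    have := congr1 (fun M => map_mx Num.conj M^T) uA.
    rewrite trmx_mul map_mxM AcT /= => h2; rewrite /uc.
    rewrite -[LHS](trmxK) -[RHS](trmxK); congr (_^T).
    move: h2; rewrite -map_trmx => ->; rewrite linearZ/= map_mxZ/=.
    by congr ((_ *: _)^T); apply/matrixP => i j; rewrite !mxE.
  move: h1; rewrite -mulmxA h2 -scalemxAr => /matrixP/(_ ord0 ord0).
  by rewrite !mxE eqxx mulr1n /N mxE => <-.
have ar : a \is Num.real by apply/CrealP; apply: (mulIf N0).
have [r ra] : exists r, a = f r.
  by exists (complex.Re a); move: ar => /complex_realP[x ->].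
have : eigenvalue A r.
  have : root (char_poly Ac) (f r).
    by rewrite -ra -eigenvalue_root_char; apply/eigenvalueP; exists u.
  by rewrite -map_char_poly fmorph_root -eigenvalue_root_char.
move=> /eigenvalueP[v vA v0].
pose q := \sum_i v ord0 i ^+ 2.
have q0 : 0 < q.
  rewrite lt_neqAle sumr_ge0 ?andbT; last by move=> i _; exact: sqr_ge0.
  apply: contra v0 => /eqP/esym/psumr_eq0P h; apply/eqP/rowP => i.
  by apply/eqP; rewrite mxE -sqrf_eq0 h// => j _; exact: sqr_ge0.
exists r, ((Num.sqrt q)^-1 *: v); split.
  by rewrite -scalemxAl vA !scalerA mulrC.
rewrite linearZ/= -scalemxAl -scalemxAr scalerA; apply/mx11_eq.
rewrite [LHS]mxE mulmx_trE [RHS]mxE eqxx mulr1n -invfM -expr2 sqr_sqrtr ?(ltW q0)//.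
rewrite (eq_bigr (fun i => v ord0 i ^+ 2)); last by move=> i _; rewrite expr2.
by rewrite mulVf// gt_eqF.
Qed.

(** Deflation: conjugation by the reflection that sends the first basis vector to a unit eigenvector
    splits off a block of size 1, by symmetry on both sides. *)
Lemma real_spectral n (A : 'M[R]_n) : A^T = A ->
  exists (Q : 'M[R]_n) (d : 'rV[R]_n), Q *m Q^T = 1%:M /\ A = Q^T *m diag_mx d *m Q.
Proof.
elim: n A => [|n IH] A symA.
  by exists 1%:M, 0; split; apply/matrixP => -[].
have [a [v [vA v1]]] := sym_eigenvector symA.
move: A symA v vA v1; rewrite -[n.+1]/(1 + n)%N => A symA v vA v1.
have [H [symH HH eH]] := householder v1.
pose B := H *m A *m H.
have symB : B^T = B by rewrite /B !trmx_mul symH symA mulmxA.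
have eB : row_mx 1%:M 0 *m B = row_mx a%:M 0.
  rewrite /B !mulmxA eH vA -scalemxAl -eH -mulmxA HH mulmx1.
  by rewrite scale_row_mx scaler0 scalemx1.
have ulB : ulsubmx B = a%:M /\ ursubmx B = 0.
  move: eB; rewrite -{1}(submxK B) mul_row_block !mul1mx !mul0mx !addr0.
  by move=> /eq_row_mx.
have dlB : dlsubmx B = 0 by rewrite -[LHS]trmxK trmx_dlsub symB ulB.2 trmx0.
have symB' : (drsubmx B)^T = drsubmx B by rewrite trmx_drsub symB.
have [Q1 [d1 [Q1E BE]]] := IH _ symB'.
have AE : A = H *m B *m H.
  by rewrite /B !mulmxA HH mul1mx -mulmxA HH mulmx1.
exists (block_mx 1%:M 0 0 Q1 *m H), (row_mx a%:M d1); split.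
  rewrite trmx_mul symH -mulmxA (mulmxA H) HH mul1mx tr_block_mx !trmx0 trmx1.
  by rewrite mulmx_block !mulmx0 !mul0mx !addr0 add0r mulmx1 Q1E -scalar_mx_block.
rewrite trmx_mul symH AE -!mulmxA; congr (_ *m _); rewrite !mulmxA; congr (_ *m _).
rewrite -[LHS]submxK ulB.1 ulB.2 dlB BE diag_mx_row.
rewrite tr_block_mx !trmx0 trmx1 !mulmx_block !mulmx0 !mul0mx !addr0 !add0r !mulmx1 !mul1mx.
congr (block_mx _ _ _ _); rewrite ?mul0mx ?mulmx0//.
by apply/mx11_eq; rewrite !mxE.
Qed.

Lemma form_psd_diag n (A Q : 'M[R]_n) (d : 'rV[R]_n) :
  Q *m Q^T = 1%:M -> A = Q^T *m diag_mx d *m Q ->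
  forall i, d ord0 i = (row i Q *m A *m (row i Q)^T) ord0 ord0.
Proof.
move=> QQ -> i.
have -> : row i Q *m (Q^T *m diag_mx d *m Q) *m (row i Q)^T = row i (diag_mx d) *m delta_mx i ord0.
  rewrite rowE -!mulmxA !trmx_mul trmx_delta (mulmxA Q) QQ mul1mx.
  by rewrite (mulmxA Q) QQ mul1mx mulmxA -rowE.
by rewrite -colE !mxE eqxx mulr1n.
Qed.

(** A first congruence, by the inverse square roots of the eigenvalues, turns A into 1. A rotation
    that diagonalizes the transformed S leaves 1 unchanged. *)
Lemma sim_diag n (A S : 'M[R]_n) : A^T = A -> S^T = S ->
  (forall u : 'rV[R]_n, u != 0 -> 0 < (u *m A *m u^T) ord0 ord0) ->
  exists (C : 'M[R]_n) (l : 'rV[R]_n), C *m A *m C^T = 1%:M /\ C *m S *m C^T = diag_mx l.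
Proof.
move=> symA symS pdA.
have [Q [d [QQ AE]]] := real_spectral symA.
have d0 i : 0 < d ord0 i.
  rewrite (form_psd_diag QQ AE); apply: pdA; apply: contraTneq isT => r0.
  have := congr1 (row i) QQ; rewrite row_mul r0 mul0mx => /rowP/(_ i).
  by rewrite !mxE eqxx => /eqP; rewrite eq_sym oner_eq0.
pose s : 'rV[R]_n := \row_i (Num.sqrt (d ord0 i))^-1.
have [C0 C0A] : exists C0 : 'M[R]_n, C0 *m A *m C0^T = 1%:M.
  exists (diag_mx s *m Q); rewrite AE trmx_mul tr_diag_mx -!mulmxA (mulmxA Q) QQ mul1mx (mulmxA Q) QQ mul1mx.
  rewrite !mulmx_diag; apply/matrixP => i j; rewrite !mxE.
  case: eqVneq => [->|_]; last by rewrite !mulr0n.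
  rewrite !mulr1n; set y := Num.sqrt _.
  have E : d ord0 j = y ^+ 2 by rewrite sqr_sqrtr// ltW.
  have y0 : y != 0 by rewrite gt_eqF// sqrtr_gt0.
  by transitivity (y^-1 * (y ^+ 2 / y)); [rewrite -E|field].
have symS0 : (C0 *m S *m C0^T)^T = C0 *m S *m C0^T by rewrite !trmx_mul trmxK symS mulmxA.
have [P [l [PP S0E]]] := real_spectral symS0.
exists (P *m C0), l; rewrite trmx_mul; split.
  have -> : P *m C0 *m A *m (C0^T *m P^T) = P *m (C0 *m A *m C0^T) *m P^T by rewrite !mulmxA.
  by rewrite C0A mulmx1.
have -> : P *m C0 *m S *m (C0^T *m P^T) = P *m (C0 *m S *m C0^T) *m P^T by rewrite !mulmxA.
by rewrite S0E !mulmxA PP mul1mx -mulmxA PP mulmx1.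
Qed.

End RealSpectral.

Section MatrixDerivative.
Context {R : realType}.

Lemma is_derive_bigprod n (f : 'I_n -> R -> R) (x : R) (df : 'I_n -> R) :
  (forall i, is_derive x 1 (f i) (df i)) ->
  is_derive x 1 (fun y => \prod_i f i y) (\sum_i df i * \prod_(j | j != i) f j x).
Proof.
elim: n f df => [|n IH] f df fD.
  rewrite big_ord0 (_ : (fun y => _) = cst 1); first exact: is_derive_cst.
  by apply/funext => y; rewrite big_ord0.
have -> : (fun y => \prod_(i < n.+1) f i y) = (f ord0 * (fun y => \prod_i f (lift ord0 i) y)).
  by apply/funext => y; rewrite big_ord_recl fctE.
have h := IH (fun i => f (lift ord0 i)) (fun i => df (lift ord0 i)) (fun i => fD _).
apply: is_derive_eq.
rewrite [RHS]big_ord_recl addrC /GRing.scale/=; congr (_ + _).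
  rewrite mulrC; congr (_ * _); rewrite [RHS]big_mkcond big_ord_recl/= mul1r.
  by apply: eq_bigr => i _.
rewrite mulr_sumr; apply: eq_bigr => i _.
rewrite [in RHS]big_mkcond big_ord_recl/= mulrCA; congr (_ * (_ * _)).
by rewrite [LHS]big_mkcond; apply: eq_bigr => j _; rewrite (inj_eq lift_inj).
Qed.

Lemma is_derive_bigsum (I : Type) (s : seq I) (f : I -> R -> R) (x : R) (df : I -> R) :
  (forall i, is_derive x 1 (f i) (df i)) ->
  is_derive x 1 (fun y => \sum_(i <- s) f i y) (\sum_(i <- s) df i).
Proof.
move=> fD; elim: s => [|i s IH].
  rewrite big_nil (_ : (fun y => _) = cst 0); first exact: is_derive_cst.
  by apply/funext => y; rewrite big_nil.
have -> : (fun y => \sum_(i <- i :: s) f i y) = (f i + (fun y => \sum_(i <- s) f i y)).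
  by apply/funext => y; rewrite big_cons fctE.
by rewrite big_cons; exact: is_deriveD.
Qed.

Definition mx_derive m n (x : R) (V : R -> 'M[R]_(m, n)) (W : 'M[R]_(m, n)) :=
  forall i j, is_derive x 1 (fun y => V y i j) (W i j).

(** Jacobi's formula. The product rule gives a sum of determinants in which one row of V is replaced
    by that of W; expansion along this row produces the adjugate. *)
Lemma mx_derive_det n (V : R -> 'M[R]_n) (x : R) (W : 'M[R]_n) : mx_derive x V W ->
  is_derive x 1 (fun y => \det (V y)) (\tr (W *m \adj (V x))).
Proof.
move=> VD; rewrite /determinant.
have h (s : {perm 'I_n}) : is_derive x 1 (fun y => (-1) ^+ s * \prod_i V y i (s i))
    ((-1) ^+ s * \sum_i W i (s i) * \prod_(j | j != i) V x j (s j)).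
  have h1 := @is_derive_bigprod n (fun i y => V y i (s i)) x (fun i => W i (s i)) (fun i => VD _ _).
  have := @is_deriveZ _ _ _ _ ((-1) ^+ s) x 1 _ h1.
  by [].
have := @is_derive_bigsum _ (index_enum {perm 'I_n}) _ x _ h.
congr (is_derive _ _ _ _).
transitivity (\sum_i \det (\matrix_(k, j) if k == i then W i j else V x k j)).
  rewrite (eq_bigr (fun s : {perm 'I_n} => \sum_i (-1) ^+ s * (W i (s i) * \prod_(j | j != i) V x j (s j)))); last first.
    by move=> s _; rewrite mulr_sumr.
  rewrite exchange_big/=; apply: eq_bigr => i _; apply: eq_bigr => s _.
  rewrite [in RHS](bigD1 i)//= mxE eqxx; congr (_ * (_ * _)).
  by apply: eq_bigr => j /negbTE ji; rewrite mxE ji.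
rewrite /mxtrace; apply: eq_bigr => i _; rewrite (expand_det_row _ i) mxE.
apply: eq_bigr => j _; rewrite !mxE eqxx; congr (_ * _).
rewrite /cofactor; congr (_ * \det _); apply/matrixP => a b; rewrite !mxE.
by rewrite eq_sym (negbTE (neq_lift _ _)).
Qed.

(** Existence is enough here: it makes the inverse differentiable, and the value of that derivative
    is found by other means. *)
Lemma mx_derive_adj n (V : R -> 'M[R]_n) (x : R) (W : 'M[R]_n) : mx_derive x V W ->
  exists W', mx_derive x (fun y => \adj (V y)) W'.
Proof.
move=> VD.
have h i j : exists c, is_derive x 1 (fun y => \adj (V y) i j) c.
  have h1 : mx_derive x (fun y => row' j (col' i (V y))) (row' j (col' i W)).
    move=> a b; have := VD (lift j a) (lift i b); congr (is_derive _ _ _ _).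
      by apply/funext => y; rewrite !mxE.
    by rewrite !mxE.
  have := @is_deriveZ _ _ _ _ ((-1) ^+ (j + i)) x 1 _ (mx_derive_det h1).
  by move=> h2; eexists; under eq_fun do rewrite mxE /cofactor; exact: h2.
exists (\matrix_(i, j) xget 0 [set c | is_derive x 1 (fun y => \adj (V y) i j) c]).
by move=> i j; rewrite mxE; have [c hc] := h i j; exact: (@xgetI _ 0 _ c).
Qed.

Lemma mx_derive_mul m n p (V : R -> 'M[R]_(m, n)) (U : R -> 'M[R]_(n, p)) (x : R) V' U' :
  mx_derive x V V' -> mx_derive x U U' ->
  mx_derive x (fun y => V y *m U y) (V' *m U x + V x *m U').
Proof.
move=> VD UD i j.
have := @is_derive_bigsum _ (index_enum 'I_n) (fun k y => V y i k * U y k j) x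
  (fun k => V x i k *: U' k j + U x k j *: V' i k) (fun k => @is_deriveM _ _ _ _ _ _ _ _ (VD i k) (UD k j)).
congr (is_derive _ _ _ _); first by apply/funext => y; rewrite mxE.
rewrite !mxE -big_split/=; apply: eq_bigr => k _.
by rewrite addrC; congr (_ + _); exact: mulrC.
Qed.

(** Differentiability comes from the adjugate divided by the determinant. The value then follows by
    differentiating V V^-1 = 1, valid near x because the determinant stays nonzero. *)
Lemma mx_derive_inv n (V : R -> 'M[R]_n) (x : R) (W : 'M[R]_n) : mx_derive x V W ->
  V x \in unitmx ->
  mx_derive x (fun y => invmx (V y)) (- (invmx (V x) *m W *m invmx (V x))).
Proof.
move=> VD; rewrite unitmxE unitfE => Vu.
have detD := mx_derive_det VD.
have nz : \forall y \near x, \det (V y) != 0.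
  have : {for x, continuous (fun y => \det (V y))}.
    by apply/differentiable_continuous/derivable1_diffP; case: detD.
  by move=> /cvgr_neq0; exact.
have [A' AD] := mx_derive_adj VD.
have iD : exists U, mx_derive x (fun y => invmx (V y)) U.
  have h i j : exists c, is_derive x 1 (fun y => invmx (V y) i j) c.
    have h1 : is_derive x 1 (fun y => (\det (V y))^-1) (- (\det (V x)) ^- 2 *: \tr (W *m \adj (V x))).
      exact: is_deriveV.
    have h2 := @is_deriveM _ _ _ _ _ _ _ _ h1 (AD i j).
    eexists; apply: near_eq_is_derive h2.
    near=> y; rewrite /invmx unitmxE unitfE ifT; last by near: y.
    by rewrite mxE.
  exists (\matrix_(i, j) xget 0 [set c | is_derive x 1 (fun y => invmx (V y) i j) c]).
  by move=> i j; rewrite mxE; have [c hc] := h i j; exact: (@xgetI _ 0 _ c).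
move: iD => [U UD].
have E : W *m invmx (V x) + V x *m U = 0.
  apply/matrixP => i j.
  have h1 := mx_derive_mul VD UD i j.
  have h2 : is_derive x 1 (fun y => (V y *m invmx (V y)) i j) 0.
    apply: near_eq_is_derive (is_derive_cst ((1%:M : 'M[R]_n) i j) x 1).
    by near=> y; rewrite /= mulmxV// unitmxE unitfE; near: y.
  have := @derive_val _ _ _ _ _ _ _ h1; rewrite (@derive_val _ _ _ _ _ _ _ h2) => <-.
  by rewrite mxE.
have Vx : V x \in unitmx by rewrite unitmxE unitfE.
have -> : - (invmx (V x) *m W *m invmx (V x)) = U.
  rewrite -mulmxA -mulmxN -[RHS](mulKmx Vx); congr (_ *m _).
  by apply/eqP; rewrite eq_sym -addr_eq0 addrC E.
exact: UD.
Unshelve. all: end_near. Qed.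

Lemma gaussian_score n (V : R -> 'M[R]_n) (x : R) (W : 'M[R]_n) (c : R) (v : 'cV[R]_n) :
  mx_derive x V W -> 0 < \det (V x) ->
  is_derive x 1 (fun y => c - 2^-1 * ln (\det (V y)) - 2^-1 * (v^T *m invmx (V y) *m v) ord0 ord0)
    (2^-1 * ((v^T *m (invmx (V x) *m W *m invmx (V x)) *m v) ord0 ord0 - \tr (invmx (V x) *m W))).
Proof.
move=> VD d0.
have Vu : V x \in unitmx by rewrite unitmxE unitfE gt_eqF.
have h1 : is_derive x 1 (fun y => ln (\det (V y))) (\tr (invmx (V x) *m W)).
  have hd := mx_derive_det VD; have hl := is_derive1_ln d0.
  have := @is_derive1_comp _ _ _ _ _ _ hl hd.
  congr (is_derive _ _ _ _); rewrite /invmx Vu -scalemxAl mxtraceZ.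
  by rewrite mxtrace_mulC.
have h2 : is_derive x 1 (fun y => (v^T *m invmx (V y) *m v) ord0 ord0)
   (- (v^T *m (invmx (V x) *m W *m invmx (V x)) *m v) ord0 ord0).
  have hv : mx_derive x (fun=> v^T) 0 by move=> i j; rewrite [X in is_derive _ _ _ X]mxE; exact: (is_derive_cst (v^T i j)).
  have hw : mx_derive x (fun=> v) 0 by move=> i j; rewrite [X in is_derive _ _ _ X]mxE; exact: (is_derive_cst (v i j)).
  have := mx_derive_mul (mx_derive_mul hv (mx_derive_inv VD Vu)) hw ord0 ord0.
  by rewrite mul0mx add0r mulmx0 addr0 mulmxN mulNmx mxE.
apply: is_derive_eq.
by rewrite /GRing.scale/=; ring.
Qed.

End MatrixDerivative.

(** * Traces of Toeplitz matrices *)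

Section SumInequalities.
Context {R : realFieldType}.

Lemma sqr_sum_le_weighted (I : finType) (a v : I -> R) :
  (\sum_i a i * v i) ^+ 2 <= (\sum_i `|a i|) * (\sum_i `|a i| * v i ^+ 2).
Proof.
have E1 : (\sum_i a i * v i) ^+ 2 = \sum_i \sum_j (a i * v i) * (a j * v j).
  by rewrite expr2 big_distrlr.
have E2 : (\sum_i `|a i|) * (\sum_i `|a i| * v i ^+ 2) = \sum_i \sum_j `|a i| * (`|a j| * v j ^+ 2).
  by rewrite big_distrlr.
have E3 : (\sum_i `|a i|) * (\sum_i `|a i| * v i ^+ 2) = \sum_i \sum_j `|a j| * (`|a i| * v i ^+ 2).
  by rewrite E2 exchange_big.
suff : (\sum_i a i * v i) ^+ 2 *+ 2 <= ((\sum_i `|a i|) * (\sum_i `|a i| * v i ^+ 2)) *+ 2 by rewrite ler_pMn2r.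
rewrite [leRHS]mulr2n {1}E2 E3 E1 -big_split -sumrMnl; apply: ler_sum => i _.
rewrite -big_split -sumrMnl; apply: ler_sum => j _ /=.
have := ler_norm ((a i * v i) * (a j * v j)).
rewrite !normrM -(real_normK (num_real (v i))) -(real_normK (num_real (v j))).
have := sqr_ge0 (`|v i| - `|v j|); have := mulr_ge0 (normr_ge0 (a i)) (normr_ge0 (a j)).
move: `|v i| `|v j| `|a i| `|a j| => x y u w.
rewrite mulr2n => h1 h2 h3; apply: le_trans (lerD h3 h3) _; nra.
Qed.

Lemma cauchy_schwarz_sum (I : finType) (x y : I -> R) :
  (\sum_i x i * y i) ^+ 2 <= (\sum_i x i ^+ 2) * (\sum_i y i ^+ 2).
Proof.
have E1 : (\sum_i x i * y i) ^+ 2 = \sum_i \sum_j (x i * y i) * (x j * y j).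
  by rewrite expr2 big_distrlr.
have E2 : (\sum_i x i ^+ 2) * (\sum_i y i ^+ 2) = \sum_i \sum_j x i ^+ 2 * y j ^+ 2.
  by rewrite big_distrlr.
have E3 : (\sum_i x i ^+ 2) * (\sum_i y i ^+ 2) = \sum_i \sum_j x j ^+ 2 * y i ^+ 2.
  by rewrite E2 exchange_big.
suff : (\sum_i x i * y i) ^+ 2 *+ 2 <= ((\sum_i x i ^+ 2) * (\sum_i y i ^+ 2)) *+ 2 by rewrite ler_pMn2r.
rewrite [leRHS]mulr2n {1}E2 E3 E1 -big_split -sumrMnl; apply: ler_sum => i _.
rewrite -big_split -sumrMnl; apply: ler_sum => j _ /=.
by have := sqr_ge0 (x i * y j - x j * y i); rewrite mulr2n; nra.
Qed.

(** Cauchy-Schwarz with weights |M_ij| uses up one factor K through the column sums; after exchange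
    of the sums the row sums give the other. *)
Lemma schur_test n (M : 'M[R]_n) (K : R) : 0 <= K ->
  (forall i, \sum_j `|M i j| <= K) -> (forall j, \sum_i `|M i j| <= K) ->
  forall v : 'rV[R]_n, \sum_j (v *m M) ord0 j ^+ 2 <= K ^+ 2 * \sum_i v ord0 i ^+ 2.
Proof.
move=> K0 hr hc v.
apply: (@le_trans _ _ (\sum_j K * \sum_i `|M i j| * v ord0 i ^+ 2)).
  apply: ler_sum => j _; rewrite mxE; under eq_bigr do rewrite mulrC.
  apply: le_trans (sqr_sum_le_weighted _ _) _; apply: ler_wpM2r => //.
  by apply: sumr_ge0 => i _; rewrite mulr_ge0 ?sqr_ge0.
rewrite -mulr_sumr exchange_big/= expr2 -mulrA; apply: ler_wpM2l => //.
rewrite mulr_sumr; apply: ler_sum => i _; rewrite -mulr_suml.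
by apply: ler_wpM2r => //; exact: sqr_ge0.
Qed.

End SumInequalities.

Section TraceBounds.
Context {R : realType}.

Lemma mxtrace_sqr_sym n (S : 'M[R]_n) : S^T = S -> \tr (S *m S) = \sum_i \sum_j S i j ^+ 2.
Proof.
move=> sS; rewrite /mxtrace; apply: eq_bigr => i _; rewrite mxE; apply: eq_bigr => j _.
by rewrite -{2}sS mxE expr2.
Qed.

Lemma sqr_rowE n (x : 'rV[R]_n) : \sum_j x ord0 j ^+ 2 = (x *m x^T) ord0 ord0.
Proof. by rewrite mulmx_trE; apply: eq_bigr => j _; rewrite expr2. Qed.

Lemma row_congr n (C M : 'M[R]_n) i : (row i C *m M *m (row i C)^T) ord0 ord0 = (C *m M *m C^T) i i.
Proof.
rewrite -row_mul mulmx_trE [RHS]mxE; apply: eq_bigr => j _.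
by rewrite !mxE.
Qed.

Variables (n : nat) (T S S1 S2 : 'M[R]_n) (g K : R).
Hypothesis (g0 : 0 <= g) (K0 : 0 <= K) (symT : T^T = T).
Hypothesis psdT : forall u : 'rV[R]_n, 0 <= (u *m T *m u^T) ord0 ord0.
Hypothesis (sym1 : S1^T = S1) (sym2 : S2^T = S2) (SE : S = S1 + S2).
Hypothesis S1K : forall v : 'rV[R]_n, \sum_j (v *m S1) ord0 j ^+ 2 <= K ^+ 2 * \sum_i v ord0 i ^+ 2.
Variables (C : 'M[R]_n) (l : 'rV[R]_n).
Hypothesis CAC : C *m (1%:M + g *: T) *m C^T = 1%:M.
Hypothesis CSC : C *m S *m C^T = diag_mx l.

Let symS : S^T = S. Proof. by rewrite SE linearD/= sym1 sym2. Qed.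

(* In the eigenbasis of [T] the matrix [C^T C = (1 + g T)^-1] is diagonal with entries
   [b i = 1 / (1 + g t i)], so [\sum_i l_i^2 = \sum_(i, j) b i b j S_ij^2], where
   [0 <= 1 - b i b j <= min 1 (g (t i + t j))]. *)
Lemma sum_sqr_congruence :
  \sum_i l ord0 i ^+ 2 <= \sum_i \sum_j S i j ^+ 2 /\
  \sum_i \sum_j S i j ^+ 2 - \sum_i l ord0 i ^+ 2 <=
    4 * g * K ^+ 2 * \tr T + 2 * \sum_i \sum_j S2 i j ^+ 2.
Proof.
have [Q [t [QQ TE]]] := real_spectral symT.
have QQ' : Q^T *m Q = 1%:M by exact: mulmx1C.
have t0 i : 0 <= t ord0 i by rewrite (form_psd_diag QQ TE).
pose b i := (1 + g * t ord0 i)^-1.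
have den i : 1 <= 1 + g * t ord0 i by rewrite lerDl mulr_ge0.
have den0 i : 0 < 1 + g * t ord0 i by exact: lt_le_trans (den i).
have bE : C^T *m C = Q^T *m diag_mx (\row_i b i) *m Q.
  have X1 : C^T *m C *m (1%:M + g *: T) = 1%:M by rewrite -mulmxA; exact: mulmx1C.
  have X2 : (1%:M + g *: T) *m (Q^T *m diag_mx (\row_i b i) *m Q) = 1%:M.
    have -> : 1%:M + g *: T = Q^T *m diag_mx (\row_i (1 + g * t ord0 i)) *m Q.
      have -> : diag_mx (\row_i (1 + g * t ord0 i)) = 1%:M + g *: diag_mx t.
        by apply/matrixP => i j; rewrite !mxE; case: eqP => _; rewrite ?mulr1n ?mulr0n ?mulr0 ?addr0.
      by rewrite mulmxDr mulmxDl mulmx1 QQ' -scalemxAr -scalemxAl -TE.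
    rewrite !mulmxA -(mulmxA _ Q Q^T) QQ mulmx1 -(mulmxA Q^T) mulmx_diag.
    have -> : diag_mx (\row_i ((\row_i0 (1 + g * t ord0 i0)) ord0 i * (\row_i0 b i0) ord0 i)) = 1%:M.
      by apply/matrixP => i j; rewrite !mxE /b divff// gt_eqF.
    by rewrite mulmx1 QQ'.
  by rewrite -[LHS]mulmx1 -X2 mulmxA X1 mul1mx.
pose S' := Q *m S *m Q^T.
pose S1' := Q *m S1 *m Q^T; pose S2' := Q *m S2 *m Q^T.
have sy (M : 'M[R]_n) : M^T = M -> (Q *m M *m Q^T)^T = Q *m M *m Q^T.
  by move=> sM; rewrite !trmx_mul trmxK sM mulmxA.
have trE (M : 'M[R]_n) : M^T = M -> \sum_i \sum_j (Q *m M *m Q^T) i j ^+ 2 = \sum_i \sum_j M i j ^+ 2.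
  move=> sM; rewrite -(mxtrace_sqr_sym (sy _ sM)) -(mxtrace_sqr_sym sM).
  by rewrite mulmxA mxtrace_mulC !mulmxA QQ' mul1mx -!mulmxA (mulmxA Q^T Q) QQ' mul1mx.
have lE : \sum_i l ord0 i ^+ 2 = \sum_i \sum_j b i * b j * S' i j ^+ 2.
  have -> : \sum_i l ord0 i ^+ 2 = \tr (diag_mx l *m diag_mx l).
    by rewrite mulmx_diag mxtrace_diag; apply: eq_bigr => i _; rewrite !mxE -expr2.
  rewrite -CSC -!mulmxA mxtrace_mulC -!mulmxA !(mulmxA C^T C) bE.
  rewrite !mulmxA mxtrace_mulC !mulmxA.
  transitivity (\tr ((S' *m diag_mx (\row_i b i)) *m (S' *m diag_mx (\row_i b i)))).
    by rewrite /S' !mulmxA.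
  rewrite /mxtrace; apply: eq_bigr => i _; rewrite mxE; apply: eq_bigr => j _.
  rewrite mul_mx_diag [in X in X * _]mxE [in X in _ * X]mxE (_ : S' j i = S' i j); last first.
    by rewrite /S' -[in LHS](sy _ symS) mxE.
  by rewrite !mxE; ring.
have b01 i : 0 < b i <= 1 by rewrite invr_gt0 den0/= invf_le1.
have bg i : 1 - b i <= g * t ord0 i.
  have bV : b i * (1 + g * t ord0 i) = 1 by rewrite mulVf// gt_eqF.
  have -> : 1 - b i = g * t ord0 i * b i by rewrite -{1}bV; ring.
  by rewrite ler_piMr ?mulr_ge0//; have /andP[] := b01 i.
rewrite lE -(trE _ symS) -/S'; split.
  apply: ler_sum => i _; apply: ler_sum => j _; rewrite ler_piMl ?sqr_ge0//.
  by have /andP[? ?] := b01 i; have /andP[? ?] := b01 j; rewrite mulr_ile1// ltW.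
rewrite -(trE _ sym2) -/S2'.
(* The rows of Q are unit vectors, and the rotation Q^T preserves length. *)
have row1 i : \sum_j S1' i j ^+ 2 <= K ^+ 2.
  have := S1K (row i Q).
  have -> : \sum_j row i Q ord0 j ^+ 2 = 1 by have := row_congr Q 1%:M i; rewrite sqr_rowE !mulmx1 => ->; rewrite QQ mxE eqxx.
  rewrite mulr1; apply: le_trans; rewrite [leRHS]sqr_rowE.
  have -> : \sum_j S1' i j ^+ 2 = \sum_j (row i Q *m S1 *m Q^T) ord0 j ^+ 2.
    by apply: eq_bigr => j _; rewrite -!row_mul [row _ _ _ _]mxE.
  by rewrite sqr_rowE trmx_mul trmxK -!mulmxA (mulmxA Q^T) QQ' mul1mx.
have -> : \tr T = \sum_i t ord0 i.
  by rewrite TE mxtrace_mulC mulmxA QQ mul1mx mxtrace_diag.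
have S12 i j : S' i j = S1' i j + S2' i j by rewrite /S' SE mulmxDr mulmxDl mxE.
have sy1 i j : S1' i j = S1' j i by rewrite /S1' -[in LHS](sy _ sym1) mxE.
(* Each half of S' meets a different bound on 1 - b i b j: g (t i + t j) for the part S1', whose
   rows are bounded, and 1 for the part S2', which is small in Frobenius norm. *)
apply: (@le_trans _ _ (\sum_i \sum_j (2 * g * t ord0 i * S1' i j ^+ 2 + 2 * g * t ord0 j * S1' i j ^+ 2 + 2 * S2' i j ^+ 2))).
  rewrite -sumrB; apply: ler_sum => i _; rewrite -sumrB; apply: ler_sum => j _.
  have /andP[bi0 bi1] := b01 i; have /andP[bj0 bj1] := b01 j.
  have hb : 1 - b i * b j <= g * t ord0 i + g * t ord0 j.
    by have := bg i; have := bg j; nra.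
  have h0 : 0 <= 1 - b i * b j by rewrite subr_ge0 mulr_ile1// ltW.
  have h1 : 1 - b i * b j <= 1 by rewrite gerBl mulr_ge0// ltW.
  have -> : S' i j ^+ 2 - b i * b j * S' i j ^+ 2 = (1 - b i * b j) * S' i j ^+ 2 by ring.
  rewrite S12; move: (1 - b i * b j) (S1' i j) (S2' i j) hb h0 h1 => c x y hb h0 h1.
  apply: (@le_trans _ _ (c * (2 * x ^+ 2) + c * (2 * y ^+ 2))).
    by rewrite -mulrDr ler_wpM2l//; have := sqr_ge0 (x - y); nra.
  apply: lerD; last by rewrite ler_piMl// mulr_ge0// sqr_ge0.
  have x2 := sqr_ge0 x; have := ler_wpM2r (mulr_ge0 (ltW (@ltr0Sn R 1)) x2) hb.
  by move=> h; apply: le_trans h _; rewrite le_eqVlt; apply/orP; left; apply/eqP; ring.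
have p1 : \sum_i \sum_j 2 * g * t ord0 i * S1' i j ^+ 2 <= 2 * g * K ^+ 2 * \sum_i t ord0 i.
  rewrite mulr_sumr; apply: ler_sum => i _; rewrite -mulr_sumr mulrAC.
  by apply: ler_wpM2r => //; apply: ler_wpM2l => //; rewrite mulr_ge0.
have p2 : \sum_i \sum_j 2 * g * t ord0 j * S1' i j ^+ 2 <= 2 * g * K ^+ 2 * \sum_i t ord0 i.
  rewrite exchange_big/=; apply: le_trans p1; apply: ler_sum => i _; apply: ler_sum => j _.
  by rewrite sy1.
have -> : \sum_i \sum_j (2 * g * t ord0 i * S1' i j ^+ 2 + 2 * g * t ord0 j * S1' i j ^+ 2 + 2 * S2' i j ^+ 2) =
  \sum_i \sum_j 2 * g * t ord0 i * S1' i j ^+ 2 + \sum_i \sum_j 2 * g * t ord0 j * S1' i j ^+ 2 + 2 * \sum_i \sum_j S2' i j ^+ 2.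
  rewrite mulr_sumr -!big_split; apply: eq_bigr => i _ /=.
  by rewrite mulr_sumr -!big_split.
by rewrite lerD2r; apply: le_trans (lerD p1 p2) _; rewrite le_eqVlt; apply/orP; left; apply/eqP; ring.
Qed.

(** Each row c of C satisfies c c^T <= c (1 + g T) c^T = 1, so |l_i| is at most the operator norm
    bound of S1 plus the Frobenius norm of S2. *)
Lemma abs_congruence i : `|l ord0 i| <= K + Num.sqrt (\sum_i \sum_j S2 i j ^+ 2).
Proof.
pose c := row i C.
have c1 : \sum_j c ord0 j ^+ 2 <= 1.
  have : (c *m (1%:M + g *: T) *m c^T) ord0 ord0 = 1 by rewrite row_congr CAC mxE eqxx.
  rewrite mulmxDr mulmxDl mulmx1 mxE -sqr_rowE -scalemxAr -scalemxAl mxE => <-.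
  by rewrite lerDl mulr_ge0.
have -> : l ord0 i = (c *m S1 *m c^T) ord0 ord0 + (c *m S2 *m c^T) ord0 ord0.
  have : C *m S *m C^T = C *m S1 *m C^T + C *m S2 *m C^T by rewrite SE mulmxDr mulmxDl.
  by rewrite CSC !row_congr => /matrixP/(_ i i); rewrite [LHS]mxE [RHS]mxE eqxx.
apply: le_trans (ler_normD _ _) _; apply: lerD.
  rewrite -ler_sqr ?nnegrE// real_normK ?num_real// mulmx_trE.
  apply: le_trans (cauchy_schwarz_sum _ _) _.
  rewrite -[leRHS]mulr1; apply: ler_pM => //; try by apply: sumr_ge0 => j _; exact: sqr_ge0.
  apply: le_trans (S1K c) _; rewrite -[leRHS]mulr1; apply: ler_wpM2l => //; exact: sqr_ge0.
rewrite -sqrtr_sqr; apply: ler_wsqrtr; rewrite mulmx_trE.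
apply: le_trans (cauchy_schwarz_sum _ _) _.
rewrite -[leRHS]mulr1; apply: ler_pM => //; try by apply: sumr_ge0 => j _; exact: sqr_ge0.
rewrite exchange_big/=; apply: ler_sum => j _; rewrite mxE.
apply: le_trans (cauchy_schwarz_sum _ _) _.
rewrite -[leRHS]mul1r; apply: ler_wpM2r => //; apply: sumr_ge0 => k _; exact: sqr_ge0.
Qed.

End TraceBounds.

Section Toeplitz.
Context {R : realType}.

Definition toeplitz (n : nat) (s : nat -> R) : 'M[R]_n := \matrix_(i, j) s `|i%:Z - j%:Z|%N.

Lemma tr_toeplitz n s : (toeplitz n s)^T = toeplitz n s.
Proof. by apply/matrixP => i j; rewrite !mxE distnC. Qed.

(* The sum of [g |k|] over all integers [|k| <= m]. *)
Definition symsum (g : nat -> R) (m : nat) := g 0 + 2 * \sum_(k < m) g k.+1.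

(** Passing from size n to n + 1 adds a last row and a last column, together [symsum g n]. Divided
    by n the sum is a Cesaro mean, which is how the limit L of [symsum] reaches the traces. *)
Lemma toeplitz_sum n (g : nat -> R) :
  \sum_(i < n) \sum_(j < n) g `|i%:Z - j%:Z|%N = \sum_(m < n) symsum g m.
Proof.
elim: n => [|n IH]; first by rewrite !big_ord0.
rewrite big_ord_recr /= [in RHS]big_ord_recr /= -IH.
under eq_bigr do rewrite big_ord_recr /=.
rewrite big_split/= -addrA; congr (_ + _).
rewrite big_ord_recr /= distnn /symsum.
have E : \sum_(i < n) g `|i%:Z - n%:Z|%N = \sum_(k < n) g k.+1.
  rewrite (reindex_inj rev_ord_inj)/=; apply: eq_bigr => i _; congr g.
  by rewrite distnEr ?leq_subr// subKn.
rewrite E (_ : \sum_(i < n) g `|n%:Z - i%:Z|%N = \sum_(k < n) g k.+1); first by ring.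
by rewrite -E; apply: eq_bigr => i _; rewrite distnC.
Qed.

(** A row meets each distance at most twice, once on either side of the diagonal. *)
Lemma toeplitz_row_le n (g : nat -> R) (B : R) i : (forall k, 0 <= g k) ->
  (forall N, \sum_(k < N) g k <= B) -> \sum_(j < n) g `|(i : 'I_n)%:Z - j%:Z|%N <= 2 * B.
Proof.
move=> g0 gB; have ni : (i <= n)%N by exact: ltnW.
rewrite -(big_mkord xpredT (fun j => g `|i%:Z - j%:Z|%N)) (@big_cat_nat _ _ _ i)//=.
rewrite mulr_natl mulr2n; apply: lerD.
  rewrite big_nat_rev/= add0n big_mkord; apply: le_trans (gB i.+1).
  rewrite big_ord_recl/= ler_wpDl// ler_sum// => k _.
  by rewrite distnEl ?leq_subr// subKn.
rewrite -{1}[i : nat]add0n big_addn big_mkord; apply: le_trans (gB (n - i)%N).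
by apply: ler_sum => k _; rewrite distnC distnEl ?leq_addl// addnK.
Qed.

Definition band (m : nat) (s : nat -> R) k := if (k <= m)%N then s k else 0.
Definition tail (m : nat) (s : nat -> R) k := if (k <= m)%N then 0 else s k.

Lemma toeplitz_band_tail n m s : toeplitz n s = toeplitz n (band m s) + toeplitz n (tail m s).
Proof. by apply/matrixP => i j; rewrite !mxE /band /tail; case: ifP; rewrite ?addr0 ?add0r. Qed.

Definition bandnorm m (s : nat -> R) := 2 * \sum_(k < m.+1) `|s k|.

Lemma bandnorm_ge0 m s : 0 <= bandnorm m s.
Proof. by rewrite mulr_ge0// sumr_ge0. Qed.

Lemma toeplitz_band_le n m s (v : 'rV[R]_n) :
  \sum_j (v *m toeplitz n (band m s)) ord0 j ^+ 2 <= bandnorm m s ^+ 2 * \sum_i v ord0 i ^+ 2.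
Proof.
have row i : \sum_j `|toeplitz n (band m s) i j| <= bandnorm m s.
  under eq_bigr do rewrite mxE.
  apply: (@toeplitz_row_le n (fun k => `|band m s k|)) => // N.
  apply: (@le_trans _ _ (\sum_(k < N + m.+1) `|band m s k|)).
    by rewrite big_split_ord/= lerDl sumr_ge0.
  rewrite addnC big_split_ord/= [X in _ + X]big1 ?addr0; last first.
    by move=> k _; rewrite /band addSn leqNgt ltnS leq_addr normr0.
  by apply: ler_sum => k _; rewrite /band -ltnS ltn_ord.
apply: schur_test => //; first exact: bandnorm_ge0.
move=> j; apply: le_trans (row j); rewrite le_eqVlt; apply/orP; left; apply/eqP.
by apply: eq_bigr => i _; rewrite -[in LHS]tr_toeplitz mxE.
Qed.

Section Limit.
Variables (s : nat -> R) (L : R).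
Hypothesis sL : symsum (fun k => s k ^+ 2) m @[m --> \oo] --> L.

Let G := symsum (fun k => s k ^+ 2).

Let G_nd : nondecreasing_seq G.
Proof.
apply/nondecreasing_seqP => m; rewrite /G /symsum big_ord_recr/= lerD2l ler_wpM2l//.
by rewrite lerDl sqr_ge0.
Qed.

Let G_le m : G m <= L.
Proof.
rewrite -(cvg_lim _ sL)//; apply: nondecreasing_cvgn_le => //.
by apply/cvg_ex; exists L.
Qed.

Lemma symsum_tail_le m M : symsum (fun k => tail m s k ^+ 2) M <= L - G m.
Proof.
have := G_le (m + M); rewrite /G /symsum big_split_ord/= => GL.
rewrite {1}/tail/= expr0n add0r.
have -> : L - (s 0 ^+ 2 + 2 * \sum_(k < m) s k.+1 ^+ 2) = L - (s 0 ^+ 2 + 2 * \sum_(k < m) s k.+1 ^+ 2) by [].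
suff : \sum_(k < M) tail m s k.+1 ^+ 2 <= \sum_(k < M) s (m + k).+1 ^+ 2 by lra.
apply: (@le_trans _ _ (\sum_(k < m + M) tail m s k.+1 ^+ 2)).
  by rewrite addnC big_split_ord/= lerDl sumr_ge0// => k _; exact: sqr_ge0.
rewrite big_split_ord/= big1 ?add0r.
  by apply: ler_sum => k _; rewrite /tail ltnNge leq_addr.
by move=> k _; rewrite /tail ltn_ord expr0n.
Qed.

Let tail_sum n m : \sum_(i < n) \sum_(j < n) toeplitz n (tail m s) i j ^+ 2 <= n%:R * (L - G m).
Proof.
under eq_bigr do under eq_bigr do rewrite mxE.
rewrite (toeplitz_sum n (fun k => tail m s k ^+ 2)) mulr_natl -[in leRHS](card_ord n) -sumr_const.
by apply: ler_sum => M _; exact: symsum_tail_le.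
Qed.

Section Sequence.
Variables (g : nat -> R) (T C : forall n, 'M[R]_n) (l : forall n, 'rV[R]_n).
Hypothesis g_ge0 : forall n, (0 < n)%N -> 0 <= g n.
Hypothesis g_cvg : g n @[n --> \oo] --> 0.
Hypothesis symT : forall n, (T n)^T = T n.
Hypothesis psdT : forall n (u : 'rV[R]_n), 0 <= (u *m T n *m u^T) ord0 ord0.
Hypothesis trT : forall n, \tr (T n) = n%:R.
Hypothesis CAC : forall n, (0 < n)%N -> C n *m (1%:M + g n *: T n) *m (C n)^T = 1%:M.
Hypothesis CSC : forall n, (0 < n)%N -> C n *m toeplitz n s *m (C n)^T = diag_mx (l n).

Let bounds n m : (0 < n)%N ->
  [/\ \sum_i l n ord0 i ^+ 2 <= \sum_(k < n) G k,
     \sum_(k < n) G k - \sum_i l n ord0 i ^+ 2 <= n%:R * (4 * g n * bandnorm m s ^+ 2 + 2 * (L - G m)) &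
     forall i, `|l n ord0 i| <= bandnorm m s + Num.sqrt (n%:R * (L - G m))].
Proof.
move=> n0.
have h := @sum_sqr_congruence R n (T n) _ _ _ _ _ (g_ge0 n0) (symT n) (psdT (n := n))
  (tr_toeplitz n (band m s)) (tr_toeplitz n (tail m s)) (toeplitz_band_tail n m s)
  (toeplitz_band_le m s) _ _ (CAC n0) (CSC n0).
have h' := @abs_congruence R n (T n) _ _ _ _ _ (g_ge0 n0) (bandnorm_ge0 m s) (psdT (n := n))
  (toeplitz_band_tail n m s)
  (toeplitz_band_le m s) _ _ (CAC n0) (CSC n0).
have sE : \sum_i \sum_j toeplitz n s i j ^+ 2 = \sum_(k < n) G k.
  under eq_bigr do under eq_bigr do rewrite mxE.
  exact: (toeplitz_sum n (fun k => s k ^+ 2)).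
rewrite sE trT in h; have [h1 h2] := h; have ts := tail_sum n m; split => //.
  by apply: le_trans h2 _; rewrite mulrDr; apply: lerD; [rewrite mulrC|rewrite mulrCA ler_wpM2l].
by move=> i; apply: le_trans (h' i) _; rewrite lerD2l ler_wsqrtr.
Qed.

Let eps_small e : 0 < e -> exists m, L - G m < e.
Proof.
move=> e0; have /cvgrPdist_lt/(_ e e0) [m _ hm] := sL.
by exists m; have := hm m (leqnn m); apply: le_lt_trans; exact: ler_norm.
Qed.

Lemma cvg_mean_sqr : n%:R^-1 * \sum_i l n ord0 i ^+ 2 @[n --> \oo] --> L.
Proof.
have mean : n%:R^-1 * \sum_(k < n) G k @[n --> \oo] --> L.
  rewrite -(cvg_shiftS (fun n => n%:R^-1 * \sum_(k < n) G k)).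
  have := cesaro sL; rewrite /arithmetic_mean; apply: cvg_trans; apply: near_eq_cvg.
  by near=> n; rewrite /series/= big_mkord.
apply/cvgrPdist_lt => e e0.
have e6 : 0 < e / 6 by rewrite divr_gt0.
(* The order of choices matters: the bandwidth m is fixed first, so that 2 (L - G m) < e / 3; its
   band norm is then a constant against which [g n] tends to 0. *)
have [m em] := eps_small e6.
have e3 : 0 < e / 3 by rewrite divr_gt0.
have g4 : 4 * g n * bandnorm m s ^+ 2 @[n --> \oo] --> 0.
  rewrite [X in _ --> X](_ : 0 = 4 * 0 * bandnorm m s ^+ 2); last by rewrite mulr0 mul0r.
  by apply: cvgM; [apply: cvgM; [exact: cvg_cst|exact: g_cvg]|exact: cvg_cst].
near=> n.
have n0 : (0 < n)%N by near: n; exists 1%N.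
have n0' : 0 < n%:R :> R by rewrite ltr0n.
have h1 : `|L - n%:R^-1 * \sum_(k < n) G k| < e / 3.
  by near: n; move/cvgrPdist_lt : mean; apply.
have h2 : `|0 - 4 * g n * bandnorm m s ^+ 2| < e / 3.
  by near: n; move/cvgrPdist_lt : g4; apply.
have [b1 b2 _] := bounds m n0.
have b1' : n%:R^-1 * \sum_i l n ord0 i ^+ 2 <= n%:R^-1 * \sum_(k < n) G k by rewrite ler_pM2l// invr_gt0.
have b2' : n%:R^-1 * \sum_(k < n) G k - n%:R^-1 * \sum_i l n ord0 i ^+ 2 <= 4 * g n * bandnorm m s ^+ 2 + 2 * (L - G m).
  by rewrite -mulrBr mulrC ler_pdivrMr// mulrC.
move: h1 h2; rewrite sub0r normrN !ltr_norml => /andP[? ?] /andP[? ?].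
by apply/andP; split; lra.
Unshelve. all: end_near. Qed.

(** The cubes are bounded by max |l_i| times the sum of squares, which is at most n L, and max |l_i|
    is o(sqrt n). *)
Lemma cvg_mean_cube : (n%:R * Num.sqrt n%:R)^-1 * \sum_i `|l n ord0 i| ^+ 3 @[n --> \oo] --> 0.
Proof.
have L0 : 0 <= L by apply: le_trans (G_le 0); rewrite /G /symsum big_ord0 mulr0 addr0 sqr_ge0.
apply/cvgrPdist_lt => e e0.
(* The band and the tail each contribute at most d sqrt n to max |l_i|, so the final bound is 2 d L
   < e. *)
pose d := e / (2 * (L + 1)).
have d0 : 0 < d by rewrite divr_gt0// mulr_gt0// ltr_wpDl.
have [m em] := eps_small (exprn_gt0 2 d0).
have K0 := bandnorm_ge0 m s.
near=> n.
have n0 : (0 < n)%N by near: n; exists 1%N.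
have n0' : 0 < n%:R :> R by rewrite ltr0n.
have s0 : 0 < Num.sqrt n%:R :> R by rewrite sqrtr_gt0.
have Ks : bandnorm m s / d < Num.sqrt n%:R.
  have nK : (bandnorm m s / d) ^+ 2 < n%:R by near: n; exact: nbhs_infty_gtr.
  by rewrite -(ger0_norm (divr_ge0 K0 (ltW d0))) -sqrtr_sqr ltr_sqrt.
have [b1 _ b3] := bounds m n0.
have lm i : `|l n ord0 i| <= 2 * d * Num.sqrt n%:R.
  apply: le_trans (b3 i) _; rewrite -[leRHS]mulrA [leRHS]mulr_natl [leRHS]mulr2n; apply: lerD.
    by rewrite mulrC -ler_pdivrMr// ltW.
  rewrite sqrtrM ?ler0n// [leRHS]mulrC ler_wpM2l ?sqrtr_ge0//.
  by rewrite -[leRHS]gtr0_norm// -sqrtr_sqr ler_wsqrtr// ltW.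
have c0 : 0 <= \sum_i `|l n ord0 i| ^+ 3 by apply: sumr_ge0 => i _; rewrite exprn_ge0.
rewrite sub0r normrN ger0_norm; last by rewrite mulr_ge0// invr_ge0 mulr_ge0// ltW.
rewrite mulrC ltr_pdivrMr ?mulr_gt0//.
apply: (@le_lt_trans _ _ (2 * d * Num.sqrt n%:R * (n%:R * L))).
  apply: (@le_trans _ _ (2 * d * Num.sqrt n%:R * \sum_i l n ord0 i ^+ 2)).
    rewrite mulr_sumr; apply: ler_sum => i _.
    rewrite exprS real_normK ?num_real//; apply: ler_wpM2r; [exact: sqr_ge0|exact: lm].
  apply: ler_wpM2l; first by apply: mulr_ge0; [apply: mulr_ge0 => //; exact: ltW|exact: sqrtr_ge0].
  apply: le_trans b1 _; rewrite mulr_natl -[in leRHS](card_ord n) -sumr_const.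
  by apply: ler_sum => k _; exact: G_le.
have -> : e = 2 * d * (L + 1) by rewrite /d; field; rewrite gt_eqF// ltr_wpDl.
have -> : 2 * d * Num.sqrt n%:R * (n%:R * L) = (n%:R * Num.sqrt n%:R) * (2 * d) * L by ring.
have -> : 2 * d * (L + 1) * (n%:R * Num.sqrt n%:R) = (n%:R * Num.sqrt n%:R) * (2 * d) * (L + 1) by ring.
by rewrite ltr_pM2l ?ltrDl//; apply: mulr_gt0; apply: mulr_gt0.
Unshelve. all: end_near. Qed.

End Sequence.
End Limit.
End Toeplitz.

(** * A continuity theorem for real characteristic functions *)

Section Expectation.
Context {R : realType}.

Definition Ex d (T : measurableType d) (P : probability T R) (f : T -> R) : R :=
  \int[P]_w f w.

Definition bmf d (T : measurableType d) (f : T -> R) :=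
  measurable_fun [set: T] f /\ exists B : R, forall w, `|f w| <= B.

Section Basics.
Context d (T : measurableType d) (P : probability T R).
Implicit Types f g : T -> R.

Lemma bmf_integrable f : bmf f -> P.-integrable [set: T] (EFin \o f).
Proof.
move=> [mf [B fB]]; apply: measurable_bounded_integrable => //.
  have h : (P [set: T] < +oo)%E by rewrite probability_setT ltry.
  exact: h.
exists B; split; first exact: num_real.
by move=> M BM w _ /=; exact: le_trans (fB w) (ltW BM).
Qed.

Lemma bmf_cst (c : R) : bmf (fun _ : T => c).
Proof. by split; [exact: measurable_cst|exists `|c|]. Qed.

Lemma bmfD f g : bmf f -> bmf g -> bmf (fun w => f w + g w).
Proof.
move=> [mf [B fB]] [mg [C gC]]; split; first exact: measurable_funD.
by exists (B + C) => w; rewrite (le_trans (ler_normD _ _))// lerD.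
Qed.

Lemma bmfB f g : bmf f -> bmf g -> bmf (fun w => f w - g w).
Proof.
move=> [mf [B fB]] [mg [C gC]]; split; first exact: measurable_funB.
by exists (B + C) => w; rewrite (le_trans (ler_normB _ _))// lerD.
Qed.

Lemma bmfM f g : bmf f -> bmf g -> bmf (fun w => f w * g w).
Proof.
move=> [mf [B fB]] [mg [C gC]]; split; first exact: measurable_funM.
by exists (B * C) => w; rewrite normrM ler_pM.
Qed.

Lemma bmfZ (c : R) f : bmf f -> bmf (fun w => c * f w).
Proof. by apply: bmfM; exact: bmf_cst. Qed.

Lemma bmf_sum I (s : seq I) (F : I -> T -> R) :
  (forall i, bmf (F i)) -> bmf (fun w => \sum_(i <- s) F i w).
Proof.
move=> bF; elim: s => [|i s IH].
  by under eq_fun do rewrite big_nil; exact: bmf_cst.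
by under eq_fun do rewrite big_cons; exact: bmfD.
Qed.

Lemma bmf_norm f : bmf f -> bmf (fun w => `|f w|).
Proof.
move=> [mf [B fB]]; split; first exact: measurableT_comp.
by exists B => w; rewrite normr_id.
Qed.

Lemma Ex_cst c : Ex P (fun=> c) = c.
Proof.
transitivity (c * fine (P [set: T])); first exact: Rintegral_cst.
by rewrite probability_setT mulr1.
Qed.

Lemma ExD f g : bmf f -> bmf g -> Ex P (fun w => f w + g w) = Ex P f + Ex P g.
Proof. by move=> bf bg; rewrite /Ex RintegralD//; exact: bmf_integrable. Qed.

Lemma ExB f g : bmf f -> bmf g -> Ex P (fun w => f w - g w) = Ex P f - Ex P g.
Proof. by move=> bf bg; rewrite /Ex RintegralB//; exact: bmf_integrable. Qed.

Lemma ExZ c f : bmf f -> Ex P (fun w => c * f w) = c * Ex P f.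
Proof. by move=> bf; rewrite /Ex RintegralZl//; exact: bmf_integrable. Qed.

Lemma Ex_sum I (s : seq I) (F : I -> T -> R) :
  (forall i, bmf (F i)) -> Ex P (fun w => \sum_(i <- s) F i w) = \sum_(i <- s) Ex P (F i).
Proof.
move=> bF; elim: s => [|i s IH].
  by rewrite big_nil; under [X in Ex _ X]eq_fun do rewrite big_nil; rewrite Ex_cst.
rewrite big_cons -IH -ExD//; last exact: bmf_sum.
by congr Ex; apply/funext => w; rewrite big_cons.
Qed.

Lemma Ex_le f g : bmf f -> bmf g -> (forall w, f w <= g w) -> Ex P f <= Ex P g.
Proof. by move=> bf bg fg; apply: le_Rintegral => //; exact: bmf_integrable. Qed.

Lemma Ex_norm f : bmf f -> `|Ex P f| <= Ex P (fun w => `|f w|).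
Proof. by move=> bf; apply: le_normr_Rintegral => //; exact: bmf_integrable. Qed.

Lemma Ex_norm_le f B : bmf f -> (forall w, `|f w| <= B) -> `|Ex P f| <= B.
Proof.
move=> bf fB; apply: le_trans (Ex_norm bf) _.
by rewrite -[leRHS]Ex_cst; apply: Ex_le => //; [exact: bmf_norm|exact: bmf_cst].
Qed.

Lemma expectation_Ex f : bmf f -> ('E_P[f] = (Ex P f)%:E)%E.
Proof.
move=> bf; rewrite unlock /Ex /Rintegral fineK//.
by apply: integrable_fin_num => //; exact: bmf_integrable.
Qed.

Lemma bmf_cos (W : T -> R) c : measurable_fun [set: T] W -> bmf (fun w => cos (W w + c)).
Proof.
move=> mW; split; last by exists 1 => w; exact: cos_max.
apply: measurableT_comp => /=; last exact: measurable_funD.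
by apply: continuous_measurable_fun; exact: continuous_cos.
Qed.

Lemma bmf_comp (h : R -> R) (W : T -> R) (B : R) : continuous h -> (forall x, `|h x| <= B) ->
  measurable_fun [set: T] W -> bmf (fun w => h (W w)).
Proof.
move=> ch hB mW; split; last by exists B.
by apply: measurableT_comp => //; apply: continuous_measurable_fun.
Qed.

Lemma Ex_dct (f_ : nat -> T -> R) f B : (forall n, measurable_fun [set: T] (f_ n)) ->
  (forall n w, `|f_ n w| <= B) -> (forall w, f_ ^~ w @ \oo --> f w) ->
  Ex P (f_ n) @[n --> \oo] --> Ex P f.
Proof.
move=> mf fB cf.
have mfl : measurable_fun [set: T] f by apply: (measurable_fun_cvg mf) => x _; exact: cf.
have [] := @dominated_convergence _ _ _ P _ measurableT (fun n => EFin \o f_ n) (EFin \o f)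
   (EFin \o (fun=> B)).
- by move=> n; exact/measurable_EFinP.
- exact/measurable_EFinP.
- by apply: aeW => x _; apply: cvg_EFin; [exact: nearW|exact: cf].
- exact/bmf_integrable/bmf_cst.
- by apply: aeW => x n _; rewrite lee_fin.
move=> intf _ cv; rewrite /Ex /Rintegral; apply: fine_cvg.
by rewrite fineK; [exact: cv|exact: integrable_fin_num].
Qed.

End Basics.

End Expectation.

(** * Taylor inequalities with explicit remainders *)

Section Taylor.
Context {R : realType}.

(** The rung of a ladder: each Taylor inequality below for sine or cosine is the derivative of the
    next one. *)
Lemma ge0_of_derive (f df : R -> R) : (forall x : R, is_derive x 1 f (df x)) ->
  (forall x, 0 <= x -> 0 <= df x) -> 0 <= f 0 -> forall x, 0 <= x -> 0 <= f x.
Proof.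
move=> fD df0 f0 x x0.
have hc : {within `[0, x], continuous f}.
  apply: continuous_subspaceT => y.
  by apply/differentiable_continuous/derivable1_diffP; case: (fD y).
have [c] := MVT_segment x0 (fun y _ => fD y) hc.
rewrite in_itv/= => /andP[c0 _] E.
have : 0 <= f x - f 0 by rewrite E mulr_ge0 ?df0// subr0.
lra.
Qed.

Lemma sin_leid (x : R) : 0 <= x -> sin x <= x.
Proof.
move=> x0; rewrite -subr_ge0; move: x x0.
apply: (@ge0_of_derive (fun x : R => x - sin x) (fun x => 1 - cos x)).
- by move=> x _; rewrite subr_ge0 cos_le1.
- by rewrite sin0 subrr.
Qed.

Lemma cos_ge_taylor (x : R) : 1 - x ^+ 2 / 2 <= cos x.
Proof.
wlog x0 : x / 0 <= x.
  move=> h; case: (leP 0 x) => [/h//|/ltW]; rewrite -oppr_ge0 => /h.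
  by rewrite cosN sqrrN.
rewrite -subr_ge0; move: x x0.
apply: (@ge0_of_derive _ (fun x => x - sin x)).
- by move=> x; apply: is_derive_eq; rewrite /GRing.scale/=; field.
- by move=> x x0; rewrite subr_ge0 sin_leid.
- by rewrite cos0 expr0n/= mul0r subr0 subrr.
Qed.

Lemma sin_ge_taylor (x : R) : 0 <= x -> x - x ^+ 3 / 6 <= sin x.
Proof.
move=> x0; rewrite -subr_ge0; move: x x0.
apply: (@ge0_of_derive _ (fun x => cos x - (1 - x ^+ 2 / 2))).
- by move=> x; apply: is_derive_eq; rewrite /GRing.scale/=; field.
- by move=> x _; rewrite subr_ge0 cos_ge_taylor.
- by rewrite sin0 expr0n/= mul0r !subr0.
Qed.

Lemma cos_le_taylor (x : R) : cos x <= 1 - x ^+ 2 / 2 + x ^+ 4 / 24.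
Proof.
wlog x0 : x / 0 <= x.
  move=> h; case: (leP 0 x) => [/h//|/ltW]; rewrite -oppr_ge0 => /h.
  by rewrite cosN sqrrN (_ : (- x) ^+ 4 = x ^+ 4)//; ring.
rewrite -subr_ge0; move: x x0.
apply: (@ge0_of_derive _ (fun x => sin x - (x - x ^+ 3 / 6))).
- by move=> x; apply: is_derive_eq; rewrite /GRing.scale/=; field.
- by move=> x x0; rewrite subr_ge0 sin_ge_taylor.
- by rewrite cos0 !expr0n/= !mul0r subr0 addr0 subrr.
Qed.

Lemma sin_taylor_abs (x : R) : `|sin x - x| <= `|x| ^+ 3 / 6.
Proof.
wlog x0 : x / 0 <= x.
  move=> h; case: (leP 0 x) => [/h//|/ltW]; rewrite -oppr_ge0 => /h.
  by rewrite sinN -opprD !normrN.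
rewrite (ger0_norm x0) distrC ger0_norm ?subr_ge0 ?sin_leid//.
by have := sin_ge_taylor x0; lra.
Qed.

Lemma cos_taylor_abs (x : R) : `|cos x - (1 - x ^+ 2 / 2)| <= x ^+ 4 / 24.
Proof.
rewrite ger0_norm ?subr_ge0 ?cos_ge_taylor//.
by have := cos_le_taylor x; lra.
Qed.

(** Below 1 the quartic remainder is smaller than the cube; above 1 the difference is at most x^2 /
    2 because cos x <= 1. A cubic bound keeps the moment in [chi3] at order three. *)
Lemma cos_taylor3 (x : R) : `|cos x - (1 - x ^+ 2 / 2)| <= `|x| ^+ 3.
Proof.
have := cos_taylor_abs x; have := cos_ge_taylor x; have := cos_le1 x.
have x2 : x ^+ 2 = `|x| ^+ 2 by rewrite real_normK// num_real.
have x4 : x ^+ 4 = `|x| ^+ 4 by rewrite (exprM x 2 2) x2 -exprM.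
rewrite x2 x4; have : 0 <= `|x| by [].
move: `|x| (cos x) => y c y0 c1 c2.
rewrite ger0_norm; last lra.
move=> h; case: (leP y 1) => y1.
  apply: le_trans h _; have -> : y ^+ 4 = y ^+ 3 * y by ring.
  have : 0 <= y ^+ 3 by exact: exprn_ge0.
  by nra.
have : y ^+ 2 <= y ^+ 3 by rewrite ler_eXn2l ?ltW.
lra.
Qed.

Lemma expRN_taylor (x : R) : 0 <= x -> `|expR (- x) - (1 - x)| <= x ^+ 2 / 2.
Proof.
move=> x0.
have h1 : 1 - x <= expR (- x) by exact: expR_ge1Dx.
rewrite ger0_norm ?subr_ge0// -subr_ge0; move: x x0 {h1}.
apply: (@ge0_of_derive _ (fun x => x - 1 + expR (- x))).
- by move=> x; apply: is_derive_eq; rewrite /GRing.scale/=; field.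
- by move=> x x0; have := expR_ge1Dx (- x); lra.
- by rewrite oppr0 expR0 expr0n/= mul0r; lra.
Qed.

End Taylor.

Section Levy.
Context {R : realType}.

Definition cdot k (u y : 'cV[R]_k) : R := (u^T *m y) ord0 ord0.

Lemma cdotE k (u y : 'cV[R]_k) : cdot u y = \sum_i u i ord0 * y i ord0.
Proof. by rewrite /cdot mxE; apply: eq_bigr => i _; rewrite mxE. Qed.

Definition cvmeas d (T : measurableType d) k (Y : T -> 'cV[R]_k) :=
  forall i, measurable_fun [set: T] (fun w => Y w i ord0).

Lemma cvmeas_cdot d (T : measurableType d) k (Y : T -> 'cV[R]_k) (u : 'cV[R]_k) :
  cvmeas Y -> measurable_fun [set: T] (fun w => cdot u (Y w)).
Proof.
move=> mY; under eq_fun do rewrite cdotE.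
apply: measurable_sum => i; exact: measurable_funM.
Qed.

Lemma bmf_trig d (T : measurableType d) k (Y : T -> 'cV[R]_k) (f : 'cV[R]_k -> R) :
  cvmeas Y -> trigpoly f -> bmf (fun w => f (Y w)).
Proof.
move=> mY; elim=> [u c|f1 f2 _ h1 _ h2|a f1 _ h1].
- by apply: bmf_cos; exact: cvmeas_cdot.
- exact: bmfD.
- exact: bmfZ.
Qed.

(** Measurability of g(Y) is derived from that of the coordinates of Y: g is a pointwise limit of
    trigonometric polynomials, the n-th one being within 1 / (n + 1) of g on the box of half-width
    n. *)
Lemma bmf_cont d (T : measurableType d) k (Y : T -> 'cV[R]_k) (g : 'cV[R]_k -> R) (B : R) :
  cvmeas Y -> continuous g -> (forall y, `|g y| <= B) -> bmf (fun w => g (Y w)).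
Proof.
move=> mY cg gB; split; last by exists B.
have /choice[F FP] : forall n : nat, exists f : 'cV[R]_k -> R, trigpoly f /\
    forall y : 'cV[R]_k, (forall i, `|y i ord0| <= n%:R) -> `|f y - g y| <= n.+1%:R^-1.
  move=> n; have [|f [tf _ fg]] := trig_approx_local n%:R cg gB (e := n.+1%:R^-1).
    by rewrite invr_gt0.
  by exists f.
apply: (@measurable_fun_cvg _ _ _ _ (fun n w => F n (Y w))).
  by move=> n; have [] := bmf_trig mY (FP n).1.
move=> w _; apply/cvgrPdist_le => e e0.
pose M := \sum_i `|Y w i ord0|.
near=> n; rewrite distrC; apply: le_trans ((FP n).2 _ _) _.
  move=> i; apply: (@le_trans _ _ M).
    by rewrite /M (bigD1 i)//= lerDl sumr_ge0.
  by near: n; exact: nbhs_infty_ger.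
rewrite -[leRHS]invrK lef_pV2 ?posrE ?invr_gt0//.
apply: (@le_trans _ _ n%:R); last by rewrite ler_nat.
by near: n; exact: nbhs_infty_ger.
Unshelve. all: end_near. Qed.

(** For L > 0, a continuous majorant of the indicator of |x| > L. *)
Definition sqcap (L x : R) := Num.min 1 (x ^+ 2 / L ^+ 2).

Lemma continuous_sqcap L : continuous (sqcap L).
Proof.
move=> x; apply: (@continuous_min _ _ (fun=> 1) (fun x : R => x ^+ 2 / L ^+ 2)); first exact: cvg_cst.
by apply: cvgM; [exact: exprn_continuous|exact: cvg_cst].
Qed.

Lemma sqcap_ge0 L x : 0 <= sqcap L x.
Proof. by rewrite le_min ler01 divr_ge0 ?sqr_ge0. Qed.

Lemma sqcap_bound L x : `|sqcap L x| <= 1.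
Proof. by rewrite ger0_norm ?sqcap_ge0// ge_min lexx. Qed.

(* Since [2 (1 - cos (t x)) / t ^ 2] increases to [x ^ 2], a quadratic bound on the
   characteristic function at 0 controls the tails. *)
Lemma tail_bound d (T : measurableType d) (P : probability T R) (W : T -> R) (C L : R) :
  measurable_fun [set: T] W -> 0 < L ->
  (forall t : R, 0 < t -> t <= 1 -> 1 - Ex P (fun w => cos (t * W w)) <= C * t ^+ 2) ->
  Ex P (fun w => sqcap L (W w)) <= 2 * C / L ^+ 2.
Proof.
move=> mW L0 hC.
pose q (n : nat) (x : R) := 2 * (1 - cos (n.+1%:R^-1 * x)) * n.+1%:R ^+ 2 / L ^+ 2.
have q0 n x : 0 <= q n x.
  by rewrite /q !mulr_ge0 ?invr_ge0 ?sqr_ge0// subr_ge0 cos_le1.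
have cq n : continuous (q n).
  move=> x; rewrite /q; apply: cvgM; last exact: cvg_cst.
  apply: cvgM; last exact: cvg_cst.
  apply: cvgM; first exact: cvg_cst.
  apply: cvgB; first exact: cvg_cst.
  apply: (@continuous_comp _ _ _ (fun x : R => n.+1%:R^-1 * x) cos); last exact: continuous_cos.
  by apply: cvgM; [exact: cvg_cst|exact: cvg_id].
have qB n x : `|q n x| <= 4 * n.+1%:R ^+ 2 / L ^+ 2.
  rewrite (ger0_norm (q0 _ _)) /q ler_wpM2r ?invr_ge0 ?sqr_ge0// ler_wpM2r ?sqr_ge0//.
  by have := cos_geN1 (n.+1%:R^-1 * x); lra.
have bq n := bmf_comp (cq n) (qB n) mW.
pose f (n : nat) w := Num.min 1 (q n (W w)).
have bf n : bmf (f n).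
  apply: (@bmf_comp _ _ _ (fun x => Num.min 1 (q n x)) W 1) => //.
    move=> x; apply: (@continuous_min _ _ (fun=> 1) (q n)); [exact: cvg_cst|exact: cq].
  by move=> x; rewrite ger0_norm ?ge_min ?lexx// le_min ler01 q0.
have fE n : Ex P (f n) <= 2 * C / L ^+ 2.
  apply: (@le_trans _ _ (Ex P (fun w => q n (W w)))).
    by apply: Ex_le => // w; rewrite /f ge_min lexx orbT.
  rewrite /q; have mt : measurable_fun [set: T] (fun w => n.+1%:R^-1 * W w) by exact: measurable_funM.
  have bc : bmf (fun w => cos (n.+1%:R^-1 * W w)).
    by have := bmf_cos 0 mt; under eq_fun do rewrite addr0.
  have -> : (fun w => 2 * (1 - cos (n.+1%:R^-1 * W w)) * n.+1%:R ^+ 2 / L ^+ 2) =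
     (fun w => (2 * n.+1%:R ^+ 2 / L ^+ 2) * (1 - cos (n.+1%:R^-1 * W w))).
    by apply/funext => w; ring.
  rewrite ExZ; last by apply: bmfB => //; exact: bmf_cst.
  rewrite ExB//; last exact: bmf_cst.
  rewrite Ex_cst; have n0 : 0 < n.+1%:R^-1 :> R by rewrite invr_gt0.
  have n1 : n.+1%:R^-1 <= 1 :> R by rewrite invf_le1// ler1n.
  apply: le_trans (ler_wpM2l _ (hC _ n0 n1)) _.
    by rewrite !mulr_ge0// ?invr_ge0 sqr_ge0.
  rewrite le_eqVlt; apply/orP; left; apply/eqP; field.
  by rewrite gt_eqF//= addrC natr1 pnatr_eq0.
have cv : Ex P (f n) @[n --> \oo] --> Ex P (fun w => sqcap L (W w)).
  apply: (@Ex_dct _ _ _ P f _ 1).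
  - by move=> n; have [] := bf n.
  - by move=> n w; rewrite /f ger0_norm ?ge_min ?lexx// le_min ler01 q0.
  move=> w; rewrite /f /sqcap.
  apply: (@cvg_comp _ _ _ (fun n => q n (W w)) (Num.min 1) _ (nbhs (W w ^+ 2 / L ^+ 2))); last first.
    exact: (@continuous_min _ _ (fun=> 1 : R) id _ (cvg_cst _) cvg_id).
  rewrite /q; apply: cvgM; last exact: cvg_cst.
  apply/cvgrPdist_le => e e0; near=> n.
  have n0 : n.+1%:R != 0 :> R by rewrite pnatr_eq0.
  have h := cos_taylor_abs (n.+1%:R^-1 * W w).
  have -> : W w ^+ 2 - 2 * (1 - cos (n.+1%:R^-1 * W w)) * n.+1%:R ^+ 2 =
    2 * n.+1%:R ^+ 2 * (cos (n.+1%:R^-1 * W w) - (1 - (n.+1%:R^-1 * W w) ^+ 2 / 2)).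
    by field; rewrite addrC natr1.
  rewrite normrM ger0_norm ?mulr_ge0 ?sqr_ge0//.
  apply: le_trans (ler_wpM2l _ h) _; first by rewrite mulr_ge0 ?sqr_ge0.
  have -> : 2 * n.+1%:R ^+ 2 * ((n.+1%:R^-1 * W w) ^+ 4 / 24) = (W w ^+ 4 / 12) * n.+1%:R^-1 ^+ 2.
    by field; rewrite addrC natr1.
  apply: (@le_trans _ _ ((W w ^+ 4 / 12) * n.+1%:R^-1)).
    rewrite ler_wpM2l ?divr_ge0//; first by rewrite (exprM _ 2 2) sqr_ge0.
    by rewrite expr2 ler_piMr ?invr_ge0// invf_le1// ler1n.
  rewrite ler_pdivrMr// [leRHS]mulrC -ler_pdivrMr//; apply: (@le_trans _ _ n%:R); last by rewrite ler_nat.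
  by near: n; exact: nbhs_infty_ger.
rewrite -(cvg_lim _ cv)//; apply: limr_le; first by apply/cvg_ex; exists (Ex P (fun w => sqcap L (W w))).
by near=> n.
Unshelve. all: end_near. Qed.

(** Inside the box the difference is at most e; outside it is at most 2 B, charged to the coordinate
    that leaves the box. The absolute value is inside the expectation so that the estimate survives
    multiplication by a bounded factor. *)
Lemma trig_Ex_absdiff d (T : measurableType d) (P : probability T R) k (Y : T -> 'cV[R]_k)
   (g f : 'cV[R]_k -> R) (B L C e : R) : cvmeas Y -> 0 < L -> 0 <= e -> 0 <= B ->
  (forall i (t : R), 0 < t -> t <= 1 -> 1 - Ex P (fun w => cos (t * Y w i ord0)) <= C * t ^+ 2) ->
  continuous g -> (forall y, `|g y| <= B) -> trigpoly f -> (forall y, `|f y| <= B) ->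
  (forall y : 'cV[R]_k, (forall i, `|y i ord0| <= L) -> `|f y - g y| <= e) ->
  Ex P (fun w => `|f (Y w) - g (Y w)|) <= e + 2 * B * (k%:R * (2 * C / L ^+ 2)).
Proof.
move=> mY L0 e0 B0 hC cg gB tf fB fg.
have bg := bmf_cont mY cg gB; have bf := bmf_trig mY tf.
have bs i : bmf (fun w => sqcap L (Y w i ord0)).
  by apply: (bmf_comp (@continuous_sqcap L) (sqcap_bound L)); exact: mY.
have bss : bmf (fun w => \sum_i sqcap L (Y w i ord0)) by exact: bmf_sum.
apply: (@le_trans _ _ (Ex P (fun w => e + 2 * B * \sum_i sqcap L (Y w i ord0)))).
  apply: Ex_le; [exact/bmf_norm/bmfB|by apply: bmfD; [exact: bmf_cst|exact: bmfZ]|].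
  move=> w; case: (pselect (forall i, `|Y w i ord0| <= L)) => h.
    apply: le_trans (fg _ h) _; rewrite lerDl !mulr_ge0// sumr_ge0// => i _.
    exact: sqcap_ge0.
  have [i hi] : exists i, L < `|Y w i ord0|.
    by apply: contrapT => h2; apply: h => i; rewrite leNgt; apply/negP => h3; apply: h2; exists i.
  apply: (@le_trans _ _ (2 * B)).
    by rewrite (le_trans (ler_normB _ _))// mulr_natl mulr2n lerD.
  rewrite -[leLHS]add0r lerD// -[leLHS]mulr1 ler_wpM2l ?mulr_ge0//.
  rewrite (bigD1 i)//= -[leLHS]addr0 lerD//; last first.
    by rewrite sumr_ge0// => j _; exact: sqcap_ge0.
  rewrite /sqcap le_min lexx/= ler_pdivlMr ?exprn_gt0// mul1r -[leRHS]real_normK ?num_real//.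
  by rewrite lerXn2r ?nnegrE ?ltW// (lt_trans L0).
rewrite ExD; [|exact: bmf_cst|exact: bmfZ].
rewrite Ex_cst ExZ// Ex_sum// lerD2l ler_wpM2l ?mulr_ge0//.
apply: (@le_trans _ _ (\sum_(i < k) (2 * C / L ^+ 2))).
  by apply: ler_sum => i _; apply: tail_bound => //; exact: hC.
by rewrite sumr_const card_ord -[X in X <= _]mulr_natl.
Qed.

Lemma trig_Ex_diff d (T : measurableType d) (P : probability T R) k (Y : T -> 'cV[R]_k)
   (g f : 'cV[R]_k -> R) (B L C e : R) : cvmeas Y -> 0 < L -> 0 <= e -> 0 <= B ->
  (forall i (t : R), 0 < t -> t <= 1 -> 1 - Ex P (fun w => cos (t * Y w i ord0)) <= C * t ^+ 2) ->
  continuous g -> (forall y, `|g y| <= B) -> trigpoly f -> (forall y, `|f y| <= B) ->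
  (forall y : 'cV[R]_k, (forall i, `|y i ord0| <= L) -> `|f y - g y| <= e) ->
  `|Ex P (fun w => f (Y w)) - Ex P (fun w => g (Y w))| <= e + 2 * B * (k%:R * (2 * C / L ^+ 2)).
Proof.
move=> mY L0 e0 B0 hC cg gB tf fB fg.
have bg := bmf_cont mY cg gB; have bf := bmf_trig mY tf.
rewrite -ExB//; apply: le_trans (Ex_norm _ (bmfB bf bg)) _.
exact: trig_Ex_absdiff.
Qed.

(** One constant C for all n and for the limit gives tightness: replacing a test function by a
    trigonometric polynomial costs the same in every expectation, and on trigonometric polynomials
    convergence follows from the hypothesis by linearity. *)
Lemma levy k (d : nat -> measure_display) (T : forall n, measurableType (d n))
    (P : forall n, probability (T n) R) (Y : forall n, T n -> 'cV[R]_k)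
    (d' : measure_display) (T' : measurableType d') (Q : probability T' R)
    (G : T' -> 'cV[R]_k) (C : R) :
  (forall n, cvmeas (Y n)) -> cvmeas G ->
  (forall (u : 'cV[R]_k) c, Ex (P n) (fun w => cos (cdot u (Y n w) + c)) @[n --> \oo] -->
     Ex Q (fun w => cos (cdot u (G w) + c))) ->
  (forall n i (t : R), 0 < t -> t <= 1 -> 1 - Ex (P n) (fun w => cos (t * Y n w i ord0)) <= C * t ^+ 2) ->
  (forall i (t : R), 0 < t -> t <= 1 -> 1 - Ex Q (fun w => cos (t * G w i ord0)) <= C * t ^+ 2) ->
  cvg_in_distribution P Y Q G.
Proof.
move=> mY mG cvc hY hG; split=> [n i|g cg [B gB]]; first exact: mY.
have bY n := bmf_cont (mY n) cg gB; have bG := bmf_cont mG cg gB.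
rewrite (expectation_Ex Q bG).
under eq_fun do rewrite (expectation_Ex _ (bY _)).
apply: cvg_EFin; first exact: nearW.
rewrite /comp/=.
have B0 : 0 <= B by exact: le_trans (gB 0).
apply/cvgrPdist_le => e e0.
pose K := 2 * B * (k%:R * (2 * C)).
(* The tail contribution is then at most e / 8; the final budget consists of three terms e / 4 and
   two terms e / 8. *)
pose L := Num.sqrt (8 * `|K| / e) + 1.
have L0 : 0 < L by rewrite ltr_wpDl.
have KL : K / L ^+ 2 <= e / 8.
  rewrite ler_pdivrMr ?exprn_gt0//; apply: le_trans (ler_norm _) _.
  rewrite mulrC -ler_pdivrMr ?divr_gt0// invf_div mulrA.
  have h : 0 <= 8 * `|K| / e by rewrite divr_ge0 ?mulr_ge0// ltW.
  rewrite (mulrC `|K|) -[leLHS](sqr_sqrtr h).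
  by rewrite lerXn2r ?nnegrE ?sqrtr_ge0 ?(ltW L0)// /L lerDl.
have e40 : 0 < e / 4 by rewrite divr_gt0.
have [f [tf fB fg]] := trig_approx_local L cg gB e40.
have KE : 2 * B * (k%:R * (2 * C / L ^+ 2)) = K / L ^+ 2 by rewrite /K; ring.
have dG := trig_Ex_diff mG L0 (ltW e40) B0 hG cg gB tf fB fg.
have dY n := trig_Ex_diff (mY n) L0 (ltW e40) B0 (hY n) cg gB tf fB fg.
have cvf : Ex (P n) (fun w => f (Y n w)) @[n --> \oo] --> Ex Q (fun w => f (G w)).
  elim: tf {fB fg dG dY} => [u c|f1 f2 t1 h1 t2 h2|a f1 t1 h1].
  - exact: cvc.
  - rewrite ExD; [|exact: bmf_trig|exact: bmf_trig].
    by under eq_fun do (rewrite ExD; [|exact: bmf_trig|exact: bmf_trig]); exact: cvgD.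
  - rewrite ExZ; last exact: bmf_trig.
    by under eq_fun do (rewrite ExZ; last exact: bmf_trig); apply: cvgM => //; exact: cvg_cst.
near=> n.
have h3 : `|Ex Q (fun w => f (G w)) - Ex (P n) (fun w => f (Y n w))| <= e / 4.
  by near: n; move/cvgrPdist_le : cvf; exact.
have h1 := dG; have h2 := dY n; move: h1 h2 h3 KL; rewrite KE.
move: (Ex Q _) (Ex Q _) (Ex (P n) _) (Ex (P n) _) (K / _) => a1 a2 a3 a4 a5.
rewrite !ler_norml => /andP[? ?] /andP[? ?] /andP[? ?] ?; apply/andP; split; lra.
Unshelve. all: end_near. Qed.

End Levy.

(** * Gaussian laws and sums of chi-squares *)

Section NormalLaw.
Context {R : realType}.
Local Notation mu := (@lebesgue_measure R).

(** The Radon-Nikodym derivative agrees almost everywhere with the normal density, since both have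
    the same integral over every measurable set. *)
Lemma integral_normal_prob (s : R) (f : R -> R) : measurable_fun [set: R] f ->
  (\int[normal_prob 0 s]_x `|(f x)%:E| < +oo)%E ->
  (\int[normal_prob 0 s]_x (f x)%:E = \int[mu]_x ((f x)%:E * (normal_pdf 0 s x)%:E))%E.
Proof.
move=> mf finf.
have dom := normal_prob_dominates (0 : R) s.
rewrite -(Radon_Nikodym_change_of_variables dom)//=; last first.
  by apply/integrableP; split => //; exact/measurable_EFinP.
apply: ae_eq_integral => //.
- apply: emeasurable_funM; first exact/measurable_EFinP.
  by apply: (measurable_int mu); apply: Radon_Nikodym_integrable; exact: dom.
- apply: emeasurable_funM; first exact/measurable_EFinP.
  by apply: measurableT_comp => //; exact: measurable_normal_pdf.
apply: ae_eqe_mul2l => /=.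
rewrite Radon_NikodymE//=; case: cid => /= h [h1 h2 h3].
apply: integral_ae_eq => //=.
- by apply: measurableT_comp => //; exact: measurable_normal_pdf.
- by move=> E _ mE; rewrite -h3.
Qed.

Variable s : R.
Hypothesis s0 : 0 < s.

Definition phi (x : R) := normal_pdf 0 s x.

(* Gaussian domination: this bounds every polynomial, and its product with the density
   is again integrable. *)
Definition gdom (x : R) := expR (x ^+ 2 / (4 * s ^+ 2)).

Lemma phiE x : phi x = normal_peak s * expR (- (x ^+ 2 / (2 * s ^+ 2))).
Proof.
rewrite /phi normal_pdfE ?gt_eqF// /normal_fun subr0 mulNr; congr (_ * expR (- (_ / _))).
by rewrite -mulr_natl.
Qed.

Lemma phi_ge0 x : 0 <= phi x. Proof. exact: normal_pdf_ge0. Qed.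

Lemma continuous_phi : continuous phi.
Proof. by apply: continuous_normal_pdf; rewrite gt_eqF. Qed.

Lemma is_derive_phi (x : R) : is_derive x 1 phi (- (x / s ^+ 2) * phi x).
Proof.
have -> : phi = (fun x => normal_peak s * expR (- (x ^+ 2 / (2 * s ^+ 2)))).
  by apply/funext => y; rewrite phiE.
apply: is_derive_eq; rewrite /GRing.scale/=; field.
by rewrite gt_eqF.
Qed.

(** The exponents add up to - x^2 / (4 s^2), that of a centred normal density with doubled
    variance. *)
Lemma gdom_phi x : gdom x * phi x = Num.sqrt 2 * normal_pdf 0 (Num.sqrt 2 * s) x.
Proof.
have q0 : 0 < Num.sqrt 2 :> R by rewrite sqrtr_gt0.
rewrite normal_pdfE ?gt_eqF ?mulr_gt0// phiE /gdom /normal_fun subr0 /normal_peak.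
rewrite exprMn sqr_sqrtr// mulrCA -expRD.
set b := Num.sqrt (s ^+ 2 * pi *+ 2).
have b0 : 0 < b by rewrite sqrtr_gt0 mulrn_wgt0// mulr_gt0 ?pi_gt0 ?exprn_gt0.
have -> : Num.sqrt (2 * s ^+ 2 * pi *+ 2) = Num.sqrt 2 * b.
  by rewrite -sqrtrM//; congr Num.sqrt; ring.
have -> : x ^+ 2 / (4 * s ^+ 2) - x ^+ 2 / (2 * s ^+ 2) = - x ^+ 2 / (2 * s ^+ 2 *+ 2).
  by rewrite -mulr_natl mulNr; field; rewrite gt_eqF.
by field; rewrite !gt_eqF.
Qed.

Lemma integrable_gdom_phi : mu.-integrable [set: R] (fun x => (gdom x * phi x)%:E).
Proof.
under eq_fun do rewrite gdom_phi EFinM.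
by apply: integrableZl => //; exact: integrable_normal_pdf.
Qed.

Definition gbnd (f : R -> R) := continuous f /\ exists K : R, forall x, `|f x| <= K * gdom x.

Lemma gdom_ge1 x : 1 <= gdom x.
Proof. by rewrite -expR0 ler_expR mulr_ge0 ?sqr_ge0// invr_ge0 mulr_ge0 ?sqr_ge0. Qed.

Lemma gbnd_integrable f : gbnd f -> mu.-integrable [set: R] (fun x => (f x * phi x)%:E).
Proof.
move=> [cf [K fK]].
have cfp : continuous (fun x => f x * phi x).
  by move=> x; apply: cvgM; [exact: cf|exact: continuous_phi].
have h : mu.-integrable [set: R] (fun x => (K * (gdom x * phi x))%:E).
  under eq_fun do rewrite EFinM.
  by apply: integrableZl => //; exact: integrable_gdom_phi.
apply: (le_integrable measurableT _ _ h).
- by apply/measurable_EFinP; exact: continuous_measurable_fun.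
- move=> x _; rewrite !abse_EFin lee_fin normrM (ger0_norm (phi_ge0 x)).
  by apply: le_trans (ler_norm _); rewrite mulrA ler_wpM2r ?phi_ge0.
Qed.

Definition nE (f : R -> R) : R := \int[mu]_x (f x * phi x).

Lemma nED f g : gbnd f -> gbnd g -> nE (fun x => f x + g x) = nE f + nE g.
Proof.
move=> bf bg; rewrite /nE -RintegralD//; [|exact: gbnd_integrable|exact: gbnd_integrable].
by apply: eq_Rintegral => x _; rewrite mulrDl.
Qed.

Lemma nEZ c f : gbnd f -> nE (fun x => c * f x) = c * nE f.
Proof.
move=> bf; rewrite /nE -RintegralZl//; last exact: gbnd_integrable.
by apply: eq_Rintegral => x _; rewrite mulrA.
Qed.

Lemma nE_le f g : gbnd f -> gbnd g -> (forall x, f x <= g x) -> nE f <= nE g.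
Proof.
move=> bf bg fg; apply: le_Rintegral => //; [exact: gbnd_integrable|exact: gbnd_integrable|].
by move=> x _; rewrite ler_wpM2r ?phi_ge0.
Qed.

Lemma nE_norm f : gbnd f -> `|nE f| <= nE (fun x => `|f x|).
Proof.
move=> bf; apply: le_trans (le_normr_Rintegral measurableT (gbnd_integrable bf)) _.
rewrite le_eqVlt; apply/orP; left; apply/eqP; apply: eq_Rintegral => x _.
by rewrite normrM (ger0_norm (phi_ge0 x)).
Qed.

Lemma gbnd_cst c : gbnd (fun=> c).
Proof.
split; first by move=> x; exact: cvg_cst.
by exists `|c| => x; rewrite ler_peMr// gdom_ge1.
Qed.

Lemma gbndD f g : gbnd f -> gbnd g -> gbnd (fun x => f x + g x).
Proof.
move=> [cf [K fK]] [cg [L gL]]; split; first by move=> x; apply: cvgD; [exact: cf|exact: cg].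
by exists (K + L) => x; rewrite (le_trans (ler_normD _ _))// mulrDl lerD.
Qed.

Lemma gbndZ c f : gbnd f -> gbnd (fun x => c * f x).
Proof.
move=> [cf [K fK]]; split; first by move=> x; apply: cvgM; [exact: cvg_cst|exact: cf].
by exists (`|c| * K) => x; rewrite normrM -mulrA ler_wpM2l.
Qed.

Lemma gbnd_norm f : gbnd f -> gbnd (fun x => `|f x|).
Proof.
move=> [cf [K fK]]; split; last by exists K => x; rewrite normr_id.
by move=> x; apply: (@continuous_comp _ _ _ f Num.norm); [exact: cf|exact: norm_continuous].
Qed.

Lemma gbnd_exp_even (n : nat) : gbnd (fun x => x ^+ (2 * n)).
Proof.
split; first exact: exprn_continuous.
exists ((4 * s ^+ 2) ^+ n * n`!%:R) => x.
have k0 : 0 < 4 * s ^+ 2 by rewrite mulr_gt0 ?exprn_gt0.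
have y0 : 0 <= x ^+ 2 / (4 * s ^+ 2) by rewrite divr_ge0 ?sqr_ge0// ltW.
have e0 : 0 <= (x ^+ 2) ^+ n by rewrite exprn_ge0// sqr_ge0.
rewrite exprM (ger0_norm e0) {e0}.
case: n => [|n]; first by rewrite !expr0 fact0 !mul1r gdom_ge1.
have h : (x ^+ 2 / (4 * s ^+ 2)) ^+ n.+1 / n.+1`!%:R <= gdom x.
  by apply: le_trans (expR_ge1Dxn n y0); rewrite lerDr.
rewrite -mulrA -ler_pdivrMl ?exprn_gt0// mulrC -expr_div_n.
by rewrite -ler_pdivrMl ?ltr0n ?fact_gt0// mulrC.
Qed.

Lemma gbnd_dominated f g : continuous f -> gbnd g -> (forall x, `|f x| <= g x) -> gbnd f.
Proof.
move=> cf [_ [K gK]] fg; split => //; exists K => x.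
by apply: le_trans (fg x) _; apply: le_trans (ler_norm _) (gK x).
Qed.

Lemma gbndX (n : nat) : gbnd (fun x => x ^+ n).
Proof.
apply: (@gbnd_dominated _ (fun x => 1 + x ^+ (2 * n))).
- exact: exprn_continuous.
- by apply: gbndD; [exact: gbnd_cst|exact: gbnd_exp_even].
- move=> x; rewrite mulnC exprM -(real_normK (num_real (x ^+ n))).
  have : 0 <= `|x ^+ n| by [].
  move: (`|x ^+ n|) => y y0; rewrite -subr_ge0.
  have -> : 1 + y ^+ 2 - y = (y - 2^-1) ^+ 2 + 3 / 4 by field.
  by rewrite addr_ge0 ?sqr_ge0.
Qed.

(* Integration by parts: [(F * phi)' = (F' - x / s ^ 2 * F) * phi]. *)
Lemma stein (F dF : R -> R) : (forall x : R, is_derive x 1 F (dF x)) ->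
  gbnd F -> gbnd dF -> (exists K : R, forall x, `|x * F x| <= K * gdom x) ->
  nE dF = (s ^+ 2)^-1 * nE (fun x => x * F x).
Proof.
move=> FD bF bdF [K xFK].
have bxF : gbnd (fun x => x * F x).
  split; last by exists K.
  by move=> x; apply: cvgM; [exact: cvg_id|exact: bF.1].
pose u x := F x * phi x.
pose du x := (dF x + - (s ^+ 2)^-1 * (x * F x)) * phi x.
have bdu : gbnd (fun x => dF x + - (s ^+ 2)^-1 * (x * F x)) by apply: gbndD => //; exact: gbndZ.
have idu := gbnd_integrable bdu.
have uD (x : R) : is_derive x 1 u (du x).
  have := is_deriveM (FD x) (is_derive_phi x).
  by congr (is_derive _ _ _ _); rewrite /du /GRing.scale/=; ring.
have cu : continuous u.
  by move=> x; apply: cvgM; [exact: bF.1|exact: continuous_phi].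
have cdu : continuous du.
  by move=> x; apply: cvgM; [exact: bdu.1|exact: continuous_phi].
have ftc (n : nat) : (\int[mu]_(x in `[(- n.+1%:R)%R, n.+1%:R%R]) (du x)%:E)%E = (u n.+1%:R - u (- n.+1%:R))%:E.
  rewrite (@continuous_FTC2 _ du u) ?EFinB//.
  - by rewrite -subr_gt0 opprK addr_gt0.
  - exact: continuous_subspaceT.
  - split=> [x _||]; first by case: (uD x).
    + by apply: cvg_at_right_filter; exact: cu.
    + by apply: cvg_at_left_filter; exact: cu.
  - by move=> x _; rewrite derive1E derive_val.
(* Since |x F x| is bounded by a multiple of [gdom x], and [gdom x * phi x] is bounded, the boundary
   terms decay like 1 / n. *)
have ubnd : exists K' : R, forall n, `|u n.+1%:R - u (- n.+1%:R)| <= K' / n.+1%:R.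
  pose M := `|K| * (Num.sqrt 2 * normal_peak (Num.sqrt 2 * s)).
  have q0 : 0 < Num.sqrt 2 :> R by rewrite sqrtr_gt0.
  have h x : `|x * u x| <= M.
    rewrite /u mulrA normrM (ger0_norm (phi_ge0 x)).
    apply: (@le_trans _ _ (`|K| * (gdom x * phi x))).
      rewrite mulrA ler_wpM2r ?phi_ge0//; apply: le_trans (xFK x) _.
      by rewrite ler_wpM2r ?expR_ge0// ler_norm.
    rewrite gdom_phi !ler_wpM2l// ?(ltW q0)//; apply: normal_pdf_ub.
    by rewrite gt_eqF// mulr_gt0.
  exists (M + M) => n; rewrite ler_pdivlMr//.
  have h' x : `|x| * `|u x| <= M by rewrite -normrM; exact: h.
  have h1 := h' n.+1%:R; have h2 := h' (- n.+1%:R).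
  move: h1 h2; rewrite normrN (ger0_norm (ler0n R n.+1)).
  have := ler_normB (u n.+1%:R) (u (- n.+1%:R)).
  have : 0 <= n.+1%:R :> R by [].
  move: (n.+1%:R : R) => N N0.
  move: `|_ - _| `|u N| `|u (- N)| => a b c abc h1 h2.
  apply: (@le_trans _ _ ((b + c) * N)); first by rewrite ler_wpM2r.
  by rewrite mulrDl lerD// mulrC.
have cv0 : (\int[mu]_(x in `[(- n.+1%:R)%R, n.+1%:R%R]) (du x)%:E)%E @[n --> \oo] --> 0%:E.
  under eq_fun do rewrite ftc.
  apply: cvg_EFin; first exact: nearW.
  move: ubnd => [K' hK']; apply/cvgrPdist_le => e e0; near=> n.
  rewrite /= distrC subr0; apply: le_trans (hK' n) _.
  rewrite ler_pdivrMr// [leRHS]mulrC -ler_pdivrMr//.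
  by apply: (@le_trans _ _ n%:R); [near: n; exact: nbhs_infty_ger|rewrite ler_nat].
have cvI : (\int[mu]_(x in `[(- n.+1%:R)%R, n.+1%:R%R]) (du x)%:E)%E @[n --> \oo] --> (\int[mu]_x (du x)%:E)%E.
  under eq_fun do rewrite integral_mkcond.
  have [|||||_ _] := @dominated_convergence _ _ _ mu _ measurableT
     (fun n => (fun x => (du x)%:E) \_ `[(- n.+1%:R)%R, n.+1%:R%R]) (fun x => (du x)%:E)
     (fun x => `|(du x)%:E|%E).
  - move=> n; apply/(measurable_restrictT _ _).1 => //.
    by apply/measurable_EFinP/measurable_funTS; exact: continuous_measurable_fun.
  - by apply/measurable_EFinP; exact: continuous_measurable_fun.
  - apply: aeW => x _; apply: cvg_near_cst; near=> n.
    rewrite patchE mem_set//= in_itv/= -ler_norml.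
    by apply: (@le_trans _ _ n%:R); [near: n; exact: nbhs_infty_ger|rewrite ler_nat].
  - exact: integrable_abse.
  - apply: aeW => x n _; rewrite patchE; case: ifP => // _.
    by rewrite abse0.
  - exact.
have I0 : nE (fun x => dF x + - (s ^+ 2)^-1 * (x * F x)) = 0.
  by rewrite /nE /Rintegral (cvg_unique _ cvI cv0).
move: I0; rewrite nED//; last exact: gbndZ.
by rewrite nEZ// mulNr => /eqP; rewrite subr_eq0 => /eqP.
Unshelve. all: end_near. Qed.

Lemma nE_cst c : nE (fun=> c) = c.
Proof.
rewrite /nE RintegralZl//; last exact: integrable_normal_pdf.
by rewrite /Rintegral integral_normal_pdf mulr1.
Qed.

Lemma gbnd_bounded f : continuous f -> (exists B : R, forall x, `|f x| <= B) -> gbnd f.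
Proof.
move=> cf [B fB]; apply: (gbnd_dominated cf (gbnd_cst B)) => x; exact: fB.
Qed.

Lemma continuous_cos_affine (a c : R) : continuous (fun x : R => cos (a * x + c)).
Proof.
move=> x; apply: (@continuous_comp _ _ _ (fun x : R => a * x + c) cos); last exact: continuous_cos.
by apply: cvgD; [apply: cvgM; [exact: cvg_cst|exact: cvg_id]|exact: cvg_cst].
Qed.

Lemma continuous_sin_affine (a c : R) : continuous (fun x : R => sin (a * x + c)).
Proof.
move=> x; apply: (@continuous_comp _ _ _ (fun x : R => a * x + c) sin); last exact: continuous_sin.
by apply: cvgD; [apply: cvgM; [exact: cvg_cst|exact: cvg_id]|exact: cvg_cst].
Qed.

(** Differentiation under the integral, dominated by |x| [phi x], produces - E[x sin (a x + c)];
    integration by parts with F = sin (a x + c) turns this back into a multiple of the original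
    integral. *)
Lemma normal_charfun_aux (c a : R) :
  is_derive a 1 (fun a => nE (fun x => cos (a * x + c))) (- (s ^+ 2 * a) * nE (fun x => cos (a * x + c))).
Proof.
have bc b : gbnd (fun x => cos (b * x + c)).
  apply: gbnd_bounded; [exact: continuous_cos_affine|by exists 1 => x; exact: cos_max].
have bs b : gbnd (fun x => sin (b * x + c)).
  apply: gbnd_bounded; [exact: continuous_sin_affine|by exists 1 => x; exact: sin_max].
have bx := gbndX 1; have bnx := gbnd_norm bx.
have bxs b : gbnd (fun x => x * sin (b * x + c)).
  apply: (gbnd_dominated _ bnx) => x.
    by apply: cvgM; [exact: cvg_id|exact: continuous_sin_affine].
  by rewrite expr1 normrM ler_piMr// sin_max.
pose f (b : R) (x : R) := cos (b * x + c) * phi x.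
have fD (b x : R) : is_derive b 1 (f ^~ x) (- (x * sin (b * x + c)) * phi x).
  by rewrite /f; apply: is_derive_eq; rewrite /GRing.scale/=; ring.
have pE b x : partial1of2 f b x = - (x * sin (b * x + c)) * phi x.
  by rewrite /partial1of2 derive1E derive_val.
have hyp : [/\ `]a - 1, a + 1[%classic a,
   forall b, `]a - 1, a + 1[%classic b -> mu.-integrable [set: R] (EFin \o f b) &
   mu.-integrable [set: R] (EFin \o (fun x => `|x ^+ 1| * phi x))].
  split; first by rewrite /= in_itv/= ltrBlDr ltrDl ltr01.
    by move=> b _; exact: gbnd_integrable.
  exact: gbnd_integrable.
move: hyp => [h1 h2 h3].
have h4 (b x : R) : `]a - 1, a + 1[%classic b -> [set: R] x -> derivable (f ^~ x) b 1.
  by move=> _ _; case: (fD b x).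
have h5 (x : R) : 0 <= `|x ^+ 1| * phi x by rewrite mulr_ge0 ?phi_ge0.
have h6 (b x : R) : `]a - 1, a + 1[%classic b -> [set: R] x -> `|partial1of2 f b x| <= `|x ^+ 1| * phi x.
  move=> _ _; rewrite pE normrM normrN (ger0_norm (phi_ge0 _)) ler_wpM2r ?phi_ge0//.
  by rewrite expr1 normrM ler_piMr// sin_max.
have der := derivable_under_integral measurableT h1 h2 h4 h5 h3 h6.
have dE := differentiation_under_integral measurableT h1 h2 h4 h5 h3 h6.
apply: DeriveDef; first exact: der.
rewrite -derive1E; apply: etrans dE _.
under eq_Rintegral do rewrite pE.
have -> : \int[mu]_x (- (x * sin (a * x + c)) * phi x) = - nE (fun x => x * sin (a * x + c)).
  rewrite -mulN1r -nEZ//; apply: eq_Rintegral => x _; by rewrite mulN1r.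
have sD (x : R) : is_derive x 1 (fun x => sin (a * x + c)) (a * cos (a * x + c)).
  by apply: is_derive_eq; rewrite /GRing.scale/=; ring.
have := stein sD (bs a) (gbndZ a (bc a)) (bxs a).2.
rewrite nEZ// => h7.
have : nE (fun x => x * sin (a * x + c)) = s ^+ 2 * (a * nE (fun x => cos (a * x + c))).
  by rewrite h7 mulrA mulfV ?mul1r// gt_eqF// exprn_gt0.
by move=> ->; ring.
Qed.

(** The linear differential equation of the previous lemma is solved by showing that the product
    with exp (s^2 a^2 / 2) has derivative zero. *)
Lemma normal_charfun (c a : R) : nE (fun x => cos (a * x + c)) = cos c * expR (- (s ^+ 2 * a ^+ 2 / 2)).
Proof.
pose g a := nE (fun x => cos (a * x + c)) * expR (s ^+ 2 * a ^+ 2 / 2).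
have gD (b : R) : is_derive b 1 g 0.
  have h1 := normal_charfun_aux c b.
  have h2 : is_derive b 1 (fun a : R => expR (s ^+ 2 * a ^+ 2 / 2)) (s ^+ 2 * b * expR (s ^+ 2 * b ^+ 2 / 2)).
    by apply: is_derive_eq; rewrite /GRing.scale/=; field.
  have := is_deriveM h1 h2; congr (is_derive _ _ _ _); rewrite /GRing.scale/=; ring.
have := is_derive_0_is_cst a 0 gD; rewrite /g expr0n/= mulr0 mul0r expR0 mulr1.
have -> : (fun x => cos (0 * x + c)) = (fun=> cos c) by apply/funext => x; rewrite mul0r add0r.
by rewrite nE_cst => <-; rewrite -mulrA -expRD subrr expR0 mulr1.
Qed.

End NormalLaw.

Section GaussianLaw.
Context {R : realType}.
Local Notation mu := (@lebesgue_measure R).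

Definition has_normal_law d (T : measurableType d) (P : probability T R) (W : T -> R) (v : R) :=
  measurable_fun [set: T] W /\
  forall A, measurable A -> P [set w | A (W w)] = centered_normal v A.

Lemma Ex_normal d (T : measurableType d) (P : probability T R) (W : T -> R) (v : R) (h : R -> R) (B : R) :
  0 < v -> has_normal_law P W v -> continuous h -> (forall x, `|h x| <= B) ->
  Ex P (fun w => h (W w)) = nE (Num.sqrt v) h.
Proof.
move=> v0 [mW lW] ch hB.
have mh : measurable_fun [set: R] h by exact: continuous_measurable_fun.
rewrite /Ex /nE /Rintegral; congr fine.
have intP : P.-integrable [set: T] ((EFin \o h) \o W).
  by have := bmf_integrable P (bmf_comp ch hB mW); apply.
transitivity (\int[pushforward P (W : T -> measurableTypeR R)]_y (h y)%:E)%E.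
  by rewrite integral_pushforward//; exact/measurable_EFinP.
transitivity (\int[normal_prob 0 (Num.sqrt v)]_y (h y)%:E)%E.
  apply: eq_measure_integral => A mA _.
  by rewrite /pushforward -[LHS]/(P [set w | A (W w)]) lW// /centered_normal gt_eqF.
rewrite integral_normal_prob//.
have bh : bmf (h : measurableTypeR R -> R) by split; [|exists B].
by have /integrableP[_] := bmf_integrable (normal_prob 0 (Num.sqrt v)) bh.
Qed.

Lemma normal_law_charfun d (T : measurableType d) (P : probability T R) (W : T -> R) (v : R) c :
  0 <= v -> has_normal_law P W v ->
  Ex P (fun w => cos (W w + c)) = cos c * expR (- (v / 2)).
Proof.
rewrite le_eqVlt => /predU1P[<-|v0] lW; last first.
  have sv : 0 < Num.sqrt v by rewrite sqrtr_gt0.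
  have := normal_charfun sv c 1; rewrite expr1n mulr1 sqr_sqrtr ?ltW// => <-.
  rewrite -(@Ex_normal _ _ P W v _ 1)//.
  - by congr Ex; apply/funext => w; rewrite mul1r.
  - exact: continuous_cos_affine.
  - by move=> x; exact: cos_max.
have [mW lW0] := lW.
rewrite mul0r oppr0 expR0 mulr1 /Ex /Rintegral.
have W0 : P [set w | W w != 0] = 0%E.
  rewrite -[LHS]/(P [set w | [set x | x != 0] (W w)]) lW0.
    by rewrite /centered_normal eqxx diracE memNset//= eqxx.
  have -> : [set x : R | x != 0] = ~` [set 0].
    by apply/seteqP; split => x /=; [move=> /eqP|move=> /eqP].
  exact/measurableC.
have -> : (\int[P]_w (cos (W w + c))%:E = \int[P]_w (cos c)%:E)%E.
  apply: ae_eq_integral => //.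
  - by apply/measurable_EFinP; have [] := bmf_cos c mW.
  exists [set w | W w != 0]; split => //.
    have := mW measurableT (~` [set 0]) (measurableC (measurable_set1 0)).
    rewrite setTI; congr (measurable _); apply/seteqP; split => w /=.
      by move/eqP.
    by move/eqP.
  move=> w /= h; apply/eqP => W00; apply: h => _.
  by rewrite W00 add0r.
by have := Ex_cst P (cos c).
Qed.

(** Uniqueness is the continuity theorem applied to a constant sequence of laws. *)
Lemma levy_eq d (T : measurableType d) (P : probability T R) d' (T' : measurableType d')
   (Q : probability T' R) (W : T -> R) (V : T' -> R) (C : R) (h : R -> R) (B : R) :
  measurable_fun [set: T] W -> measurable_fun [set: T'] V ->
  (forall a c, Ex P (fun w => cos (a * W w + c)) = Ex Q (fun w => cos (a * V w + c))) ->
  (forall t : R, 0 < t -> t <= 1 -> 1 - Ex Q (fun w => cos (t * V w)) <= C * t ^+ 2) ->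
  continuous h -> (forall x, `|h x| <= B) ->
  Ex P (fun w => h (W w)) = Ex Q (fun w => h (V w)).
Proof.
move=> mW mV cE hC ch hB.
pose Y w : 'cV[R]_1 := const_mx (W w); pose G w : 'cV[R]_1 := const_mx (V w).
have mY : cvmeas Y by move=> i; rewrite /Y; under eq_fun do rewrite mxE.
have mG : cvmeas G by move=> i; rewrite /G; under eq_fun do rewrite mxE.
have cE0 t : Ex P (fun w => cos (t * W w)) = Ex Q (fun w => cos (t * V w)).
  by have := cE t 0; under eq_fun do rewrite addr0; under [X in _ = Ex _ X]eq_fun do rewrite addr0.
have dotE (u : 'cV[R]_1) (y : R) : cdot u (const_mx y) = u ord0 ord0 * y.
  by rewrite cdotE big_ord_recl big_ord0 addr0 mxE.
have [|||||_] := @levy R 1 (fun=> d) (fun=> T) (fun=> P) (fun=> Y) d' T' Q G C.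
- by [].
- by [].
- move=> u c.
  have -> : (fun w => cos (cdot u (G w) + c)) = (fun w => cos (u ord0 ord0 * V w + c)).
    by apply/funext => w; rewrite dotE.
  have -> : (fun w => cos (cdot u (Y w) + c)) = (fun w => cos (u ord0 ord0 * W w + c)).
    by apply/funext => w; rewrite dotE.
  by rewrite cE; exact: cvg_cst.
- move=> _ i t t0 t1; under [X in Ex _ X]eq_fun do rewrite mxE.
  by rewrite cE0; exact: hC.
- by move=> i t t0 t1; under [X in Ex _ X]eq_fun do rewrite mxE; exact: hC.
pose g (y : 'cV[R]_1) := h (y ord0 ord0).
have cg : continuous g.
  by move=> y; apply: (@continuous_comp _ _ _ (fun y : 'cV[R]_1 => y ord0 ord0) h); [exact: coord_continuous|exact: ch].
move=> /(_ g cg (ex_intro _ B (fun y => hB _))).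
have bY : bmf (g \o Y) by exact: (bmf_cont mY cg (fun y => hB _)).
have bG : bmf (g \o G) by exact: (bmf_cont mG cg (fun y => hB _)).
rewrite (expectation_Ex P bY) (expectation_Ex Q bG) => hcv.
have [] : (Ex Q (g \o G))%:E = (Ex P (g \o Y))%:E.
  by apply: (cvg_unique _ hcv (cvg_cst _)); exact: ereal_hausdorff.
rewrite /g /comp; under eq_fun do rewrite mxE.
by under [X in _ = Ex _ X -> _]eq_fun do rewrite mxE; move=> ->.
Qed.

Lemma normal_law_id (v : R) : 0 < v ->
  has_normal_law (normal_prob 0 (Num.sqrt v)) (idfun : measurableTypeR R -> R) v.
Proof.
move=> v0; split; first exact: measurable_id.
by move=> A mA; rewrite /centered_normal gt_eqF.
Qed.

Lemma charfun_tail (v t E : R) : 0 <= v -> E = expR (- (v * t ^+ 2 / 2)) -> 1 - E <= v * t ^+ 2.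
Proof.
move=> v0 ->; have := expR_ge1Dx (- (v * t ^+ 2 / 2)).
have : 0 <= v * t ^+ 2 by rewrite mulr_ge0// sqr_ge0.
lra.
Qed.

(** Equality of expectations for bounded continuous functions passes to the open left half-lines,
    which are stable under intersection and generate the Borel sets. *)
Lemma charfun_normal_law d (T : measurableType d) (P : probability T R) (W : T -> R) (v : R) :
  measurable_fun [set: T] W -> 0 < v ->
  (forall a c, Ex P (fun w => cos (a * W w + c)) = cos c * expR (- (v * a ^+ 2 / 2))) ->
  has_normal_law P W v.
Proof.
move=> mW v0 hW; split => // A mA.
have sv : 0 < Num.sqrt v by rewrite sqrtr_gt0.
pose Q : probability (measurableTypeR R) R := normal_prob 0 (Num.sqrt v).
pose V : measurableTypeR R -> R := idfun.
have hV a c : Ex Q (fun w => cos (a * V w + c)) = cos c * expR (- (v * a ^+ 2 / 2)).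
  rewrite (@Ex_normal _ _ Q V v (fun x => cos (a * x + c)) 1) ?normal_charfun ?sqr_sqrtr ?(ltW v0)//.
  - exact: normal_law_id.
  - exact: continuous_cos_affine.
  - by move=> x; exact: cos_max.
have eqE (h : R -> R) (B : R) : continuous h -> (forall x, `|h x| <= B) ->
    Ex P (fun w => h (W w)) = Ex Q (fun w => h (V w)).
  apply: (@levy_eq _ _ P _ _ Q W V v) => //.
  - exact: measurable_id.
  - by move=> a c; rewrite hW hV.
  - move=> t _ _; apply: charfun_tail (ltW v0) _.
    have := hV t 0; rewrite cos0 mul1r => <-.
    by congr Ex; apply/funext => w; rewrite addr0.
pose X : {mfun T >-> measurableTypeR R} := HB.pack (W : T -> measurableTypeR R) (@isMeasurableFun.Build _ _ T (measurableTypeR R) W mW).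
rewrite /centered_normal gt_eqF// -[RHS]/(Q A).
rewrite -[LHS]/(distribution P X A).
refine (@measure_unique _ R (measurableTypeR R) (@RGenInftyO.G R) (fun n => `]-oo, n%:R[%classic) _ _ _ _ (distribution P X) Q _ _ A mA).
- exact: (@RGenInftyO.measurableE R).
- move=> _ _ [x ->] [y ->]; exists (Num.min x y).
  by apply/seteqP; split => z /=; rewrite !in_itv/= lt_min => /andP.
- by move=> i; exists i%:R.
- apply/seteqP; split => // x _; exists (Num.truncn `|x|).+1 => //=.
  by rewrite in_itv/= (le_lt_trans (ler_norm x))// truncnS_gt.
- move=> _ [x ->].
  (* A continuous ramp of slope m; as m grows it tends pointwise to the indicator of []-oo, x[]. *)
  pose h (m : nat) (y : R) := Num.min 1 (Num.max 0 (m%:R * (x - y))).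
  have ch m : continuous (h m).
    move=> y; apply: (@continuous_min _ _ (fun=> 1) (fun y : R => Num.max 0 (m%:R * (x - y)))); first exact: cvg_cst.
    apply: (@continuous_max _ _ (fun=> 0) (fun y : R => m%:R * (x - y))); first exact: cvg_cst.
    by apply: cvgM; [exact: cvg_cst|apply: cvgB; [exact: cvg_cst|exact: cvg_id]].
  have hB m y : `|h m y| <= 1.
    by rewrite ger0_norm /h ?ge_min ?lexx// le_min ler01 le_max lexx.
  have hcv y : h m y @[m --> \oo] --> (\1_(`]-oo, x[%classic) y : R).
    rewrite indicE; case: (ltP y x) => yx.
      rewrite mem_set ?in_itv//=; apply: cvg_near_cst; near=> m.
      rewrite /h max_r; last by rewrite mulr_ge0// subr_ge0 ltW.
      rewrite min_l// -ler_pdivrMr ?subr_gt0// div1r; near: m; exact: nbhs_infty_ger.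
    rewrite memNset; last by rewrite /= in_itv/= => /(le_lt_trans yx); rewrite ltxx.
    apply: cvg_near_cst; apply: nearW => m; rewrite /h max_l ?min_r//.
    by rewrite mulr_ge0_le0// subr_le0.
  have lim d0 (T0 : measurableType d0) (P0 : probability T0 R) (U : T0 -> R) : measurable_fun [set: T0] U ->
      Ex P0 (fun w => h m (U w)) @[m --> \oo] --> Ex P0 (fun w => \1_(`]-oo, x[%classic) (U w) : R).
    move=> mU; apply: (@Ex_dct _ _ _ P0 _ _ 1).
    - by move=> m; have [] := bmf_comp (ch m) (hB m) mU.
    - by move=> m w; exact: hB.
    - by move=> w; exact: hcv.
  have IE d0 (T0 : measurableType d0) (P0 : probability T0 R) (U : T0 -> R) : measurable_fun [set: T0] U ->
      (Ex P0 (fun w => \1_(`]-oo, x[%classic) (U w) : R))%:E = P0 (U @^-1` `]-oo, x[%classic).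
    move=> mU.
    have mA0 : measurable (U @^-1` `]-oo, x[%classic) by rewrite -[X in measurable X]setTI; exact: mU.
    have E : (\int[P0]_w (\1_(`]-oo, x[%classic) (U w) : R)%:E = P0 (U @^-1` `]-oo, x[%classic))%E.
      by have := @integral_indic _ T0 R P0 _ measurableT _ mA0; rewrite setIT => <-.
    by rewrite /Ex /Rintegral E fineK// fin_num_measure.
  have l1 := lim _ _ P W mW; have l2 := lim _ _ Q V (@measurable_id _ _ _).
  transitivity (Ex P (fun w => \1_(`]-oo, x[%classic) (W w) : R))%:E.
    exact/esym/(IE _ _ P W mW).
  transitivity (Ex Q (fun w => \1_(`]-oo, x[%classic) (V w) : R))%:E; last first.
    exact: (IE _ _ Q V (@measurable_id _ _ _)).
  congr EFin; move: l2.
  rewrite (_ : (fun m => Ex Q _) = (fun m => Ex P (fun w => h m (W w)))).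
    by move=> l2; apply: cvg_unique l1 l2; exact: Rhausdorff.
  by apply/funext => m; apply/esym; apply: eqE (ch m) (hB m).
- by move=> k; rewrite (le_lt_trans (probability_le1 _ _)) ?ltry.
Unshelve. all: end_near. Qed.

Section ChiSquare.
(* For a standard normal [Z] the characteristic function of [s (Z ^ 2 - 1)] is [exp (- s ^ 2)]
   up to a multiple of [chi3 * |s| ^ 3]. *)
Definition chi3 : R := nE 1 (fun x => `|(x ^+ 2 - 1) ^+ 3|) + 1.

Lemma gbnd_poly (p : {poly R}) : gbnd 1 (fun x => p.[x]).
Proof.
under eq_fun do rewrite horner_coef.
elim: (index_enum _) => [|i r IH].
  by under eq_fun do rewrite big_nil; exact: gbnd_cst.
by under eq_fun do rewrite big_cons; apply: gbndD => //; apply: gbndZ; exact: gbndX.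
Qed.

Lemma gbnd_chi n : gbnd 1 (fun x : R => (x ^+ 2 - 1) ^+ n).
Proof.
have := gbnd_poly (('X^2 - 1) ^+ n); congr (gbnd _ _).
by apply/funext => x; rewrite !hornerE.
Qed.

Lemma nE_chi1 : nE 1 (fun x : R => x ^+ 2 - 1) = 0.
Proof.
have h1 : 0 < 1 :> R by exact: ltr01.
have := @stein R 1 h1 id (fun=> 1) (fun x => is_derive_id x (1:R)) (gbndX h1 1) (gbnd_cst 1 1) (gbndX h1 2).2.
rewrite nE_cst// expr1n invr1 mul1r => h.
have := nED h1 (gbndX h1 2) (gbnd_cst 1 (-1)).
by rewrite nE_cst// -[X in _ = X - 1]h subrr.
Qed.

Lemma nE_chi2 : nE 1 (fun x : R => (x ^+ 2 - 1) ^+ 2) = 2.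
Proof.
have h1 : 0 < 1 :> R by exact: ltr01.
have e2 : nE 1 (fun x : R => x ^+ 2) = 1.
  have := @stein R 1 h1 id (fun=> 1) (fun x => is_derive_id x (1:R)) (gbndX h1 1) (gbnd_cst 1 1) (gbndX h1 2).2.
  by rewrite nE_cst// expr1n invr1 mul1r => <-.
have e4 : nE 1 (fun x : R => x ^+ 4) = 3.
  have dF (x : R) : is_derive x 1 (fun x : R => x ^+ 3) (3 * x ^+ 2).
    by apply: is_derive_eq; rewrite /GRing.scale/=; ring.
  have := @stein R 1 h1 _ _ dF (gbndX h1 3) (gbndZ 3 (gbndX h1 2)).
  have -> : (fun x : R => x * x ^+ 3) = (fun x => x ^+ 4) by apply/funext => x; ring.
  move=> /(_ (gbndX h1 4).2).
  by rewrite nEZ//; [rewrite e2 expr1n invr1 mul1r mulr1 => <-|exact: gbndX].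
have -> : (fun x : R => (x ^+ 2 - 1) ^+ 2) = (fun x => x ^+ 4 + (-2 * x ^+ 2 + 1)) by apply/funext => x; ring.
have g2 : gbnd 1 (fun x : R => -2 * x ^+ 2) by exact/gbndZ/gbndX.
rewrite nED//; [|exact: gbndX|by apply: gbndD => //; exact: gbnd_cst].
rewrite nED//; last exact: gbnd_cst.
rewrite nEZ//; last exact: gbndX.
by rewrite e2 e4 nE_cst//; lra.
Qed.

Lemma chi3_ge1 : 1 <= chi3.
Proof.
rewrite lerDr; apply: Rintegral_ge0 => x _.
by rewrite mulr_ge0// phi_ge0.
Qed.

Lemma continuous_chi (s c : R) : continuous (fun x : R => s * (x ^+ 2 - 1) + c).
Proof.
move=> x; apply: cvgD; last exact: cvg_cst.
apply: cvgM; first exact: cvg_cst.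
by apply: cvgB; [exact: exprn_continuous|exact: cvg_cst].
Qed.

Lemma nE_norm1_le f : gbnd 1 f -> (forall x : R, `|f x| <= 1) -> `|nE 1 f| <= 1.
Proof.
move=> bf f1; have h1 : 0 < 1 :> R by exact: ltr01.
apply: le_trans (nE_norm h1 bf) _; rewrite -[leRHS](nE_cst 1).
by apply: nE_le => //; [exact: gbnd_norm|exact: gbnd_cst].
Qed.

(** Since x^2 - 1 has second moment 2 under the normal law, the second-order expansion of the left
    expectation is 1 - s^2, which is also that of exp (- s^2). *)
Lemma nE_cos_chi (s : R) :
  `|nE 1 (fun x => cos (s * (x ^+ 2 - 1))) - expR (- s ^+ 2)| <= 3 * chi3 * `|s| ^+ 3.
Proof.
have h1 : 0 < 1 :> R by exact: ltr01.
have cc : continuous (fun x : R => cos (s * (x ^+ 2 - 1))).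
  move=> x; apply: (@continuous_comp _ _ _ (fun x : R => s * (x ^+ 2 - 1)) cos); last exact: continuous_cos.
  apply: cvgM; first exact: cvg_cst.
  by apply: cvgB; [exact: exprn_continuous|exact: cvg_cst].
have bc : gbnd 1 (fun x : R => cos (s * (x ^+ 2 - 1))).
  by apply: gbnd_bounded => //; exists 1 => x; exact: cos_max.
have c1 := chi3_ge1.
(* For |s| > 1 the trivial bound 2 is enough, because [chi3] is at least 1. *)
case: (leP `|s| 1) => s1; last first.
  have h2 := nE_norm1_le bc (fun x => cos_max _).
  have h3 : expR (- s ^+ 2) <= 1 by rewrite -expR0 ler_expR oppr_le0 sqr_ge0.
  have h4 : 1 <= `|s| ^+ 3 by rewrite exprn_ege1// ltW.
  apply: (@le_trans _ _ 2).
    apply: le_trans (ler_normB _ _) _; rewrite (ger0_norm (expR_ge0 _)); lra.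
  move: (`|s| ^+ 3) h4 => y y1; nra.
have b2 := gbnd_chi 2; have b3 := gbnd_norm (gbnd_chi 3).
have E1 : nE 1 (fun x => cos (s * (x ^+ 2 - 1)) - (1 - (s * (x ^+ 2 - 1)) ^+ 2 / 2)) =
    nE 1 (fun x => cos (s * (x ^+ 2 - 1))) - (1 - s ^+ 2).
  have -> : (fun x => cos (s * (x ^+ 2 - 1)) - (1 - (s * (x ^+ 2 - 1)) ^+ 2 / 2)) =
     (fun x => cos (s * (x ^+ 2 - 1)) + (-1 + (s ^+ 2 / 2) * (x ^+ 2 - 1) ^+ 2)).
    by apply/funext => x; field.
  rewrite nED//; last by apply: gbndD; [exact: gbnd_cst|exact: gbndZ].
  rewrite nED//; [|exact: gbnd_cst|exact: gbndZ].
  by rewrite nE_cst// nEZ// nE_chi2; field.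
have bd : gbnd 1 (fun x => cos (s * (x ^+ 2 - 1)) - (1 - (s * (x ^+ 2 - 1)) ^+ 2 / 2)).
  have -> : (fun x => cos (s * (x ^+ 2 - 1)) - (1 - (s * (x ^+ 2 - 1)) ^+ 2 / 2)) =
     (fun x => cos (s * (x ^+ 2 - 1)) + (-1 + (s ^+ 2 / 2) * (x ^+ 2 - 1) ^+ 2)).
    by apply/funext => x; field.
  by apply: gbndD => //; apply: gbndD; [exact: gbnd_cst|exact: gbndZ].
have E2 : `|nE 1 (fun x => cos (s * (x ^+ 2 - 1))) - (1 - s ^+ 2)| <= `|s| ^+ 3 * (chi3 - 1).
  rewrite -E1; apply: le_trans (nE_norm h1 bd) _.
  rewrite /chi3 addrK -nEZ//; apply: nE_le => //; [exact: gbnd_norm|exact: gbndZ|].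
  move=> x; apply: le_trans (cos_taylor3 _) _.
  by rewrite normrM exprMn !normrX.
have E3 := expRN_taylor (sqr_ge0 s).
have s4 : (s ^+ 2) ^+ 2 / 2 <= `|s| ^+ 3.
  rewrite -(real_normK (num_real s)); move: s1 (normr_ge0 s); move: `|s| => y y1 y0.
  have -> : (y ^+ 2) ^+ 2 / 2 = y ^+ 3 * (y / 2) by field.
  by rewrite ler_piMr ?exprn_ge0//; lra.
have n3 : 0 <= `|s| ^+ 3 by rewrite exprn_ge0.
move: E2 E3; rewrite !ler_norml => /andP[? ?] /andP[? ?].
by apply/andP; split; nra.
Qed.

(** The linear term of the sine vanishes because x^2 - 1 is centred, and there is no quadratic
    term. *)
Lemma nE_sin_chi (s : R) :
  `|nE 1 (fun x => sin (s * (x ^+ 2 - 1)))| <= 3 * chi3 * `|s| ^+ 3.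
Proof.
have h1 : 0 < 1 :> R by exact: ltr01.
have cs : continuous (fun x : R => sin (s * (x ^+ 2 - 1))).
  move=> x; apply: (@continuous_comp _ _ _ (fun x : R => s * (x ^+ 2 - 1)) sin); last exact: continuous_sin.
  apply: cvgM; first exact: cvg_cst.
  by apply: cvgB; [exact: exprn_continuous|exact: cvg_cst].
have bc : gbnd 1 (fun x : R => sin (s * (x ^+ 2 - 1))).
  by apply: gbnd_bounded => //; exists 1 => x; exact: sin_max.
have c1 := chi3_ge1.
have b1 : gbnd 1 (fun x : R => x ^+ 2 - 1) by have := gbnd_chi 1; under eq_fun do rewrite expr1.
have b3 := gbnd_norm (gbnd_chi 3).
have fE : (fun x => sin (s * (x ^+ 2 - 1)) - s * (x ^+ 2 - 1)) =
     (fun x => sin (s * (x ^+ 2 - 1)) + (- s) * (x ^+ 2 - 1)).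
  by apply/funext => x; ring.
have E1 : nE 1 (fun x => sin (s * (x ^+ 2 - 1)) - s * (x ^+ 2 - 1)) = nE 1 (fun x => sin (s * (x ^+ 2 - 1))).
  by rewrite fE nED//; [rewrite nEZ// nE_chi1 mulr0 addr0|exact: gbndZ].
have bd : gbnd 1 (fun x => sin (s * (x ^+ 2 - 1)) - s * (x ^+ 2 - 1)).
  by rewrite fE; apply: gbndD => //; exact: gbndZ.
rewrite -E1; apply: le_trans (nE_norm h1 bd) _.
apply: (@le_trans _ _ (`|s| ^+ 3 / 6 * (chi3 - 1))).
  rewrite /chi3 addrK -nEZ//; apply: nE_le => //; [exact: gbnd_norm|exact: gbndZ|].
  move=> x; apply: le_trans (sin_taylor_abs _) _.
  by rewrite normrM exprMn !normrX mulrAC.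
have n3 : 0 <= `|s| ^+ 3 by rewrite exprn_ge0.
nra.
Qed.

End ChiSquare.

(* Independence of [Z] and [W], tested on trigonometric functions only: this is what
   factorised characteristic functions say without complex numbers. *)
Definition trig_indep d (T : measurableType d) (P : probability T R) (Z W : T -> R) :=
  forall a c c', Ex P (fun w => cos (a * Z w + c) * cos (W w + c')) =
     Ex P (fun w => cos (a * Z w + c)) * Ex P (fun w => cos (W w + c')).

(** The factorization is linear in the first factor, hence holds for trigonometric polynomials of Z;
    the tail bound on Z then allows the approximation of h, the cosine of W being at most 1 in
    absolute value. *)
Lemma trig_indep_cont d (T : measurableType d) (P : probability T R) (Z W : T -> R) (C : R)
   (h : R -> R) (B : R) c' :
  measurable_fun [set: T] Z -> measurable_fun [set: T] W -> trig_indep P Z W ->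
  (forall t : R, 0 < t -> t <= 1 -> 1 - Ex P (fun w => cos (t * Z w)) <= C * t ^+ 2) ->
  continuous h -> (forall x, `|h x| <= B) ->
  Ex P (fun w => h (Z w) * cos (W w + c')) = Ex P (fun w => h (Z w)) * Ex P (fun w => cos (W w + c')).
Proof.
move=> mZ mW ind hC ch hB.
have B0 : 0 <= B by exact: le_trans (hB 0).
pose Y w : 'cV[R]_1 := const_mx (Z w).
have mY : cvmeas Y by move=> i; rewrite /Y; under eq_fun do rewrite mxE.
pose g (y : 'cV[R]_1) := h (y ord0 ord0).
have cg : continuous g.
  by move=> y; apply: (@continuous_comp _ _ _ (fun y : 'cV[R]_1 => y ord0 ord0) h); [exact: coord_continuous|exact: ch].
have gB y : `|g y| <= B by exact: hB.
have bcW := bmf_cos c' mW.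
have bh := bmf_comp ch hB mZ.
have trigE f : trigpoly f -> Ex P (fun w => f (Y w) * cos (W w + c')) =
    Ex P (fun w => f (Y w)) * Ex P (fun w => cos (W w + c')).
  elim=> [u c|f1 f2 t1 h1 t2 h2|a f1 t1 h1].
  - have uE w : (u^T *m Y w) ord0 ord0 = u ord0 ord0 * Z w.
      by rewrite mxE big_ord_recl big_ord0 addr0 /Y !mxE.
    under [X in Ex P X = _]eq_fun do rewrite uE.
    by under [X in _ = Ex P X * _]eq_fun do rewrite uE; rewrite ind.
  - have -> : (fun w => (f1 (Y w) + f2 (Y w)) * cos (W w + c')) = (fun w => f1 (Y w) * cos (W w + c') + f2 (Y w) * cos (W w + c')).
      by apply/funext => w; rewrite mulrDl.
    have b1 := bmf_trig mY t1; have b2 := bmf_trig mY t2.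
    rewrite (ExD P (bmfM b1 bcW) (bmfM b2 bcW)).
    by rewrite h1 h2 [in RHS]ExD// mulrDl.
  - have -> : (fun w => (a * f1 (Y w)) * cos (W w + c')) = (fun w => a * (f1 (Y w) * cos (W w + c'))).
      by apply/funext => w; rewrite mulrA.
    rewrite ExZ; last by apply: bmfM => //; exact: bmf_trig.
    by rewrite h1 ExZ ?mulrA//; exact: bmf_trig.
pose D := Ex P (fun w => h (Z w) * cos (W w + c')) - Ex P (fun w => h (Z w)) * Ex P (fun w => cos (W w + c')).
have DE L e : 0 < L -> 0 < e -> `|D| <= 2 * (e + 2 * B * (1%:R * (2 * C / L ^+ 2))).
  move=> L0 e0; have [f [tf fB fg]] := trig_approx_local L cg gB e0.
  have := trig_Ex_absdiff (P := P) mY L0 (ltW e0) B0 _ cg gB tf fB fg.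
  have hY (i : 'I_1) (t : R) : 0 < t -> t <= 1 -> 1 - Ex P (fun w => cos (t * Y w i ord0)) <= C * t ^+ 2.
    by move=> t0 t1; under [X in Ex _ X]eq_fun do rewrite mxE; exact: hC.
  move=> /(_ _ hY).
  have gYE w : g (Y w) = h (Z w) by rewrite /g mxE.
  under [X in Ex _ X]eq_fun do rewrite gYE.
  set del := _ + _ => hdel.
  have bf : bmf (fun w => f (Y w)) by exact: bmf_trig.
  have h1 : `|Ex P (fun w => f (Y w)) - Ex P (fun w => h (Z w))| <= del.
    by rewrite -ExB//; apply: le_trans (Ex_norm _ (bmfB bf bh)) hdel.
  have h2 : `|Ex P (fun w => f (Y w) * cos (W w + c')) - Ex P (fun w => h (Z w) * cos (W w + c'))| <= del.
    rewrite -ExB//; [|exact: bmfM|exact: bmfM].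
    apply: le_trans (Ex_norm _ _) _; first by apply: bmfB; exact: bmfM.
    apply: le_trans hdel; apply: Ex_le.
    - by apply: bmf_norm; apply: bmfB; exact: bmfM.
    - by apply: bmf_norm; exact: bmfB.
    - by move=> w; rewrite -mulrBl normrM ler_piMr// cos_max.
  have h3 : `|Ex P (fun w => cos (W w + c'))| <= 1 by apply: Ex_norm_le => // w; exact: cos_max.
  move: h2; rewrite trigE// => h2; rewrite /D.
  move: h1 h2 h3; set a1 := Ex P _; set a2 := Ex P _; set a3 := Ex P _; set a4 := Ex P _.
  move=> h1 h2 h3.
  have -> : a4 - a2 * a3 = - (a1 * a3 - a4) + (a1 - a2) * a3 by ring.
  apply: le_trans (ler_normD _ _) _; rewrite normrN mulr_natl mulr2n lerD//.
  rewrite normrM; apply: le_trans h1; rewrite ler_piMr//.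
apply/eqP; rewrite -subr_eq0 -normr_le0 -/D; apply/ler_addgt0Pr => e e0; rewrite add0r.
pose K := 4 * B * (2 * C).
pose L := Num.sqrt (2 * `|K| / e) + 1.
have L0 : 0 < L by rewrite ltr_wpDl.
have KL : K / L ^+ 2 <= e / 2.
  rewrite ler_pdivrMr ?exprn_gt0//; apply: le_trans (ler_norm _) _.
  rewrite mulrC -ler_pdivrMr ?divr_gt0// invf_div mulrA.
  have h2 : 0 <= 2 * `|K| / e by rewrite divr_ge0 ?mulr_ge0// ltW.
  rewrite (mulrC `|K|) -[leLHS](sqr_sqrtr h2).
  by rewrite lerXn2r ?nnegrE ?sqrtr_ge0 ?(ltW L0)// /L lerDl.
have e4 : 0 < e / 4 by rewrite divr_gt0.
apply: le_trans (DE L _ L0 e4) _.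
have -> : 2 * (e / 4 + 2 * B * (1%:R * (2 * C / L ^+ 2))) = e / 2 + K / L ^+ 2 by rewrite /K; field; rewrite gt_eqF.
lra.
Qed.

End GaussianLaw.

(** * Sums of weighted chi-squares *)

Section ChiSquareSums.
Context {R : realType}.

Lemma sum_if_add (I : finType) (i0 : I) (x : R) (g : I -> R) : g i0 = 0 ->
  \sum_i (if i == i0 then x else g i) = x + \sum_i g i.
Proof.
move=> g0; rewrite (bigD1 i0)//= eqxx [in RHS](bigD1 i0)//= g0 add0r; congr (_ + _).
by apply: eq_bigr => i /negbTE ->.
Qed.

Lemma cos_shift (x : R) : cos (x - pi / 2) = sin x.
Proof. by rewrite cosB cos_pihalf sin_pihalf mulr0 mulr1 add0r. Qed.

Section Family.
Context d (T : measurableType d) (P : probability T R) (I : finType) (Z : I -> T -> R).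
Hypothesis mZ : forall i, measurable_fun [set: T] (Z i).
Hypothesis hZ : forall w c, Ex P (fun x => cos (\sum_i w i * Z i x + c)) =
  expR (- ((\sum_i w i ^+ 2) / 2)) * cos c.
Variable s : I -> R.

Let q i x := s i * (Z i x ^+ 2 - 1).
Let L w x := \sum_i w i * Z i x.

Let mq i : measurable_fun [set: T] (q i).
Proof.
apply: measurable_funM; first exact: measurable_cst.
apply: measurable_funB; last exact: measurable_cst.
exact: measurable_funX.
Qed.

Let mL w : measurable_fun [set: T] (L w).
Proof. by apply: measurable_sum => i; apply: measurable_funM => //; exact: measurable_cst. Qed.

Let mQ r : measurable_fun [set: T] (fun x => \sum_(i <- r) q i x).
Proof. exact: measurable_sum. Qed.

Let lawZ i : has_normal_law P (Z i) 1.
Proof.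
apply: charfun_normal_law => // a c.
have := hZ (fun j => if j == i then a else 0) c.
have -> : \sum_j (if j == i then a else 0) ^+ 2 = a ^+ 2.
  by rewrite -[RHS]addr0 -[X in _ + X](@big1 R 0 +%R I (index_enum I) xpredT (fun=> 0))// -(sum_if_add (i0 := i))//;
     apply: eq_bigr => j _; case: ifP => //; rewrite expr0n.
rewrite mul1r mulrC => <-; congr Ex; apply/funext => x; congr (cos (_ + _)).
rewrite -[LHS]addr0 -[X in _ + X](@big1 R 0 +%R I (index_enum I) xpredT (fun=> 0))// -(sum_if_add (i0 := i))//.
by apply: eq_bigr => j _; case: ifP => [/eqP ->|]//; rewrite mul0r.
Qed.

Let Zcos i a c : Ex P (fun x => cos (a * Z i x + c)) = expR (- (a ^+ 2 / 2)) * cos c.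
Proof.
rewrite (@Ex_normal R _ _ P (Z i) 1 (fun z => cos (a * z + c)) 1)//.
- by rewrite normal_charfun sqrtr1 ?expr1n ?mul1r ?ltr01// mulrC.
- exact: continuous_cos_affine.
- by move=> x; exact: cos_max.
Qed.

Let tailZ i t : 0 < t -> t <= 1 -> 1 - Ex P (fun x => cos (t * Z i x)) <= 1 * t ^+ 2.
Proof.
move=> _ _; apply: charfun_tail => //.
have := Zcos i t 0; rewrite cos0 mulr1 mul1r => <-.
by congr Ex; apply/funext => x; rewrite addr0.
Qed.

(** The induction invariant: the quadratic part over the coordinates in r is independent of every
    linear combination of the remaining ones, as seen by cosines. The arbitrary w is what lets the
    induction single out the next coordinate. *)
Let decoupled r := forall w, (forall i, i \in r -> w i = 0) -> forall c,
  Ex P (fun x => cos (\sum_(i <- r) q i x + L w x + c)) =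
  expR (- ((\sum_i w i ^+ 2) / 2)) * Ex P (fun x => cos (\sum_(i <- r) q i x + c)).

(** The product of cosines becomes a sum of two, with coefficients a and - a of Z. The invariant
    depends on a only through a^2, so the two terms recombine into a product. *)
Let decoupled_indep r i0 w : i0 \notin r -> decoupled r -> (forall i, i \in i0 :: r -> w i = 0) ->
  trig_indep P (Z i0) (fun x => \sum_(i <- r) q i x + L w x).
Proof.
move=> i0r hr w0 a c c'.
have wi0 : w i0 = 0 by rewrite w0 ?mem_head.
have hr' (b e : R) : Ex P (fun x => cos (b * Z i0 x + (\sum_(i <- r) q i x + L w x) + e)) =
    expR (- ((b ^+ 2 + \sum_i w i ^+ 2) / 2)) * Ex P (fun x => cos (\sum_(i <- r) q i x + e)).
  have := hr (fun i => if i == i0 then b else w i) _ e.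
  have -> : \sum_i (if i == i0 then b else w i) ^+ 2 = b ^+ 2 + \sum_i w i ^+ 2.
    rewrite -(sum_if_add (i0 := i0)) ?wi0 ?expr0n//.
    by apply: eq_bigr => j _; case: ifP.
  move=> <-; last first.
    move=> i ir; case: eqP => [ii0|_]; first by move: i0r; rewrite -ii0 ir.
    by rewrite w0// inE ir orbT.
  congr Ex; apply/funext => x; congr (cos (_ + _)); rewrite addrCA; congr (_ + _).
  rewrite /L -(sum_if_add (i0 := i0)) ?wi0 ?mul0r//.
  by apply: eq_bigr => j _; case: ifP => [/eqP ->|].
have mS : measurable_fun [set: T] (fun x => \sum_(i <- r) q i x + L w x) by exact: measurable_funD.
have ma b : measurable_fun [set: T] (fun x => b * Z i0 x + (\sum_(i <- r) q i x + L w x)).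
  apply: measurable_funD => //; apply: measurable_funM => //; exact: measurable_cst.
have -> : (fun x => cos (a * Z i0 x + c) * cos (\sum_(i <- r) q i x + L w x + c')) =
  (fun x => 2^-1 * (cos (a * Z i0 x + (\sum_(i <- r) q i x + L w x) + (c + c')) +
           cos ((- a) * Z i0 x + (\sum_(i <- r) q i x + L w x) + (c' - c)))).
  apply/funext => x; rewrite cosM; congr (_ * (cos _ + _)); first by ring.
  by rewrite -cosN; congr cos; ring.
have b1 := bmf_cos (c + c') (ma a); have b2 := bmf_cos (c' - c) (ma (- a)).
rewrite (ExZ P 2^-1 (bmfD b1 b2)) (ExD P b1 b2) !hr' sqrrN Zcos hr; last first.
  by move=> i ir; rewrite w0// inE ir orbT.
have bQ e := bmf_cos e (mQ r).
have key : Ex P (fun x => cos (\sum_(i <- r) q i x + (c + c'))) + Ex P (fun x => cos (\sum_(i <- r) q i x + (c' - c))) =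
   2 * cos c * Ex P (fun x => cos (\sum_(i <- r) q i x + c')).
  rewrite -(ExD P (bQ _) (bQ _)) -(ExZ P _ (bQ _)); congr Ex; apply/funext => x.
  rewrite -mulrA cosM mulrA divff// mul1r.
  by rewrite -[X in _ = _ + X]cosN; congr (_ + _); congr cos; ring.
by rewrite -mulrDr key mulrDl opprD expRD; field.
Qed.

(** The addition formula isolates the coordinate i0. The sine of the remaining sum is written as a
    cosine with phase shifted by pi / 2, so that the invariant applies to both terms. *)
Let split_cos r i0 w : i0 \notin r -> decoupled r -> (forall i, i \in i0 :: r -> w i = 0) -> forall c,
  Ex P (fun x => cos (\sum_(i <- i0 :: r) q i x + L w x + c)) =
  expR (- ((\sum_i w i ^+ 2) / 2)) *
  (Ex P (fun x => cos (q i0 x)) * Ex P (fun x => cos (\sum_(i <- r) q i x + c)) -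
   Ex P (fun x => sin (q i0 x)) * Ex P (fun x => cos (\sum_(i <- r) q i x + (c - pi / 2)))).
Proof.
move=> i0r hr w0 c.
have ind := decoupled_indep i0r hr w0.
have wr i : i \in r -> w i = 0 by move=> ir; rewrite w0// inE ir orbT.
have mS : measurable_fun [set: T] (fun x => \sum_(i <- r) q i x + L w x) by exact: measurable_funD.
have cch (h : R -> R) : continuous h -> continuous (fun z : R => h (s i0 * (z ^+ 2 - 1))).
  move=> ch z; apply: (@continuous_comp _ _ _ (fun z : R => s i0 * (z ^+ 2 - 1)) h); last exact: ch.
  by have := @continuous_chi R (s i0) 0; under eq_fun do rewrite addr0; apply.
have I1 := trig_indep_cont c (mZ i0) mS ind (@tailZ i0) (cch _ (@continuous_cos R)) (fun x => cos_max _).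
have I2 := trig_indep_cont (c - pi / 2) (mZ i0) mS ind (@tailZ i0) (cch _ (@continuous_sin R)) (fun x => sin_max _).
have -> : (fun x => cos (\sum_(i <- i0 :: r) q i x + L w x + c)) =
  (fun x => cos (q i0 x) * cos (\sum_(i <- r) q i x + L w x + c) -
            sin (q i0 x) * cos (\sum_(i <- r) q i x + L w x + (c - pi / 2))).
  apply/funext => x; rewrite big_cons -!addrA cosD; congr (_ - _ * _).
  by rewrite !addrA cos_shift.
have bc : bmf (fun x => cos (q i0 x)).
  by have := bmf_cos 0 (mq i0); under eq_fun do rewrite addr0.
have bs : bmf (fun x => sin (q i0 x)).
  by have := bmf_cos (- (pi / 2)) (mq i0); under eq_fun do rewrite cos_shift.
rewrite (ExB P (bmfM bc (bmf_cos c mS)) (bmfM bs (bmf_cos (c - pi / 2) mS))) I1 I2 !hr//.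
by rewrite mulrBr !(mulrCA (expR _)).
Qed.

Let decoupled_all r : uniq r -> decoupled r.
Proof.
elim: r => [_ w _ c|i0 r IH /= /andP[i0r ur]].
  under [X in _ = _ * Ex _ X]eq_fun do rewrite big_nil add0r.
  rewrite Ex_cst -hZ; congr Ex; apply/funext => x; by rewrite big_nil add0r.
have hr := IH ur => w w0 c.
rewrite split_cos//; congr (_ * _).
have := @split_cos r i0 (fun=> 0) i0r hr (fun _ _ => erefl) c.
rewrite big1; last by move=> i _; rewrite expr0n.
rewrite mul0r oppr0 expR0 mul1r => <-; congr Ex; apply/funext => x.
by rewrite /L [X in _ + X + _]big1 ?addr0// => i _; rewrite mul0r.
Qed.

(** All factors are at most 1 in absolute value, so the errors of replacing one coordinate after the
    other add up. The cosine and the sine of a coordinate cost 3 [chi3] |s_i|^3 each, hence the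
    constant 6. *)
Lemma chisq_sum_charfun c :
  `|Ex P (fun x => cos (\sum_i s i * (Z i x ^+ 2 - 1) + c)) - expR (- \sum_i s i ^+ 2) * cos c| <=
  6 * (@chi3 R) * \sum_i `|s i| ^+ 3.
Proof.
have : uniq (index_enum I) by exact: index_enum_uniq.
rewrite -!/(q _ _); elim: (index_enum I) c => [c _|i0 r IH c /= /andP[i0r ur]].
  under eq_fun do rewrite big_nil add0r.
  by rewrite !big_nil Ex_cst oppr0 expR0 mul1r subrr normr0 mulr0.
have := @split_cos r i0 (fun=> 0) i0r (decoupled_all ur) (fun _ _ => erefl) c.
rewrite big1; last by move=> i _; rewrite expr0n.
rewrite mul0r oppr0 expR0 mul1r.
have -> : (fun x => cos (\sum_(i <- i0 :: r) q i x + L (fun=> 0) x + c)) =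
          (fun x => cos (\sum_(i <- i0 :: r) q i x + c)).
  apply/funext => x.
  by rewrite /L [X in _ + X + _]big1 ?addr0// => i _; rewrite mul0r.
move=> ->; rewrite !big_cons opprD expRD mulrDr.
have sv : Num.sqrt 1 = 1 :> R by exact: sqrtr1.
have cch (h : R -> R) : continuous h -> continuous (fun z : R => h (s i0 * (z ^+ 2 - 1))).
  move=> ch z; apply: (@continuous_comp _ _ _ (fun z : R => s i0 * (z ^+ 2 - 1)) h); last exact: ch.
  by have := @continuous_chi R (s i0) 0; under eq_fun do rewrite addr0; apply.
have E1 : Ex P (fun x => cos (q i0 x)) = nE 1 (fun z => cos (s i0 * (z ^+ 2 - 1))).
  rewrite (@Ex_normal R _ _ P (Z i0) 1 (fun z => cos (s i0 * (z ^+ 2 - 1))) 1) ?sv//; first exact: cch (@continuous_cos R).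
  by move=> x; exact: cos_max.
have E2 : Ex P (fun x => sin (q i0 x)) = nE 1 (fun z => sin (s i0 * (z ^+ 2 - 1))).
  rewrite (@Ex_normal R _ _ P (Z i0) 1 (fun z => sin (s i0 * (z ^+ 2 - 1))) 1) ?sv//; first exact: cch (@continuous_sin R).
  by move=> x; exact: sin_max.
have := nE_cos_chi (s i0); have := nE_sin_chi (s i0); rewrite -E1 -E2.
have C1 e : `|Ex P (fun x => cos (\sum_(i <- r) q i x + e))| <= 1.
  by apply: Ex_norm_le => [|x]; [exact: bmf_cos|exact: cos_max].
have e1 : `|expR (- s i0 ^+ 2)| <= 1.
  by rewrite ger0_norm ?expR_ge0// -expR0 ler_expR oppr_le0 sqr_ge0.
have := C1 (c - pi / 2); have := C1 c; have := IH c ur.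
set a := Ex P _; set b := expR _ * cos c; set a' := Ex P _.
set u := Ex P (fun x => sin _); set v := Ex P (fun x => cos _).
move=> h1 h2 h3 h4 h5.
have -> : v * a - u * a' - expR (- s i0 ^+ 2) * expR (- (\sum_(j <- r) s j ^+ 2)) * cos c =
  (v - expR (- s i0 ^+ 2)) * a - u * a' + expR (- s i0 ^+ 2) * (a - b) by rewrite /b; ring.
apply: le_trans (ler_normD _ _) _; apply: lerD; last first.
  by rewrite normrM; apply: le_trans h1; rewrite ler_piMl.
apply: le_trans (ler_normB _ _) _.
have -> : 6 * chi3 * `|s i0| ^+ 3 = 3 * chi3 * `|s i0| ^+ 3 + 3 * (@chi3 R) * `|s i0| ^+ 3 by ring.
apply: lerD; rewrite normrM.
  by apply: le_trans h5; rewrite ler_piMr.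
by apply: le_trans h4; rewrite ler_piMr.
Qed.

End Family.

Lemma gaussian_vector_charfun d (T : measurableType d) (P : probability T R) n (X : T -> 'cV[R]_n)
   (V : 'M[R]_n) (u : 'cV[R]_n) c : gaussian_vector P X V ->
  Ex P (fun x => cos (cdot u (X x) + c)) = cos c * expR (- ((u^T *m V *m u) ord0 ord0 / 2)).
Proof.
move=> [symV psdV mX lX]; apply: normal_law_charfun => //.
by split; [exact: cvmeas_cdot|exact: lX].
Qed.

Lemma gaussian_chisq d (T : measurableType d) (P : probability T R) n (X : T -> 'cV[R]_n)
   (V C : 'M[R]_n) (s : 'I_n -> R) c : gaussian_vector P X V -> C *m V *m C^T = 1%:M ->
  `|Ex P (fun x => cos (\sum_i s i * ((C *m X x) i ord0 ^+ 2 - 1) + c)) - expR (- \sum_i s i ^+ 2) * cos c| <=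
  6 * (@chi3 R) * \sum_i `|s i| ^+ 3.
Proof.
move=> gX CVC; have [_ _ mX _] := gX.
apply: (@chisq_sum_charfun _ T P _ (fun i x => (C *m X x) i ord0)).
  move=> i; under eq_fun do rewrite mxE.
  by apply: measurable_sum => j; apply: measurable_funM; [exact: measurable_cst|exact: mX].
move=> w e; pose u : 'cV[R]_n := \col_i w i.
have := gaussian_vector_charfun (C^T *m u) e gX.
have -> : ((C^T *m u)^T *m V *m (C^T *m u)) ord0 ord0 = \sum_i w i ^+ 2.
  rewrite trmx_mul trmxK -!mulmxA (mulmxA C) (mulmxA (C *m V)) CVC mul1mx mxE.
  by apply: eq_bigr => i _; rewrite !mxE.
rewrite mulrC => <-; congr Ex; apply/funext => x; congr (cos (_ + _)).
rewrite /cdot trmx_mul trmxK -mulmxA mxE; apply: eq_bigr => i _.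
by rewrite /u !mxE.
Qed.

End ChiSquareSums.

(** * Existence of the Gaussian limit vector *)

Section GaussianExistence.
Context {R : realType}.

Let N01 : probability (measurableTypeR R) R := normal_prob 0 1.
Let N2 : probability (measurableTypeR R * measurableTypeR R)%type R := (N01 \x N01)%E.

Lemma normal_prod_charfun (a b c : R) :
  Ex N2 (fun z => cos (a * z.1 + b * z.2 + c)) = cos c * expR (- ((a ^+ 2 + b ^+ 2) / 2)).
Proof.
have inner (e k : R) : Ex N01 (fun y => cos (e * y + k)) = cos k * expR (- (e ^+ 2 / 2)).
  have h1 : has_normal_law N01 (idfun : measurableTypeR R -> R) 1.
    by have := @normal_law_id R 1 ltr01; rewrite sqrtr1.
  rewrite (@Ex_normal R _ _ N01 idfun 1 (fun y => cos (e * y + k)) 1)//.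
  - by rewrite normal_charfun sqrtr1 ?expr1n ?mul1r ?ltr01.
  - exact: continuous_cos_affine.
  - by move=> x; exact: cos_max.
have mW : measurable_fun [set: measurableTypeR R * measurableTypeR R] (fun z => a * z.1 + b * z.2).
  apply: measurable_funD; apply: measurable_funM; try exact: measurable_cst.
  - exact: measurable_fst.
  - exact: measurable_snd.
have iW := bmf_integrable N2 (bmf_cos c mW).
have meas (e k : R) : measurable_fun [set: measurableTypeR R] (fun y : R => e * y + k).
  apply: measurable_funD; last exact: measurable_cst.
  by apply: measurable_funM; [exact: measurable_cst|exact: measurable_id].
have bin (e k : R) : bmf (fun y : measurableTypeR R => cos (e * y + k)).
  by have := bmf_cos 0 (meas e k); under eq_fun do rewrite addr0.
rewrite {1}/Ex /Rintegral -[X in fine X](integral12_prod_meas1 iW) -[X in fine X]/(\int[N01]_x fubini_F N01 (EFin \o (fun w : measurableTypeR R * measurableTypeR R => cos (a * w.1 + b * w.2 + c))) x)%E.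
have -> : fubini_F N01 (EFin \o (fun w : measurableTypeR R * measurableTypeR R => cos (a * w.1 + b * w.2 + c))) = EFin \o (fun x : measurableTypeR R => expR (- (b ^+ 2 / 2)) * cos (a * x + c)).
  apply/funext => x; rewrite /fubini_F.
  rewrite [RHS]/= [X in _ = X%:E]mulrC -inner.
  rewrite /Ex /Rintegral fineK; last by apply: integrable_fin_num => //; exact: bmf_integrable.
  by apply: eq_integral => y _ /=; congr (cos _)%:E; ring.
rewrite -[LHS]/(Ex N01 (fun x => expR (- (b ^+ 2 / 2)) * cos (a * x + c))) ExZ//.
rewrite inner mulrCA -expRD; congr (_ * expR _); by field.
Qed.

(** A square root L of Gam, with L L^T = Gam, maps two independent standard normals to the vector.
    Directions of zero variance give a point mass and are treated apart. *)
Lemma gaussian_vector_exists (Gam : 'M[R]_2) : Gam^T = Gam ->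
  (forall u : 'cV[R]_2, 0 <= (u^T *m Gam *m u) ord0 ord0) ->
  exists (d' : measure_display) (T' : measurableType d') (Q : probability T' R) (G : T' -> 'cV[R]_2),
    gaussian_vector Q G Gam.
Proof.
move=> sG pG; have [Q [d [QQ GE]]] := real_spectral sG.
have d0 i : 0 <= d ord0 i.
  rewrite (form_psd_diag QQ GE).
  by have := pG (row i Q)^T; rewrite trmxK.
pose L : 'M[R]_2 := Q^T *m diag_mx (\row_i Num.sqrt (d ord0 i)).
have LL : L *m L^T = Gam.
  rewrite /L trmx_mul trmxK tr_diag_mx mulmxA -(mulmxA Q^T) mulmx_diag GE; congr (_ *m diag_mx _ *m _).
  by apply/rowP => i; rewrite !mxE -expr2 sqr_sqrtr.
pose G (z : measurableTypeR R * measurableTypeR R) : 'cV[R]_2 := L *m col2 z.1 z.2.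
exists _, _, N2, G.
have GL (u : 'cV[R]_2) z : (u^T *m G z) ord0 ord0 = (u^T *m L) ord0 ord0 * z.1 + (u^T *m L) ord0 (lift ord0 ord0) * z.2.
  by rewrite /G mulmxA mxE !big_ord_recl big_ord0 addr0 ![col2 _ _ _ _]mxE.
have GV (u : 'cV[R]_2) : (u^T *m Gam *m u) ord0 ord0 = (u^T *m L) ord0 ord0 ^+ 2 + (u^T *m L) ord0 (lift ord0 ord0) ^+ 2.
  rewrite -LL mulmxA -mulmxA -[X in _ *m X]trmxK [(L^T *m u)^T]trmx_mul trmxK mulmx_trE.
  by rewrite !big_ord_recl big_ord0 addr0 -!expr2.
have mlin (a b : R) : measurable_fun [set: measurableTypeR R * measurableTypeR R] (fun z => a * z.1 + b * z.2).
  apply: measurable_funD; apply: measurable_funM; try exact: measurable_cst.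
  - exact: measurable_fst.
  - exact: measurable_snd.
split => //.
  move=> i; have := mlin (((delta_mx i ord0)^T *m L : 'rV[R]_2) ord0 ord0) (((delta_mx i ord0)^T *m L : 'rV[R]_2) ord0 (lift ord0 ord0)).
  by under eq_fun do rewrite -GL trmx_delta -rowE mxE.
move=> u A mA; have := pG u; rewrite le_eqVlt => /predU1P[v0|v0].
  rewrite -v0 /centered_normal eqxx.
  have := GV u; rewrite -v0 => /esym/eqP; rewrite paddr_eq0 ?sqr_ge0// !sqrf_eq0 => /andP[/eqP l0 /eqP l1].
  have -> : [set w | A ((u^T *m G w) ord0 ord0)] = [set w | A 0].
    by apply/funext => w /=; rewrite GL l0 l1 !mul0r addr0.
  rewrite diracE; case: (pselect (A 0)) => A0.
    rewrite mem_set// (_ : [set _ | _] = setT) ?probability_setT//.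
    by apply/seteqP; split.
  rewrite memNset// (_ : [set _ | _] = set0) ?measure0//.
  by apply/seteqP; split.
have : has_normal_law N2 (fun w => (u^T *m G w) ord0 ord0) ((u^T *m Gam *m u) ord0 ord0).
  apply: charfun_normal_law => //.
    by under eq_fun do rewrite GL; exact: mlin.
  move=> a c; rewrite GV.
  have := normal_prod_charfun (a * (u^T *m L) ord0 ord0) (a * (u^T *m L) ord0 (lift ord0 ord0)) c.
  rewrite !exprMn -mulrDr [a ^+ 2 * _]mulrC => <-.
  by congr Ex; apply/funext => z; rewrite GL mulrDr !mulrA.
by move=> [_]; exact.
Qed.

End GaussianExistence.

(** * The spectral density *)

Section LebesgueTools.
Context {R : realType}.
Local Notation mu := (@lebesgue_measure R).

Let aff (a b : R) : R -> measurableTypeR R := fun x => a * x + b.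

Let maff a b : measurable_fun [set: measurableTypeR R] (aff a b).
Proof.
apply: measurable_funD; last exact: measurable_cst.
by apply: measurable_funM; [exact: measurable_cst|exact: measurable_id].
Qed.

Let affm (a b : R) : {measure set (measurableTypeR R) -> \bar R} :=
  mscale (NngNum (normr_ge0 a)) (measure_function_pushforward__canonical__measure_function_Measure mu (maff a b)).

Let lebesgue_measure_affine (a b : R) (A : set R) : a != 0 -> measurable A -> mu A = affm a b A.
Proof.
move=> a0 mA.
apply: (@lebesgue_measure_unique R (affm a b)) => //= _ [[x y]] _ <-.
rewrite /affm /= /mscale /= /pushforward.
have [{}a0|{}a0] : a < 0 \/ 0 < a by apply/orP; rewrite -neq_lt.
- have -> : aff a b @^-1` `]x, y] = `[(y - b) / a, (x - b) / a[%classic.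
    apply/seteqP; split => z /=; rewrite !in_itv/= ler_ndivrMr// ltr_ndivlMr// /aff => /andP[h1 h2];
      apply/andP; split; lra.
  rewrite !lebesgue_measure_itv/= !lte_fin ltr_nM2r ?invr_lt0// ltrD2r ltr0_norm//.
  case: ifP => xy; last by rewrite mule0.
  by rewrite -!EFinD -EFinM; congr EFin; field; rewrite lt_eqF.
- have -> : aff a b @^-1` `]x, y] = `](x - b) / a, (y - b) / a]%classic.
    apply/seteqP; split => z /=; rewrite !in_itv/= ler_pdivlMr// ltr_pdivrMr// /aff => /andP[h1 h2];
      apply/andP; split; lra.
  rewrite !lebesgue_measure_itv/= !lte_fin ltr_pM2r ?invr_gt0// ltrD2r gtr0_norm//.
  case: ifP => xy; last by rewrite mule0.
  by rewrite -!EFinD -EFinM; congr EFin; field; rewrite gt_eqF.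
Qed.

Lemma ge0_integral_affine (a b : R) (D : set R) (f : R -> \bar R) : a != 0 -> measurable D ->
  measurable_fun D f -> (forall x, D x -> (0 <= f x)%E) ->
  (\int[mu]_(x in D) f x = `|a|%:E * \int[mu]_(x in [set x | D (a * x + b)%R]) f (a * x + b)%R)%E.
Proof.
move=> a0 mD mf f0.
rewrite (eq_measure_integral (affm a b)); last first.
  by move=> A mA _; exact: lebesgue_measure_affine.
rewrite ge0_integral_mscale//; congr (_ * _)%E.
by rewrite ge0_integral_pushforward// => y /set_mem /f0.
Qed.

Lemma itv0y_bigcup (c : R) : 0 < c ->
  `]0%R, +oo[%classic = \bigcup_j `](c * j%:R), (c * j.+1%:R)]%classic.
Proof.
move=> c0; apply/seteqP; split => [x /=|x [j _] /=]; rewrite !in_itv/= ?andbT; last first.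
  by move=> /andP[h _]; apply: le_lt_trans h; rewrite mulr_ge0 ?ler0n// ltW.
move=> x0; have ex : exists n, x <= c * n.+1%:R.
  by exists (Num.truncn (x / c)); rewrite mulrC -ler_pdivrMr//; exact/ltW/truncnS_gt.
case: (ex_minnP ex) => -[|m] xm mm.
  by exists 0%N => //=; rewrite in_itv/= mulr0 x0.
exists m.+1 => //=; rewrite in_itv/= xm andbT ltNge; apply/negP => /mm.
by rewrite ltnn.
Qed.

Lemma trivIset_itvS (c : R) : 0 < c -> trivIset setT (fun j : nat => `](c * j%:R), (c * j.+1%:R)]%classic).
Proof.
move=> c0; apply/trivIsetP => i j _ _; wlog ij : i j / (i < j)%N => [hw|_].
  by move=> /[dup] ne; rewrite neq_ltn => /orP[|] h; [|rewrite setIC]; apply: hw; rewrite ?neq_ltn ?h ?orbT.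
apply/seteqP; split => // x [] /=; rewrite !in_itv/= => /andP[_ h1] /andP[h2 _].
have : c * i.+1%:R <= c * j%:R :> R by rewrite ler_pM2l ?ler_nat.
by rewrite leNgt (lt_le_trans h2).
Qed.

(** The half-line is cut into periods of length 2 pi, each period into two halves. The first half is
    translated onto ]0, pi], the second is reflected onto it. *)
Lemma ge0_integral_fold (f : R -> \bar R) : measurable_fun [set: R] f -> (forall x, (0 <= f x)%E) ->
  (\int[mu]_(x in `]0%R, +oo[) f x = \int[mu]_(x in `]0%R, pi])
    \sum_(0 <= j <oo) (f (2 * pi * j%:R + x)%R + f (2 * pi * j.+1%:R - x)%R))%E.
Proof.
move=> mf f0.
have mfs (D : set R) : measurable_fun D f by exact: measurable_funTS.
have p0 : 0 < pi :> R by exact: pi_gt0.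
have c0 : 0 < 2 * pi :> R by rewrite mulr_gt0.
have maf (a b : R) (D : set R) : measurable_fun D (fun x : R => f (a * x + b)).
  by apply: measurable_funTS; exact: measurableT_comp (maff a b).
have mp (b : R) (D : set R) : measurable_fun D (fun x : R => f (b + x)).
  by have := maf 1 b D; under eq_fun do rewrite mul1r addrC.
have mm (b : R) (D : set R) : measurable_fun D (fun x : R => f (b - x)).
  by have := maf (-1) b D; under eq_fun do rewrite mulN1r addrC.
rewrite (itv0y_bigcup c0) ge0_integral_bigcup//; [|exact: mfs|exact: trivIset_itvS].
rewrite integral_nneseries//; last 2 first.
- by move=> j; exact: (emeasurable_funD (mp _ _) (mm _ _)).
- by move=> j x _; exact: adde_ge0.
apply: eq_eseriesr => j _.
have cj : 2 * pi * j.+1%:R = 2 * pi * j%:R + pi + pi :> R by rewrite -natr1; ring.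
have -> : `](2 * pi * j%:R), (2 * pi * j.+1%:R)]%classic =
   `](2 * pi * j%:R), (2 * pi * j%:R + pi)]%classic `|` `](2 * pi * j%:R + pi), (2 * pi * j.+1%:R)]%classic :> set R.
  rewrite cj; apply/seteqP; split => x /=; rewrite !in_itv/=; move: (2 * pi * j%:R) => y.
    by move=> /andP[h1 h2]; case: (leP x (y + pi)) => h3; [left; rewrite h1|right; rewrite h2].
  by case=> /andP[h1 h2]; apply/andP; split; lra.
rewrite integral_setU//; last 2 first.
  exact: mfs.
  rewrite disj_set2E; apply/eqP/seteqP; split => // x [] /=; rewrite !in_itv/= => /andP[_ h] /andP[h' _].
  by move: h; rewrite leNgt h'.
rewrite (ge0_integralD mu _ _ (mp _ _) _ (mm _ _))//; congr (_ + _)%E.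
  rewrite (ge0_integral_affine (2 * pi * j%:R) (oner_neq0 R) _ (mfs _))//.
  rewrite normr1 mul1e.
  have -> : [set x | `](2 * pi * j%:R), (2 * pi * j%:R + pi)]%classic (1 * x + 2 * pi * j%:R)] = `]0%R, pi]%classic :> set R.
    by apply/seteqP; split => x /=; rewrite !in_itv/= mul1r => /andP[? ?]; apply/andP; split; lra.
  by apply: eq_integral => x _; rewrite mul1r addrC.
have n1 : -1 != 0 :> R by rewrite oppr_eq0 oner_neq0.
rewrite (ge0_integral_affine (2 * pi * j.+1%:R) n1 _ (mfs _))//.
rewrite normrN normr1 mul1e.
have -> : [set x | `](2 * pi * j%:R + pi), (2 * pi * j.+1%:R)]%classic (-1 * x + 2 * pi * j.+1%:R)] = `[0%R, pi[%classic :> set R.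
  by apply/seteqP; split => x /=; rewrite !in_itv/= cj mulN1r => /andP[? ?]; apply/andP; split; lra.
rewrite integral_itv_bndo_bndc// integral_itv_obnd_cbnd//.
by apply: eq_integral => x _; rewrite mulN1r addrC.
Qed.

End LebesgueTools.

(** * Power functions under a shift of the exponent *)

Section PowerTaylor.
Context {R : realType}.

(** This is the exit point of all remainder estimates: the bound K t^2 is proved for powers, summed
    over the poles and integrated, and only then converted into a derivative. *)
Lemma is_derive_quadratic (F : R -> R) (a D K d : R) : 0 < d ->
  (forall t : R, `|t| <= d -> `|F (a + t) - F a - t * D| <= K * t ^+ 2) -> is_derive a 1 F D.
Proof.
move=> d0 hF.
suff h : (fun t : R => t^-1 *: (F (t *: 1 + a) - F a)) @ 0^' --> D.
  apply: DeriveDef; first by apply/cvg_ex; exists D.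
  by rewrite /derive; apply: cvg_lim.
apply/cvgrPdist_lt => e e0.
pose K' := `|K| + 1.
have K0 : 0 < K' by rewrite ltr_wpDl.
near=> t.
have t0 : t != 0 by near: t; exact: nbhs_dnbhs_neq.
have td : `|t| <= d.
  near: t; apply: nbhs_dnbhs; near=> t; apply: ltW; near: t.
  have := @nbhs0_lt R R d d0; apply: filterS => t; exact.
have te : `|t| < e / K'.
  near: t; apply: nbhs_dnbhs; near=> t; near: t.
  have := @nbhs0_lt R R (e / K') (divr_gt0 e0 K0); apply: filterS => t; exact.
have := hF t td; rewrite /GRing.scale/= mulr1 (addrC t).
have -> : D - t^-1 * (F (a + t) - F a) = - (t^-1 * (F (a + t) - F a - t * D)) by field.
move=> h; rewrite normrN normrM normfV.
rewrite mulrC ltr_pdivrMr ?normr_gt0//; apply: le_lt_trans h _.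
apply: (@le_lt_trans _ _ (K' * `|t| ^+ 2)).
  by rewrite real_normK ?num_real// ler_wpM2r ?sqr_ge0// (le_trans (ler_norm K))// lerDl.
rewrite expr2 mulrA ltr_pM2r ?normr_gt0//.
by rewrite mulrC -ltr_pdivlMr.
Unshelve. all: end_near. Qed.

Lemma expR_taylor1 (y : R) : `|expR y - 1 - y| <= y ^+ 2 * expR `|y|.
Proof.
have h1 : 1 + y <= expR y by exact: expR_ge1Dx.
rewrite ger0_norm; last by lra.
have h2 : 1 - y <= expR (- y) by have := expR_ge1Dx (- y).
have e0 : 0 < expR y by exact: expR_gt0.
have : expR y * (1 - y) <= 1.
  by have := ler_wpM2l (ltW e0) h2; rewrite expRxMexpNx_1.
have h3 : expR y <= expR `|y| by rewrite ler_expR ler_norm.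
have h4 : 1 <= expR `|y| by rewrite -expR0 ler_expR.
have y2 := sqr_ge0 y.
case: (ler0P y) => y0 h5; last by move: h3; rewrite gtr0_norm// => _; nra.
have h6 : expR y <= 1 by rewrite -expR0 ler_expR.
nra.
Qed.

Lemma abs_ln_le (d x : R) : 0 < d -> `|ln x| <= d^-1 * expR (d * `|ln x|).
Proof.
move=> d0; rewrite mulrC ler_pdivlMr// mulrC.
by apply: le_trans (expR_ge1Dx _); rewrite lerDr.
Qed.

(* [x ^ e exp (4 d |ln x|)] up to a factor at most 2 *)
Definition powdom (e d x : R) : R := x `^ (e + 4 * d) + x `^ (e - 4 * d).

Section Pos.
Variables (e d x : R).
Hypotheses (d0 : 0 < d) (x0 : 0 < x).

Lemma powR_expR a : x `^ a = expR (a * ln x).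
Proof. by rewrite /powR gt_eqF. Qed.

Lemma powdom_ge0 : 0 <= powdom e d x.
Proof. by rewrite addr_ge0 ?powR_ge0. Qed.

Lemma powdom_ge : x `^ e * expR (4 * d * `|ln x|) <= powdom e d x.
Proof.
rewrite /powdom !powR_expR -expRD.
case: (lerP 0 (ln x)) => l0.
  by rewrite ger0_norm// -mulrDl lerDl expR_ge0.
by rewrite ltr0_norm// mulrN -mulrBl lerDr expR_ge0.
Qed.

(** The shift is 2 t because the exponent is - (2 H) - 1 and H moves by t. Of the margin 4 d in
    [powdom], one half absorbs the squared logarithm and the other half the factor exp (2 |t| |ln
    x|). *)
Lemma powR_taylor (t : R) : `|t| <= d ->
  `|x `^ (e - 2 * t) - x `^ e - t * (- 2 * ln x * x `^ e)| <= 4 / d ^+ 2 * powdom e d x * t ^+ 2.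
Proof.
move=> td; have -> : x `^ (e - 2 * t) = x `^ e * expR (- 2 * t * ln x).
  by rewrite !powR_expR -expRD; congr expR; ring.
set y := - 2 * t * ln x.
have -> : x `^ e * expR y - x `^ e - t * (- 2 * ln x * x `^ e) = x `^ e * (expR y - 1 - y) by rewrite /y; ring.
rewrite normrM (ger0_norm (powR_ge0 _ _)).
apply: (@le_trans _ _ (x `^ e * (4 * t ^+ 2 * (d^-1 * expR (d * `|ln x|)) ^+ 2 * expR (2 * d * `|ln x|)))).
  apply: ler_wpM2l; first exact: powR_ge0.
  apply: le_trans (expR_taylor1 y) _; apply: ler_pM; rewrite ?sqr_ge0 ?expR_ge0//.
    rewrite /y -[leLHS]real_normK ?num_real// !normrM normrN !exprMn !real_normK ?num_real//.
    rewrite (_ : 2 ^+ 2 = 4); last by ring.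
    rewrite -mulrA -[leRHS]mulrA; apply: ler_wpM2l => //; apply: ler_wpM2l; first exact: sqr_ge0.
    rewrite -exprMn -[leLHS]real_normK ?num_real// lerXn2r ?nnegrE//.
      by rewrite mulr_ge0 ?invr_ge0 ?expR_ge0// ltW.
    exact: abs_ln_le.
  by rewrite ler_expR /y !normrM normrN (ger0_norm (ler0n R 2)) ler_wpM2r// ler_wpM2l.
have -> : x `^ e * (4 * t ^+ 2 * (d^-1 * expR (d * `|ln x|)) ^+ 2 * expR (2 * d * `|ln x|)) =
   4 / d ^+ 2 * (x `^ e * expR (4 * d * `|ln x|)) * t ^+ 2.
  have -> : expR (4 * d * `|ln x|) = expR (d * `|ln x|) ^+ 2 * expR (2 * d * `|ln x|).
    by rewrite -expRM_natl -expRD; congr expR; ring.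
  by field; rewrite gt_eqF.
apply: ler_wpM2r; first exact: sqr_ge0.
apply: ler_wpM2l; last exact: powdom_ge.
by rewrite divr_ge0// exprn_ge0// ltW.
Qed.

Lemma powR_le_powdom (t : R) : `|t| <= d -> x `^ (e - 2 * t) <= powdom e d x.
Proof.
move=> td; apply: le_trans powdom_ge; rewrite !powR_expR -expRD ler_expR.
rewrite mulrBl lerD2l -mulNr; apply: le_trans (ler_norm _) _; rewrite !normrM ler_wpM2r// normrN normrM (ger0_norm (ler0n R 2)).
by apply: ler_pM => //; rewrite ler_nat.
Qed.

Lemma lnpowR_le_powdom : `|- 2 * ln x * x `^ e| <= 2 / d * powdom e d x.
Proof.
have -> : `|- 2 * ln x * x `^ e| = 2 * (x `^ e * `|ln x|).
  by rewrite !normrM normrN (ger0_norm (powR_ge0 _ _)) (ger0_norm (ler0n R 2)); ring.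
rewrite -[leRHS]mulrA; apply: ler_wpM2l => //.
apply: (@le_trans _ _ (x `^ e * (d^-1 * expR (4 * d * `|ln x|)))).
  apply: ler_wpM2l; first exact: powR_ge0.
  apply: le_trans (abs_ln_le _ d0) _; apply: ler_wpM2l; first by rewrite invr_ge0 ltW.
  by rewrite ler_expR ler_wpM2r// ler_peMl ?ler1n ?ltW.
rewrite mulrCA; apply: ler_wpM2l; first by rewrite invr_ge0 ltW.
exact: powdom_ge.
Qed.

End Pos.

Lemma powdom_le_invsq (e d x : R) (j : nat) : 0 < d -> e + 4 * d <= - 2 -> j.+1%:R <= x ->
  powdom e d x <= 2 / j.+1%:R ^+ 2.
Proof.
move=> d0 ed xj; have x1 : 1 <= x by apply: le_trans xj; rewrite ler1n.
have x0 : 0 < x by exact: lt_le_trans x1.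
have h1 : x `^ (- 2%:R) <= j.+1%:R ^- 2.
  by rewrite powR_invn ?(ltW x0)// lef_pV2 ?posrE ?exprn_gt0// lerXn2r ?nnegrE ?(ltW x0).
have h2 : x `^ (e + 4 * d) <= x `^ (- 2%:R) by rewrite ler_powR//.
have h3 : x `^ (e - 4 * d) <= x `^ (- 2%:R) by rewrite ler_powR//; lra.
have -> : 2 / j.+1%:R ^+ 2 = j.+1%:R ^- 2 + j.+1%:R ^- 2 :> R by ring.
by rewrite /powdom lerD// (le_trans _ h1).
Qed.

Lemma sum_invsq_le N : \sum_(j < N) (j.+1%:R ^- 2 : R) <= 2.
Proof.
(* The sharper bound is the one that passes through the induction, since 1 / (N + 2)^2 is at most 1
   / (N + 1) - 1 / (N + 2). *)
suff : \sum_(j < N.+1) (j.+1%:R ^- 2 : R) <= 2 - N.+1%:R^-1.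
  rewrite big_ord_recr/= => h; have h1 : 0 <= N.+1%:R^-1 :> R by rewrite invr_ge0.
  have h2 : 0 <= N.+1%:R ^- 2 :> R by rewrite invr_ge0 exprn_ge0.
  by apply: le_trans (le_trans _ h) _; [rewrite lerDl|rewrite gerBl].
elim: N => [|N IH]; first by rewrite big_ord_recl big_ord0 addr0 expr1n invr1; lra.
rewrite big_ord_recr/=; apply: le_trans (lerD IH (lexx _)) _.
have a0 : 0 < N.+1%:R :> R by rewrite ltr0n.
have b0 : 0 < N.+2%:R :> R by rewrite ltr0n.
have E : N.+1%:R^-1 = N.+2%:R^-1 + (N.+1%:R * N.+2%:R)^-1 :> R.
  by rewrite -(natr1 N.+1); field; rewrite -(natr1 N.+1) in b0; rewrite !gt_eqF.
have : N.+2%:R ^- 2 <= (N.+1%:R * N.+2%:R)^-1 :> R.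
  by rewrite lef_pV2 ?posrE ?exprn_gt0 ?mulr_gt0// expr2 ler_wpM2r ?ler_nat// ltW.
rewrite E; move: (N.+2%:R^-1) (N.+2%:R ^- 2) ((N.+1%:R * N.+2%:R)^-1) => x y z yz.
by lra.
Qed.

Section Series.
Variables (a : nat -> R) (c : R).
Hypothesis ha : forall j, `|a j| <= c / j.+1%:R ^+ 2.

Lemma invsq_series_cvg : series a n @[n --> \oo] --> limn (series a).
Proof.
suff : cvgn (series a) by [].
apply: normed_cvg; have -> : [normed series a] = (fun n => \sum_(0 <= k < n) `|a k|) by [].
apply: nondecreasing_is_cvgn.
  by apply/nondecreasing_seqP => n; rewrite big_nat_recr//= lerDl.
exists (c * 2) => _ [n _ <-]; rewrite big_mkord.
apply: (@le_trans _ _ (\sum_(j < n) c * j.+1%:R ^- 2)); first by apply: ler_sum => j _; exact: ha.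
rewrite -mulr_sumr; apply: ler_wpM2l; last exact: sum_invsq_le.
by have := ha 0; rewrite expr1n divr1; apply: le_trans.
Qed.

Lemma invsq_series_le : `|limn (series a)| <= c * 2.
Proof.
have h : `|series a n| @[n --> \oo] --> `|limn (series a)| by apply: cvg_norm; exact: invsq_series_cvg.
rewrite -(cvg_lim _ h)//; apply: limr_le; first by apply/cvg_ex; eexists; exact: h.
apply: nearW => n; rewrite /series/= big_mkord; apply: le_trans (ler_norm_sum _ _ _) _.
apply: (@le_trans _ _ (\sum_(j < n) c * j.+1%:R ^- 2)); first by apply: ler_sum => j _; exact: ha.
rewrite -mulr_sumr; apply: ler_wpM2l; last exact: sum_invsq_le.
by have := ha 0; rewrite expr1n divr1; apply: le_trans.
Qed.

End Series.

End PowerTaylor.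

Section PowerIntegrals.
Context {R : realType}.
Local Notation mu := (@lebesgue_measure R).

Lemma integrable_powRN (g : R) : 0 <= g -> g < 1 -> mu.-integrable `[0, pi] (fun x => (x `^ (- g))%:E).
Proof.
move=> g0 g1; have p0 : 0 < pi :> R by exact: pi_gt0.
have mpow (D : set R) : measurable_fun D (fun x : R => x `^ (- g)) by apply: measurable_funTS; exact: measurable_powR.
have mE (D : set R) : measurable_fun D (fun x : R => (x `^ (- g))%:E) by apply/measurable_EFinP; exact: mpow.
apply/integrableP; split; first exact: mE.
under eq_integral do rewrite gee0_abs ?lee_fin ?powR_ge0//.
rewrite -integral_itv_obnd_cbnd; last exact: mE.
pose a (n : nat) : R := pi / n.+2%:R.
have a0 n : 0 < a n by rewrite divr_gt0.
have ap n : a n < pi by rewrite /a ltr_pdivrMr// ltr_pMr// ltr1n.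
have g1' : 0 < 1 - g by rewrite subr_gt0.
have -> : `]0%R, pi]%classic = \bigcup_n `[a n, pi]%classic :> set R.
  apply/seteqP; split => [x /=|x [n _] /=]; rewrite !in_itv/=; last first.
    by move=> /andP[h ->]; rewrite (lt_le_trans (a0 n)).
  move=> /andP[x0 xp]; exists (Num.truncn (pi / x)) => //=; rewrite in_itv/= xp andbT.
  rewrite /a ler_pdivrMr// mulrC -ler_pdivrMr// ltW// (lt_trans (truncnS_gt _))// ltr_nat.
  by [].
have cv : (\int[mu]_(x in `[a n, pi]) (x `^ (- g))%:E @[n --> \oo] -->
           \int[mu]_(x in \bigcup_n `[a n, pi]%classic) (x `^ (- g))%:E)%E.
  apply: ge0_nondecreasing_set_cvg_integral.
  - apply/nondecreasing_seqP => n; apply/subsetPset => x /=; rewrite !in_itv/= => /andP[h ->]; rewrite andbT.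
    by apply: le_trans h; rewrite /a ler_pM2l// lef_pV2 ?posrE// ler_nat.
  - by move=> n; exact: measurable_itv.
  - by move=> n; exact: mE.
  - by move=> n x _; rewrite lee_fin powR_ge0.
rewrite -(cvg_lim _ cv)//.
apply: (@le_lt_trans _ _ (pi `^ (1 - g) / (1 - g))%:E); last exact: ltry.
apply: lime_le; first by apply/cvg_ex; eexists; exact: cv.
apply: nearW => n.
pose F (x : R) := x `^ (1 - g) / (1 - g).
have dF (x : R) : 0 < x -> is_derive x 1 F (x `^ (- g)).
  move=> x0; have := is_derive1_powR (1 - g) x0; rewrite (_ : 1 - g - 1 = - g); last by ring.
  move=> h; have := @is_deriveM _ _ _ _ _ _ _ _ h (is_derive_cst (1 - g)^-1 x 1).
  move=> E; suff -> : x `^ (- g) = x `^ (1 - g) *: (0 : R) + cst (1 - g)^-1 x *: ((1 - g) * x `^ (- g)) by exact: E.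
  by rewrite /GRing.scale/= mulr0 add0r mulrA mulVf ?mul1r// gt_eqF.
have pos (x : R) : a n <= x -> 0 < x by exact: lt_le_trans.
rewrite (@continuous_FTC2 _ _ F)//.
- rewrite -EFinD lee_fin gerBl /F divr_ge0// ?powR_ge0// ltW//.
- apply: continuous_in_subspaceT => x /set_mem /=; rewrite in_itv/= => /andP[/pos x0 _].
  have := is_derive1_powR (- g) x0 => h; apply: differentiable_continuous; apply/derivable1_diffP.
  by have [] := h.
- split.
  + move=> x; rewrite in_itv/= => /andP[/ltW/pos x0 _]; by have [] := dF x x0.
  + apply: cvg_at_right_filter; apply: differentiable_continuous; apply/derivable1_diffP.
    by have [] := dF _ (a0 n).
  + apply: cvg_at_left_filter; apply: differentiable_continuous; apply/derivable1_diffP.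
    by have [] := dF _ p0.
- move=> x; rewrite in_itv/= => /andP[/ltW/pos x0 _].
  by have [_] := dF x x0; rewrite derive1E.
Qed.

End PowerIntegrals.

(** * The poles of the spectral density away from the origin *)

Section SpectralShape.
Context {R : realType}.
Local Notation mu := (@lebesgue_measure R).

(* The part of [\sum_j |x + 2 pi j| ^ e] with [j != 0], for [|x| <= pi]. *)
Definition pole_term (e : R) (j : nat) (x : R) : R :=
  (2 * pi * j.+1%:R + x) `^ e + (2 * pi * j.+1%:R - x) `^ e.

Definition pole_sum (e x : R) : R := limn (series (pole_term e ^~ x)).

(** The derivative of [pole_term (e - 2 * t) j x] in t at t = 0. *)
Definition dpole_term (e : R) (j : nat) (x : R) : R :=
  - 2 * ln (2 * pi * j.+1%:R + x) * (2 * pi * j.+1%:R + x) `^ e +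
  - 2 * ln (2 * pi * j.+1%:R - x) * (2 * pi * j.+1%:R - x) `^ e.

Definition dpole_sum (e x : R) : R := limn (series (dpole_term e ^~ x)).

Lemma pole_ge (j : nat) (x : R) : `|x| <= pi -> j.+1%:R <= 2 * pi * j.+1%:R + x.
Proof.
rewrite ler_norml => /andP[x1 _]; have p2 := pi_ge2 R.
have j1 : 1 <= j.+1%:R :> R by rewrite ler1n.
apply: (@le_trans _ _ (pi * j.+1%:R)); first by rewrite ler_peMl//; lra.
have : pi <= pi * j.+1%:R :> R by rewrite ler_peMr// pi_ge0.
have -> : 2 * pi * j.+1%:R = pi * j.+1%:R + pi * j.+1%:R :> R by ring.
by move=> h; rewrite -addrA lerDl; lra.
Qed.

Section Bounds.
Variables (e d x : R).
Hypotheses (d0 : 0 < d) (ed : e + 4 * d <= - 2) (xp : `|x| <= pi).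

Let wp j : j.+1%:R <= 2 * pi * j.+1%:R + x. Proof. exact: pole_ge. Qed.
Let wm j : j.+1%:R <= 2 * pi * j.+1%:R - x. Proof. by apply: pole_ge; rewrite normrN. Qed.
Let wp0 j : 0 < 2 * pi * j.+1%:R + x. Proof. exact: lt_le_trans (wp j). Qed.
Let wm0 j : 0 < 2 * pi * j.+1%:R - x. Proof. exact: lt_le_trans (wm j). Qed.

Lemma pole_term_bound (t : R) j : `|t| <= d -> `|pole_term (e - 2 * t) j x| <= 4 / j.+1%:R ^+ 2.
Proof.
move=> td; rewrite ger0_norm ?addr_ge0 ?powR_ge0//.
have -> : 4 / j.+1%:R ^+ 2 = 2 / j.+1%:R ^+ 2 + 2 / j.+1%:R ^+ 2 :> R by ring.
by apply: lerD; [apply: le_trans (powR_le_powdom e (wp0 j) td) _|apply: le_trans (powR_le_powdom e (wm0 j) td) _]; exact: powdom_le_invsq.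
Qed.

Lemma dpole_term_bound j : `|dpole_term e j x| <= (8 / d) / j.+1%:R ^+ 2.
Proof.
apply: le_trans (ler_normD _ _) _.
have -> : 8 / d / j.+1%:R ^+ 2 = 2 / d * (2 / j.+1%:R ^+ 2) + 2 / d * (2 / j.+1%:R ^+ 2) :> R.
  by rewrite -mulr2n -mulr_natr; ring.
have c0 : 0 <= 2 / d by rewrite divr_ge0// ltW.
apply: lerD; (apply: le_trans (lnpowR_le_powdom _ d0 _) _; [by []|apply: ler_wpM2l => //; exact: powdom_le_invsq]).
Qed.

Lemma pole_sum_bound (t : R) : `|t| <= d -> `|pole_sum (e - 2 * t) x| <= 8.
Proof.
move=> td; have := invsq_series_le (fun j => pole_term_bound j td).
by rewrite (_ : 4 * 2 = 8)//; ring.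
Qed.

Lemma dpole_sum_bound : `|dpole_sum e x| <= 16 / d.
Proof.
have := invsq_series_le dpole_term_bound.
by rewrite (_ : 8 / d * 2 = 16 / d)//; ring.
Qed.

(** The remainders of the single powers are dominated by a multiple of t^2 / (j + 1)^2, so the
    Taylor estimate passes to the sum. *)
Lemma pole_sum_taylor (t : R) : `|t| <= d ->
  `|pole_sum (e - 2 * t) x - pole_sum e x - t * dpole_sum e x| <= 32 / d ^+ 2 * t ^+ 2.
Proof.
move=> td.
have t0 : `|0 : R| <= d by rewrite normr0 ltW.
have c1 := invsq_series_cvg (fun j => pole_term_bound j td).
have c2 := invsq_series_cvg (fun j => pole_term_bound j t0).
have c3 := invsq_series_cvg dpole_term_bound.
rewrite mulr0 subr0 in c2.
pose r j := pole_term (e - 2 * t) j x - pole_term e j x - t * dpole_term e j x.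
have rb j : `|r j| <= (16 / d ^+ 2 * t ^+ 2) / j.+1%:R ^+ 2.
  pose w1 := 2 * pi * j.+1%:R + x; pose w2 := 2 * pi * j.+1%:R - x.
  have -> : r j = (w1 `^ (e - 2 * t) - w1 `^ e - t * (- 2 * ln w1 * w1 `^ e)) +
                 (w2 `^ (e - 2 * t) - w2 `^ e - t * (- 2 * ln w2 * w2 `^ e)).
    by rewrite /r /pole_term /dpole_term -/w1 -/w2; ring.
  apply: le_trans (ler_normD _ _) _.
  have -> : 16 / d ^+ 2 * t ^+ 2 / j.+1%:R ^+ 2 = 4 / d ^+ 2 * (2 / j.+1%:R ^+ 2) * t ^+ 2 + 4 / d ^+ 2 * (2 / j.+1%:R ^+ 2) * t ^+ 2.
    by rewrite -mulr2n -mulr_natr; ring.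
  have c0 : 0 <= 4 / d ^+ 2 by rewrite divr_ge0// exprn_ge0// ltW.
  apply: lerD; [apply: le_trans (powR_taylor e d0 (wp0 j) td) _|apply: le_trans (powR_taylor e d0 (wm0 j) td) _];
    by apply: ler_wpM2r; [exact: sqr_ge0|apply: ler_wpM2l => //; exact: powdom_le_invsq].
have -> : pole_sum (e - 2 * t) x - pole_sum e x - t * dpole_sum e x = limn (series r).
  apply/esym/cvg_lim => //.
  rewrite (_ : series r = (fun n => series (pole_term (e - 2 * t) ^~ x) n - series (pole_term e ^~ x) n -
      t * series (dpole_term e ^~ x) n)).
    apply: cvgB; first exact: cvgB c1 c2.
    by apply: cvgM; [exact: cvg_cst|exact: c3].
  by apply/funext => n; rewrite /series/= mulr_sumr -!sumrB.
have := invsq_series_le rb.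
by rewrite (_ : 16 / d ^+ 2 * t ^+ 2 * 2 = 32 / d ^+ 2 * t ^+ 2)//; ring.
Qed.

End Bounds.

Lemma pole_sum_ge0 (e d x : R) : 0 < d -> e + 4 * d <= - 2 -> `|x| <= pi -> 0 <= pole_sum e x.
Proof.
move=> d0 ed xp; have t0 : `|0 : R| <= d by rewrite normr0 ltW.
have := invsq_series_cvg (fun j => pole_term_bound d0 ed xp j t0).
rewrite mulr0 subr0 => c; rewrite /pole_sum; apply: limr_ge.
  by apply/cvg_ex; eexists; exact: c.
by apply: nearW => n; rewrite /series/= sumr_ge0// => j _; rewrite addr_ge0 ?powR_ge0.
Qed.

Lemma measurable_aff_powR (a b e : R) : measurable_fun [set: R] (fun x : R => (a + b * x) `^ e).
Proof.
apply: (@measurableT_comp _ _ _ _ _ _ (@powR R ^~ e)); first exact: measurable_powR.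
by apply: measurable_funD; [exact: measurable_cst|apply: measurable_funM; [exact: measurable_cst|exact: measurable_id]].
Qed.

Lemma measurable_aff_ln (a b : R) : measurable_fun [set: R] (fun x : R => ln (a + b * x)).
Proof.
apply: (@measurableT_comp _ _ _ _ _ _ (@ln R)); first exact: measurable_ln.
by apply: measurable_funD; [exact: measurable_cst|apply: measurable_funM; [exact: measurable_cst|exact: measurable_id]].
Qed.

Lemma measurable_pole_sum (e d : R) : 0 < d -> e + 4 * d <= - 2 ->
  measurable_fun `[- pi, pi] (pole_sum e).
Proof.
move=> d0 ed; apply: (@measurable_fun_cvg _ _ _ _ (fun n x => series (pole_term e ^~ x) n)).
  move=> n; apply: measurable_funTS; rewrite /series/=; apply: measurable_sum => j.
  have := measurable_funD (measurable_aff_powR (2 * pi * j.+1%:R) 1 e) (measurable_aff_powR (2 * pi * j.+1%:R) (-1) e).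
  by congr (measurable_fun _ _); apply/funext => x; rewrite /= mul1r mulN1r.
move=> x /=; rewrite in_itv/= -ler_norml => xp.
have t0 : `|0 : R| <= d by rewrite normr0 ltW.
have := invsq_series_cvg (fun j => pole_term_bound d0 ed xp j t0).
by rewrite mulr0 subr0.
Qed.

Lemma measurable_dpole_sum (e d : R) : 0 < d -> e + 4 * d <= - 2 ->
  measurable_fun `[- pi, pi] (dpole_sum e).
Proof.
move=> d0 ed; apply: (@measurable_fun_cvg _ _ _ _ (fun n x => series (dpole_term e ^~ x) n)).
  move=> n; apply: measurable_funTS; rewrite /series/=; apply: measurable_sum => j.
  have m1 b : measurable_fun [set: R] (fun x : R => - 2 * ln (2 * pi * j.+1%:R + b * x) * (2 * pi * j.+1%:R + b * x) `^ e).
    apply: measurable_funM; last exact: measurable_aff_powR.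
    by apply: measurable_funM; [exact: measurable_cst|exact: measurable_aff_ln].
  have := measurable_funD (m1 1) (m1 (-1)).
  by congr (measurable_fun _ _); apply/funext => x; rewrite /= mul1r mulN1r.
move=> x /=; rewrite in_itv/= -ler_norml => xp.
exact: (invsq_series_cvg (dpole_term_bound d0 ed xp)).
Qed.

Lemma esum_int_split (a : int -> \bar R) : (forall j, (0 <= a j)%E) ->
  (\esum_(j in [set: int]) a j = \sum_(0 <= j <oo) (a (Posz j) + a (Negz j)))%E.
Proof.
move=> a0; rewrite (@esumID _ _ (range Posz)) ?setTI//.
have -> : ~` range Posz = range Negz.
  apply/seteqP; split => [[n|n] /= h|_ [n _ <-] [m _]]//.
    by exfalso; apply: h; exists n.
  by exists n.
rewrite !esum_set_image//; last 2 first.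
  by move=> x y _ _ [].
  by move=> x y _ _ [].
rewrite nneseriesD//; congr (_ + _)%E; apply: eq_eseriesl => i; by rewrite in_setT.
Qed.

Lemma esum_int_opp (a : int -> \bar R) : (forall j, (0 <= a j)%E) ->
  (\esum_(j in [set: int]) a j = \esum_(j in [set: int]) a (- j)%R)%E.
Proof.
move=> a0; apply: reindex_esum; split.
- by [].
- by move=> x y _ _; exact: oppr_inj.
- by move=> x _; exists (- x) => //; rewrite opprK.
Qed.

Lemma esum_poles (e x : R) : 0 < x -> x <= pi ->
  (\esum_(j in [set: int]) (`|x + 2 * pi * j%:~R| `^ e)%:E =
   \sum_(0 <= j <oo) (((2 * pi * j%:R + x) `^ e)%:E + ((2 * pi * j.+1%:R - x) `^ e)%:E))%E.
Proof.
move=> x0 xp; have p0 := pi_gt0 R.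
rewrite esum_int_split => [|j]; last by rewrite lee_fin powR_ge0.
have e1 j : (Posz j)%:~R = j%:R :> R by [].
have e2 j : (Negz j)%:~R = - j.+1%:R :> R by rewrite NegzE mulrNz.
apply: eq_eseriesr => j _; congr (_ %:E + _ %:E)%E; congr (_ `^ _).
  by rewrite e1 addrC ger0_norm// addr_ge0 ?(ltW x0)// !mulr_ge0// ltW.
rewrite e2 mulrN -normrN opprB ger0_norm//.
have := @pole_ge j (- x); rewrite normrN gtr0_norm// => /(_ xp); apply: le_trans.
by rewrite ler0n.
Qed.

Lemma esum_poles_fin (e d x : R) : 0 < d -> e + 4 * d <= - 2 -> 0 < x -> x <= pi ->
  (\esum_(j in [set: int]) (`|x + 2 * pi * j%:~R| `^ e)%:E = (x `^ e + pole_sum e x)%:E)%E.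
Proof.
move=> d0 ed x0 xp; rewrite esum_poles//.
have xp' : `|x| <= pi by rewrite gtr0_norm.
have t0 : `|0 : R| <= d by rewrite normr0 ltW.
have := invsq_series_cvg (fun j => pole_term_bound d0 ed xp' j t0).
rewrite mulr0 subr0 => c.
apply/cvg_lim => //.
(* The sum over integers pairs 2 pi j + x with 2 pi (j + 1) - x, while [pole_term] pairs both at j +
   1. Partial sums therefore differ by x^e, the pole at the origin, and by the boundary term p N,
   which vanishes in the limit. *)
pose p (N : nat) := (2 * pi * N%:R + x) `^ e.
have pN : p N @[N --> \oo] --> 0.
  rewrite -cvg_shiftS /=; apply: (@squeeze_cvgr _ _ _ _ (fun=> 0) (fun N => N.+1%:R^-1)).
  - apply: nearW => N; rewrite powR_ge0/=.
    have h1 := pole_ge N xp'.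
    have h2 : 0 < 2 * pi * N.+1%:R + x by exact: lt_le_trans h1.
    apply: (@le_trans _ _ ((2 * pi * N.+1%:R + x) `^ (-1))).
      by rewrite ler_powR ?(le_trans _ h1) ?ler1n//; lra.
    by rewrite powR_inv1 ?(ltW h2)// lef_pV2 ?posrE.
  - exact: cvg_cst.
  - exact: cvg_harmonic.
have E N : (\sum_(0 <= j < N) (((2 * pi * j%:R + x) `^ e)%:E + ((2 * pi * j.+1%:R - x) `^ e)%:E) =
    (x `^ e + series (pole_term e ^~ x) N - p N)%:E)%E.
  elim: N => [|N IH]; first by rewrite /series/= !big_geq// /p mulr0 add0r addr0 subrr.
  rewrite big_nat_recr//= IH -!EFinD; congr EFin.
  by rewrite /series/= big_nat_recr//= /p /pole_term; ring.
rewrite (_ : (fun n => _) = (fun N => (x `^ e + series (pole_term e ^~ x) N - p N)%:E)); last first.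
  by apply/funext => N; rewrite E.
apply: cvg_EFin; first by apply: nearW.
rewrite -[X in _ --> X]subr0; apply: cvgB => //.
by apply: cvgD; [exact: cvg_cst|exact: c].
Qed.

End SpectralShape.

Section WaveIntegral.
Context {R : realType}.
Local Notation mu := (@lebesgue_measure R).

Lemma measurable_wave (t e : R) : measurable_fun [set: R] (fun x : R => (1 - cos (t * x)) * x `^ e).
Proof.
apply: measurable_funM; last exact: measurable_powR.
apply: measurable_funB; first exact: measurable_cst.
apply: (@measurableT_comp _ _ _ _ _ _ (@cos R)); first by apply: continuous_measurable_fun; exact: continuous_cos.
by apply: measurable_funM; [exact: measurable_cst|exact: measurable_id].
Qed.

(** For an integer t the factor 1 - cos (t x) is even and 2 pi-periodic, so it is unaffected by the
    folding and only the powers are summed. The substitution x -> t x then extracts the power of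
    t. *)
Lemma wave_integral (e d : R) (t : nat) : 0 < d -> e + 4 * d <= - 2 -> (0 < t)%N ->
  (\int[mu]_(x in `]0%R, pi]) ((1 - cos (t%:R * x)) * (x `^ e + pole_sum e x))%:E =
   (t%:R `^ (-1 - e))%:E * \int[mu]_(x in `]0%R, +oo[) ((1 - cos x) * x `^ e)%:E)%E.
Proof.
move=> d0 ed t0; pose f (y : R) := ((1 - cos (t%:R * y)) * y `^ e)%:E.
have t0' : 0 < t%:R :> R by rewrite ltr0n.
have mE (s : R) (D : set R) : measurable_fun D (fun y : R => ((1 - cos (s * y)) * y `^ e)%:E).
  by apply: measurable_funTS; apply/measurable_EFinP; exact: measurable_wave.
have w0 (s y : R) : 0 <= (1 - cos (s * y)) * y `^ e by rewrite mulr_ge0 ?powR_ge0// subr_ge0 cos_le1.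
transitivity (\int[mu]_(x in `]0%R, +oo[) f x)%E.
  rewrite ge0_integral_fold//; [|exact: mE|by move=> x; rewrite lee_fin].
  apply: eq_integral => x /set_mem /=; rewrite in_itv/= => /andP[x0 xp].
  have := esum_poles_fin d0 ed x0 xp; rewrite esum_poles// => E.
  rewrite EFinM -E -nneseriesZl; last by move=> j _; rewrite adde_ge0// lee_fin powR_ge0.
  apply: eq_eseriesr => j _; rewrite ge0_muleDr ?lee_fin ?powR_ge0//.
  rewrite /f !EFinM; congr (_%:E * _ + _%:E * _)%E; congr (1 - _).
    by rewrite -(cosD2pin _ (t * j)); congr cos; rewrite natrM; ring.
  by rewrite -cosN -(cosD2pin (- (t%:R * x)) (t * j.+1)); congr cos; rewrite natrM; ring.
rewrite (_ : (fun x => ((1 - cos x) * x `^ e)%:E) = (fun x : R => ((1 - cos (1 * x)) * x `^ e)%:E)); last first.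
  by apply/funext => x; rewrite mul1r.
have tn0 : t%:R != 0 :> R by rewrite gt_eqF.
rewrite (ge0_integral_affine 0 tn0 _ (mE 1 _))//; last by move=> x _; rewrite lee_fin.
have -> : [set x : R | `]0%R, +oo[%classic (t%:R * x + 0)] = `]0%R, +oo[%classic :> set R.
  by apply/seteqP; split => x /=; rewrite !in_itv/= !andbT addr0 pmulr_rgt0.
have -> : (\int[mu]_(x in `]0%R, +oo[) ((1 - cos (1 * (t%:R * x + 0))) * (t%:R * x + 0) `^ e)%:E =
  \int[mu]_(x in `]0%R, +oo[) ((t%:R `^ e)%:E * f x))%E.
  apply: eq_integral => x /set_mem /=; rewrite in_itv/= andbT => x0.
  rewrite mul1r addr0 /f -EFinM; congr EFin.
  by rewrite powRM ?(ltW x0)// mulrCA.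
rewrite ge0_integralZl_EFin ?powR_ge0//; last 2 first.
- by move=> x _; rewrite lee_fin.
- exact: (mE t%:R).
rewrite !muleA -!EFinM gtr0_norm//.
have -> : t%:R `^ (-1 - e) * t%:R * t%:R `^ e = 1 :> R.
  rewrite -[X in _ * X * _]powRr1 ?(ltW t0')// -!powRD ?tn0 ?implybT//.
  by rewrite (_ : -1 - e + 1 + e = 0) ?powRr0//; ring.
by rewrite mul1e.
Qed.

End WaveIntegral.

(** * Square integrable bounds uniform near H *)

Section ShapeBounds.
Context {R : realType}.
Local Notation mu := (@lebesgue_measure R).
Variable H : R.
Hypotheses (H1 : 1 / 2 < H) (H2 : H < 3 / 4).

(** A radius around H on which all bounds are uniform. The first term keeps [hexp + 4 * hrad] at
    most - 2, so that the poles away from 0 are summable. The second keeps [hsing] below 1 / 2, so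
    that [hdom] is square integrable; here H < 3/4 enters. *)
Definition hrad : R := Num.min ((2 * H - 1) / 4) ((3 - 4 * H) / 16).
Definition hexp : R := - (2 * H) - 1.
Definition hsing : R := 2 * H - 1 + 4 * hrad.

Lemma hrad_gt0 : 0 < hrad. Proof. by have h1 := H1; have h2 := H2; rewrite lt_min; apply/andP; split; lra. Qed.

Let hrad1 : hrad <= (2 * H - 1) / 4. Proof. by rewrite ge_min lexx. Qed.
Let hrad2 : hrad <= (3 - 4 * H) / 16. Proof. by rewrite ge_min lexx orbT. Qed.

Lemma hexp_hrad : hexp + 4 * hrad <= - 2. Proof. by rewrite /hexp; have := hrad1; lra. Qed.
Lemma hsing_gt0 : 0 < hsing. Proof. by rewrite /hsing; have := hrad_gt0; have := H1; lra. Qed.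
Lemma hsing_lt : hsing < 1 / 2. Proof. by rewrite /hsing; have := hrad2; have := H2; lra. Qed.

(** One majorant, up to constants, for the shape, its derivative in H and the Taylor remainder. The
    power dominates the pole at 0 with its logarithms, the 1 the other poles. *)
Definition hdom (x : R) : R := `|x| `^ (- hsing) + 1.

Lemma hdom_ge1 x : 1 <= hdom x. Proof. by rewrite lerDr powR_ge0. Qed.

Lemma one_sub_cos_ge0 (x : R) : 0 <= 1 - cos x. Proof. by rewrite subr_ge0 cos_le1. Qed.
Lemma one_sub_cos_le2 (x : R) : 1 - cos x <= 2.
Proof. by have := cos_geN1 x; lra. Qed.

Lemma sqr_powR (a y : R) : 0 < y -> y ^+ 2 * y `^ a = y `^ (2 + a).
Proof.
move=> y0; rewrite -powR_mulrn ?(ltW y0)// -powRD//.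
by apply/implyP => _; rewrite gt_eqF.
Qed.

(** The factor 1 - cos x <= x^2 / 2 raises the exponent at the origin by 2, which turns a
    non-integrable pole into the mild singularity of [hdom]. *)
Lemma one_sub_cos_powdom (x : R) : x != 0 -> (1 - cos x) * powdom hexp hrad `|x| <= hdom x.
Proof.
move=> x0; have y0 : 0 < `|x| by rewrite normr_gt0.
have c1 : 1 - cos x <= `|x| ^+ 2 / 2 by rewrite real_normK ?num_real//; have := cos_ge_taylor x; lra.
apply: (@le_trans _ _ (`|x| ^+ 2 / 2 * powdom hexp hrad `|x|)).
  by rewrite ler_wpM2r// powdom_ge0.
rewrite /hdom; move: (`|x|) y0 {c1} => y y0.
have E a := sqr_powR a y0.
have -> : y ^+ 2 / 2 * powdom hexp hrad y = (y `^ (2 + (hexp + 4 * hrad)) + y `^ (2 + (hexp - 4 * hrad))) / 2.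
  by rewrite -!E /powdom; field.
have -> : 2 + (hexp - 4 * hrad) = - hsing by rewrite /hexp /hsing; ring.
have a1 : 2 + (hexp + 4 * hrad) <= 0 by have := hexp_hrad; lra.
have a2 : - hsing <= 2 + (hexp + 4 * hrad) by have := hrad_gt0; rewrite /hexp /hsing; lra.
have hA : y `^ (2 + (hexp + 4 * hrad)) <= y `^ (- hsing) + 1.
  case: (lerP 1 y) => y1; last by apply: ler_wpDr => //; rewrite ger_powR// y0 ltW.
  by apply: ler_wpDl; [exact: powR_ge0|rewrite -[leRHS](powRr0 y) ler_powR].
have := powR_ge0 y (- hsing).
by rewrite ler_pdivrMr//; lra.
Qed.

Definition sing_sum (t x : R) : R := `|x| `^ (hexp - 2 * t) + pole_sum (hexp - 2 * t) x.
Definition dsing_sum (x : R) : R := - 2 * ln `|x| * `|x| `^ hexp + dpole_sum hexp x.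
Definition dshape (x : R) : R := (1 - cos x) * dsing_sum x.

(** A shift of H by at most [hrad] uses half of the margin in the exponent. The other half allows
    the pole estimates to be applied at the shifted exponent, with radius [hrad / 2]. *)
Lemma hexp_shift t : `|t| <= hrad -> hexp - 2 * t + 4 * (hrad / 2) <= - 2.
Proof. by have := hexp_hrad; rewrite ler_norml => h /andP[? ?]; lra. Qed.

Lemma hrad2_gt0 : 0 < hrad / 2. Proof. by rewrite divr_gt0// hrad_gt0. Qed.

Lemma pole_sumN (e x : R) : pole_sum e (- x) = pole_sum e x.
Proof.
rewrite /pole_sum; congr (limn (series _)); apply/funext => j.
by rewrite /pole_term opprK addrC.
Qed.

Lemma fgn_spec_shapeN h (x : R) : fgn_spec_shape h (- x) = fgn_spec_shape h x.
Proof.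
rewrite /fgn_spec_shape cosN; congr (_ * fine _); rewrite esum_int_opp; last first.
  by move=> j; rewrite lee_fin powR_ge0.
apply: eq_esum => j _; congr (_ `^ _)%:E.
by rewrite -normrN opprD opprK mulrNz mulrN opprK.
Qed.

Lemma fgn_spec_shapeE t x : `|t| <= hrad -> `|x| <= pi ->
  fgn_spec_shape (H + t) x = (1 - cos x) * sing_sum t x.
Proof.
move=> td.
have main y : 0 <= y -> y <= pi -> fgn_spec_shape (H + t) y = (1 - cos y) * sing_sum t y.
  rewrite le_eqVlt => /predU1P[<- _|y0 yp].
    by rewrite /fgn_spec_shape cos0 subrr !mul0r.
  rewrite /fgn_spec_shape /sing_sum gtr0_norm//; congr (_ * _).
  have -> : - (2 * (H + t)) - 1 = hexp - 2 * t by rewrite /hexp; ring.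
  by rewrite (esum_poles_fin hrad2_gt0 (hexp_shift td)).
case: (lerP 0 x) => x0 xp; first by rewrite main// (le_trans (ler_norm x)).
rewrite -fgn_spec_shapeN main ?oppr_ge0 ?(ltW x0)//; last by rewrite -(ltr0_norm x0).
by rewrite cosN /sing_sum normrN pole_sumN.
Qed.

Lemma shape_bound t x : `|t| <= hrad -> `|x| <= pi -> `|fgn_spec_shape (H + t) x| <= 17 * hdom x.
Proof.
move=> td xp; rewrite fgn_spec_shapeE//.
have [->|x0] := eqVneq x 0; first by rewrite cos0 subrr mul0r normr0 mulr_ge0// (le_trans ler01 (hdom_ge1 _)).
have y0 : 0 < `|x| by rewrite normr_gt0.
rewrite /sing_sum mulrDr; apply: le_trans (ler_normD _ _) _.
have -> : 17 * hdom x = hdom x + 2 * 8 * hdom x by ring.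
apply: lerD.
  rewrite ger0_norm ?mulr_ge0 ?powR_ge0 ?one_sub_cos_ge0//; apply: le_trans (one_sub_cos_powdom x0).
  by apply: ler_wpM2l; [exact: one_sub_cos_ge0|exact: powR_le_powdom].
rewrite normrM (ger0_norm (one_sub_cos_ge0 x)); apply: (@le_trans _ _ (2 * 8)).
  apply: ler_pM; rewrite ?one_sub_cos_ge0 ?one_sub_cos_le2//.
  exact: (pole_sum_bound hrad_gt0 hexp_hrad).
by rewrite ler_peMr// hdom_ge1.
Qed.

Lemma dshape_bound x : `|x| <= pi -> `|dshape x| <= 34 / hrad * hdom x.
Proof.
move=> xp; have d0 := hrad_gt0; have d0' : 0 <= hrad^-1 by rewrite invr_ge0 ltW.
rewrite /dshape.
have [->|x0] := eqVneq x 0.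
  by rewrite cos0 subrr mul0r normr0 mulr_ge0 ?(le_trans ler01 (hdom_ge1 _))// mulr_ge0.
have y0 : 0 < `|x| by rewrite normr_gt0.
rewrite /dsing_sum mulrDr; apply: le_trans (ler_normD _ _) _.
have -> : 34 / hrad * hdom x = 2 / hrad * hdom x + 2 * (16 / hrad) * hdom x by ring.
apply: lerD.
  rewrite normrM (ger0_norm (one_sub_cos_ge0 x)).
  apply: (@le_trans _ _ ((1 - cos x) * (2 / hrad * powdom hexp hrad `|x|))).
    by apply: ler_wpM2l; [exact: one_sub_cos_ge0|exact: lnpowR_le_powdom].
  by rewrite mulrCA; apply: ler_wpM2l; [rewrite mulr_ge0|exact: one_sub_cos_powdom].
rewrite normrM (ger0_norm (one_sub_cos_ge0 x)); apply: (@le_trans _ _ (2 * (16 / hrad))).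
  apply: ler_pM; rewrite ?one_sub_cos_ge0 ?one_sub_cos_le2//.
  exact: (dpole_sum_bound hrad_gt0 hexp_hrad).
by rewrite ler_peMr ?hdom_ge1// !mulr_ge0.
Qed.

Lemma shape_taylor t x : `|t| <= hrad -> `|x| <= pi ->
  `|fgn_spec_shape (H + t) x - fgn_spec_shape H x - t * dshape x| <= 68 / hrad ^+ 2 * hdom x * t ^+ 2.
Proof.
move=> td xp; have d0 := hrad_gt0; have d0' : 0 <= hrad ^- 2 by rewrite invr_ge0 exprn_ge0// ltW.
have t0 : `|0 : R| <= hrad by rewrite normr0 ltW.
rewrite -[in fgn_spec_shape H x](addr0 H) !fgn_spec_shapeE//.
have -> : (1 - cos x) * sing_sum t x - (1 - cos x) * sing_sum 0 x - t * dshape x =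
   (1 - cos x) * (`|x| `^ (hexp - 2 * t) - `|x| `^ hexp - t * (- 2 * ln `|x| * `|x| `^ hexp)) +
   (1 - cos x) * (pole_sum (hexp - 2 * t) x - pole_sum hexp x - t * dpole_sum hexp x).
  by rewrite /dshape /sing_sum /dsing_sum mulr0 subr0; ring.
have [->|x0] := eqVneq x 0.
  rewrite cos0 subrr !mul0r addr0 normr0; apply: mulr_ge0; last exact: sqr_ge0.
  by rewrite mulr_ge0 ?(le_trans ler01 (hdom_ge1 _))// mulr_ge0.
have y0 : 0 < `|x| by rewrite normr_gt0.
apply: le_trans (ler_normD _ _) _.
have -> : 68 / hrad ^+ 2 * hdom x * t ^+ 2 = 4 / hrad ^+ 2 * hdom x * t ^+ 2 + 2 * (32 / hrad ^+ 2 * t ^+ 2) * hdom x by ring.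
apply: lerD; rewrite normrM (ger0_norm (one_sub_cos_ge0 x)).
  apply: (@le_trans _ _ ((1 - cos x) * (4 / hrad ^+ 2 * powdom hexp hrad `|x| * t ^+ 2))).
    by apply: ler_wpM2l; [exact: one_sub_cos_ge0|exact: powR_taylor].
  have -> : (1 - cos x) * (4 / hrad ^+ 2 * powdom hexp hrad `|x| * t ^+ 2) =
    4 / hrad ^+ 2 * ((1 - cos x) * powdom hexp hrad `|x|) * t ^+ 2 by ring.
  apply: ler_wpM2r; first exact: sqr_ge0.
  by apply: ler_wpM2l; [rewrite mulr_ge0|exact: one_sub_cos_powdom].
apply: (@le_trans _ _ (2 * (32 / hrad ^+ 2 * t ^+ 2))).
  apply: ler_pM; rewrite ?one_sub_cos_ge0 ?one_sub_cos_le2//.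
  exact: (pole_sum_taylor hrad_gt0 hexp_hrad).
rewrite ler_peMr ?hdom_ge1//; apply: mulr_ge0 => //; apply: mulr_ge0; [exact: mulr_ge0|exact: sqr_ge0].
Qed.

Lemma is_derive_shape x : `|x| <= pi -> is_derive H 1 (fun h => fgn_spec_shape h x) (dshape x).
Proof.
move=> xp; apply: (is_derive_quadratic hrad_gt0) => t td.
exact: (shape_taylor td xp).
Qed.

Lemma shape_ge0 t x : `|t| <= hrad -> `|x| <= pi -> 0 <= fgn_spec_shape (H + t) x.
Proof.
move=> td xp; rewrite fgn_spec_shapeE// mulr_ge0 ?one_sub_cos_ge0// addr_ge0 ?powR_ge0//.
exact: (pole_sum_ge0 hrad2_gt0 (hexp_shift td)).
Qed.

Let measurable_pre (D : set R) : measurable_fun D (fun x : R => 1 - cos x).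
Proof.
apply: measurable_funTS; apply: measurable_funB; first exact: measurable_cst.
by apply: continuous_measurable_fun; exact: continuous_cos.
Qed.

Lemma measurable_sing_sum (t : R) : `|t| <= hrad -> measurable_fun `[- pi, pi] (sing_sum t).
Proof.
move=> td; apply: measurable_funD; last exact: (measurable_pole_sum hrad2_gt0 (hexp_shift td)).
apply: measurable_funTS; apply: (@measurableT_comp _ _ _ _ _ _ (@powR R ^~ _)); first exact: measurable_powR.
exact: normr_measurable.
Qed.

Lemma measurable_shape (t : R) : `|t| <= hrad -> measurable_fun `[- pi, pi] (fgn_spec_shape (H + t)).
Proof.
move=> td; apply: (eq_measurable_fun (fun x => (1 - cos x) * sing_sum t x)).
  by move=> x /set_mem /=; rewrite in_itv/= -ler_norml => xp; rewrite fgn_spec_shapeE.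
by apply: measurable_funM; [exact: measurable_pre|exact: measurable_sing_sum].
Qed.

Lemma measurable_dshape : measurable_fun `[- pi, pi] dshape.
Proof.
apply: measurable_funM; first exact: measurable_pre.
apply: measurable_funD; last exact: (measurable_dpole_sum hrad_gt0 hexp_hrad).
apply: measurable_funTS; apply: measurable_funM; last first.
  by apply: (@measurableT_comp _ _ _ _ _ _ (@powR R ^~ _)); [exact: measurable_powR|exact: normr_measurable].
apply: measurable_funM; first exact: measurable_cst.
by apply: (@measurableT_comp _ _ _ _ _ _ (@ln R)); [exact: measurable_ln|exact: normr_measurable].
Qed.

End ShapeBounds.

(** * Fourier coefficients *)

Section Parseval.
Context {R : realType}.
Local Notation mu := (@lebesgue_measure R).
Local Notation E := (`[0%R, pi]%classic : set R).

Implicit Types (f g : R -> R) (c B : R).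

Definition Ipi (f : R -> R) : R := \int[mu]_(x in E) f x.
Definition Lone (f : R -> R) := mu.-integrable E (EFin \o f).
Definition Ltwo (f : R -> R) := measurable_fun E f /\ Lone (fun x => f x ^+ 2).

Lemma muE : mu E = (pi)%:E.
Proof. by rewrite lebesgue_measure_itv/= lte_fin pi_gt0 sube0. Qed.

Lemma muE_lty : (mu E < +oo)%E. Proof. by rewrite muE ltry. Qed.

Lemma Lone_le f g : measurable_fun E f -> Lone g -> (forall x, E x -> `|f x| <= g x) -> Lone f.
Proof.
move=> mf ig fg; apply: (le_integrable _ _ _ ig) => //; first exact/measurable_EFinP.
by move=> x Ex; rewrite lee_fin; apply: le_trans (fg x Ex) (ler_norm _).
Qed.

Lemma Lone_cst c : Lone (fun=> c).
Proof.
apply/integrableP; split; first exact: measurable_cst.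
by rewrite integral_cst//= muE -EFinM ltry.
Qed.

Lemma LoneD f g : Lone f -> Lone g -> Lone (fun x => f x + g x).
Proof. by move=> i1 i2; have := integrableD _ i1 i2; apply. Qed.

Lemma LoneZ c f : Lone f -> Lone (fun x => c * f x).
Proof. by move=> i1; have := integrableZl _ c i1; apply. Qed.

Lemma LoneB f g : Lone f -> Lone g -> Lone (fun x => f x - g x).
Proof.
move=> i1 i2; have := LoneD i1 (LoneZ (-1) i2); congr Lone.
by apply/funext => x; rewrite mulN1r.
Qed.

Lemma Lone_sum (I : Type) (s : seq I) (F : I -> R -> R) : (forall i, Lone (F i)) ->
  Lone (fun x => \sum_(i <- s) F i x).
Proof.
move=> h; elim: s => [|i s IH].
  by under eq_fun do rewrite big_nil; exact: Lone_cst.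
by under eq_fun do rewrite big_cons; exact: LoneD.
Qed.

Lemma Lone_meas f : Lone f -> measurable_fun E f.
Proof. by move=> /integrableP[/measurable_EFinP]. Qed.

Lemma Lone_bounded f B : measurable_fun E f -> (forall x, E x -> `|f x| <= B) -> Lone f.
Proof. by move=> mf fB; apply: Lone_le (Lone_cst B) _. Qed.

Lemma Ipi_cst c : Ipi (fun=> c) = c * pi.
Proof. by rewrite /Ipi Rintegral_cst//= muE. Qed.

Lemma IpiD f g : Lone f -> Lone g -> Ipi (fun x => f x + g x) = Ipi f + Ipi g.
Proof. exact: RintegralD. Qed.

Lemma IpiB f g : Lone f -> Lone g -> Ipi (fun x => f x - g x) = Ipi f - Ipi g.
Proof. exact: RintegralB. Qed.

Lemma IpiZ c f : Lone f -> Ipi (fun x => c * f x) = c * Ipi f.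
Proof. exact: RintegralZl. Qed.

Lemma Ipi_sum (I : Type) (s : seq I) (F : I -> R -> R) : (forall i, Lone (F i)) ->
  Ipi (fun x => \sum_(i <- s) F i x) = \sum_(i <- s) Ipi (F i).
Proof.
move=> h; elim: s => [|i s IH].
  under [X in Ipi X]eq_fun do rewrite big_nil.
  by rewrite Ipi_cst mul0r big_nil.
under [X in Ipi X]eq_fun do rewrite big_cons.
by rewrite IpiD ?big_cons ?IH//; exact: Lone_sum.
Qed.

Lemma Ipi_le f g : Lone f -> Lone g -> (forall x, E x -> f x <= g x) -> Ipi f <= Ipi g.
Proof. by move=> i1 i2 h; apply: le_Rintegral. Qed.

Lemma Ipi_ge0 f : (forall x, E x -> 0 <= f x) -> 0 <= Ipi f.
Proof. by move=> f0; apply: Rintegral_ge0. Qed.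

Lemma Ipi_norm f : Lone f -> `|Ipi f| <= Ipi (fun x => `|f x|).
Proof. by move=> i1; apply: le_normr_Rintegral. Qed.

Lemma eq_Ipi f g : (forall x, E x -> f x = g x) -> Ipi f = Ipi g.
Proof. by move=> h; apply: eq_Rintegral => x /set_mem /h. Qed.

Lemma Ltwo_mul f g : Ltwo f -> Ltwo g -> Lone (fun x => f x * g x).
Proof.
move=> [mf If] [mg Ig]; apply: Lone_le (LoneD If Ig) _; first exact: measurable_funM.
move=> x _; rewrite normrM -(real_normK (num_real (f x))) -(real_normK (num_real (g x))).
have := sqr_ge0 (`|f x| - `|g x|); have := normr_ge0 (f x); have := normr_ge0 (g x).
by move: `|f x| `|g x| => a b; nra.
Qed.

Lemma Ltwo_one f : Ltwo f -> Lone f.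
Proof.
move=> [mf If]; apply: Lone_le (LoneD (Lone_cst 1) If) _ => // x _.
rewrite -(real_normK (num_real (f x))).
by have := sqr_ge0 (`|f x| - 1); have := normr_ge0 (f x); move: `|f x| => a; nra.
Qed.

Lemma LtwoD f g : Ltwo f -> Ltwo g -> Ltwo (fun x => f x + g x).
Proof.
move=> [mf If] [mg Ig]; split; first exact: measurable_funD.
apply: Lone_le (LoneD (LoneZ 2 If) (LoneZ 2 Ig)) _.
  by apply: measurable_funX; exact: measurable_funD.
by move=> x _; rewrite ger0_norm ?sqr_ge0//; have := sqr_ge0 (f x - g x); nra.
Qed.

Lemma LtwoZ c f : Ltwo f -> Ltwo (fun x => c * f x).
Proof.
move=> [mf If]; split; first by apply: measurable_funM => //; exact: measurable_cst.
by have := LoneZ (c ^+ 2) If; congr Lone; apply/funext => x; rewrite exprMn.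
Qed.

Lemma LtwoB f g : Ltwo f -> Ltwo g -> Ltwo (fun x => f x - g x).
Proof.
move=> h1 h2; have := LtwoD h1 (LtwoZ (-1) h2); congr Ltwo.
by apply/funext => x; rewrite mulN1r.
Qed.

Lemma Ltwo_bounded f B : measurable_fun E f -> (forall x, E x -> `|f x| <= B) -> Ltwo f.
Proof.
move=> mf fB; split => //; apply: (@Lone_bounded _ (B ^+ 2)); first exact: measurable_funX.
by move=> x Ex; rewrite normrX lerXn2r ?nnegrE ?fB// (le_trans _ (fB x Ex)).
Qed.

Lemma Ltwo_cos (k : R) : Ltwo (fun x => cos (k * x)).
Proof.
apply: (@Ltwo_bounded _ 1); last by move=> x _; exact: cos_max.
apply: measurable_funTS; apply: continuous_measurable_fun => x.
apply: (@continuous_comp _ _ _ (fun x : R => k * x) cos); last exact: continuous_cos.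
by apply: cvgM; [exact: cvg_cst|exact: cvg_id].
Qed.

Lemma Ipi_cos (m : nat) : Ipi (fun x => cos (m%:R * x)) = pi * (m == 0%N)%:R.
Proof.
case: m => [|m].
  under [X in Ipi X]eq_fun do rewrite mul0r cos0.
  by rewrite Ipi_cst mul1r mulr1.
rewrite mulr0 /Ipi /Rintegral.
pose F (x : R) := sin (m.+1%:R * x) / m.+1%:R.
have m0 : m.+1%:R != 0 :> R by rewrite pnatr_eq0.
have dF (x : R) : is_derive x 1 F (cos (m.+1%:R * x)).
  have h : is_derive x 1 (fun x : R => m.+1%:R * x) m.+1%:R.
    by apply: is_derive_eq; rewrite /GRing.scale/= mulr1.
  have hs := @is_derive1_comp R sin _ x _ _ (is_derive_sin (m.+1%:R * x)) h.
  have := @is_deriveM _ _ _ _ _ _ _ _ hs (is_derive_cst (m.+1%:R^-1 : R) x 1).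
  move=> E0; suff -> : cos (m.+1%:R * x) = (sin \o (fun x0 : R => m.+1%:R * x0)) x *: (0 : R) +
      cst m.+1%:R^-1 x *: (cos (m.+1%:R * x) * m.+1%:R) by exact: E0.
  by rewrite /GRing.scale/= mulr0 add0r mulrCA mulVf// mulr1.
have cF (x : R) : {for x, continuous F}.
  by apply: differentiable_continuous; apply/derivable1_diffP; have [] := dF x.
rewrite (@continuous_FTC2 _ _ F)//.
- rewrite /F mulr0 sin0 mul0r.
  have -> : sin (m.+1%:R * pi) = 0 :> R.
    elim: m {m0 F dF cF} => [|m IH]; first by rewrite mul1r sinpi.
    by rewrite -natr1 mulrDl mul1r sinDpi IH oppr0.
  by rewrite mul0r sube0.
- exact: pi_gt0.
- apply: continuous_subspaceT => x; apply: (@continuous_comp _ _ _ (fun x : R => m.+1%:R * x) cos); last exact: continuous_cos.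
  by apply: cvgM; [exact: cvg_cst|exact: cvg_id].
- split.
  + by move=> x _; have [] := dF x.
  + by apply: cvg_at_right_filter; exact: cF.
  + by apply: cvg_at_left_filter; exact: cF.
- by move=> x _; have [_] := dF x; rewrite derive1E.
Qed.

(** The squared norm of cos (k x) on [0, pi] is pi / [cosweight k]. *)
Definition cosweight (k : nat) : R := if k == 0%N then 1 else 2.

Lemma cosweight_gt0 k : 0 < cosweight k. Proof. by rewrite /cosweight; case: eqP. Qed.

Lemma Ipi_coscos (j k : nat) :
  Ipi (fun x => cos (j%:R * x) * cos (k%:R * x)) = (j == k)%:R * (pi / cosweight k).
Proof.
wlog jk : j k / (k <= j)%N => [hw|].
  have [|/ltnW h] := leqP k j; first exact: hw.
  rewrite -[LHS](_ : Ipi (fun x => cos (k%:R * x) * cos (j%:R * x)) = _); last first.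
    by apply: eq_Ipi => x _; rewrite mulrC.
  by rewrite hw// eq_sym; case: eqP => [->|]//; rewrite !mul0r.
have c1 (a : nat) : Lone (fun x => cos (a%:R * x)) by exact/Ltwo_one/Ltwo_cos.
have -> : (fun x => cos (j%:R * x) * cos (k%:R * x)) =
   (fun x => 2^-1 * (cos ((j + k)%N%:R * x) + cos ((j - k)%N%:R * x))) :> (R -> R).
  apply/funext => x; rewrite cosM natrD natrB//; congr (_ * (cos _ + cos _)); ring.
rewrite IpiZ; last exact: LoneD.
rewrite IpiD// !Ipi_cos /cosweight addn_eq0 subn_eq0.
have [->|nk] := eqVneq j k.
  by rewrite leqnn andbb; case: eqP => _ /=; field.
have -> : (j <= k)%N = false by apply/negbTE; rewrite -ltnNge ltn_neqAle eq_sym nk jk.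
suff -> : (j == 0%N) = false by rewrite /=; ring.
by apply/negbTE; rewrite -lt0n (leq_ltn_trans (leq0n k))// ltn_neqAle eq_sym nk jk.
Qed.

Section Function.
Variable g : R -> R.
Hypothesis g2 : Ltwo g.

(** For an even function this is the mean of g x cos (k x) over [-pi, pi], the normalization under
    which the spectral density has the autocovariances as coefficients. *)
Definition fcoef (k : nat) : R := Ipi (fun x => g x * cos (k%:R * x)) / pi.

(** Completing the square in each coefficient. It yields both Bessel's inequality and the optimality
    of the Fourier coefficients. *)
Lemma bessel_identity N (c : nat -> R) :
  Ipi (fun x => (g x - \sum_(k < N) c k * cos (k%:R * x)) ^+ 2) =
  Ipi (fun x => g x ^+ 2) - pi * (\sum_(k < N) cosweight k * fcoef k ^+ 2) +
  pi * \sum_(k < N) (c k - cosweight k * fcoef k) ^+ 2 / cosweight k.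
Proof.
have p0 : pi != 0 :> R by rewrite gt_eqF// pi_gt0.
have cc k := Ltwo_cos k%:R.
have -> : (fun x => (g x - \sum_(k < N) c k * cos (k%:R * x)) ^+ 2) =
  (fun x => g x ^+ 2 - \sum_(k < N) (2 * c k) * (g x * cos (k%:R * x)) +
    \sum_(j < N) \sum_(k < N) (c j * c k) * (cos (j%:R * x) * cos (k%:R * x))).
  apply/funext => x; rewrite sqrrB; congr (_ - _ + _).
    by rewrite mulr_sumr -sumrMnl; apply: eq_bigr => k _; rewrite mulr2n; ring.
  rewrite expr2 big_distrlr/=; apply: eq_bigr => j _; apply: eq_bigr => k _; ring.
have i1 (k : 'I_N) : Lone (fun x => (2 * c k) * (g x * cos (k%:R * x))) by apply: LoneZ; exact: Ltwo_mul.
have i2 (j k : 'I_N) : Lone (fun x => (c j * c k) * (cos (j%:R * x) * cos (k%:R * x))) by apply: LoneZ; exact: Ltwo_mul.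
have i3 (j : 'I_N) : Lone (fun x => \sum_(k < N) (c j * c k) * (cos (j%:R * x) * cos (k%:R * x))).
  by apply: Lone_sum => k; exact: i2.
rewrite IpiD; [|by apply: LoneB; [exact: g2.2|exact: Lone_sum]|exact: Lone_sum].
rewrite IpiB; [|exact: g2.2|exact: Lone_sum].
rewrite !Ipi_sum//.
have -> : \sum_(j < N) Ipi (fun x => \sum_(k < N) (c j * c k) * (cos (j%:R * x) * cos (k%:R * x))) =
   \sum_(j < N) c j ^+ 2 * (pi / cosweight j).
  apply: eq_bigr => j _; rewrite Ipi_sum//.
  rewrite (bigD1 j)//= big1 ?addr0.
    by rewrite IpiZ; [rewrite Ipi_coscos eqxx mul1r expr2|exact: Ltwo_mul].
  move=> k kj; rewrite IpiZ; last exact: Ltwo_mul.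
  by rewrite Ipi_coscos (_ : (j == k :> nat) = false) ?mul0r ?mulr0//; apply/negbTE; rewrite eq_sym.
have -> : \sum_(k < N) Ipi (fun x => (2 * c k) * (g x * cos (k%:R * x))) = \sum_(k < N) 2 * c k * (pi * fcoef k).
  apply: eq_bigr => k _; rewrite IpiZ; last exact: Ltwo_mul.
  by rewrite /fcoef [pi * _]mulrC divfK.
rewrite !mulr_sumr -!addrA; congr (_ + _); rewrite -!sumrN -!big_split/=; apply: eq_bigr => k _.
by field; rewrite gt_eqF// cosweight_gt0.
Qed.

Lemma symsum_cosweight N (s : nat -> R) : symsum (fun k => s k ^+ 2) N = \sum_(k < N.+1) cosweight k * s k ^+ 2.
Proof.
rewrite /symsum big_ord_recl/= /cosweight eqxx mul1r mulr_sumr; congr (_ + _).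
Qed.

Lemma bessel_le N : pi * symsum (fun k => fcoef k ^+ 2) N <= Ipi (fun x => g x ^+ 2).
Proof.
have := bessel_identity N.+1 (fun k => cosweight k * fcoef k).
rewrite [X in _ + pi * X]big1 ?mulr0 ?addr0; last by move=> k _; rewrite subrr expr0n mul0r.
rewrite -symsum_cosweight => E0; rewrite -subr_ge0 -E0.
by apply: Ipi_ge0 => x _; exact: sqr_ge0.
Qed.

Lemma bessel_min N (c : nat -> R) : Ipi (fun x => g x ^+ 2) - pi * symsum (fun k => fcoef k ^+ 2) N <=
  Ipi (fun x => (g x - \sum_(k < N.+1) c k * cos (k%:R * x)) ^+ 2).
Proof.
rewrite bessel_identity -symsum_cosweight lerDl mulr_ge0 ?pi_ge0//.
by apply: sumr_ge0 => k _; rewrite divr_ge0 ?sqr_ge0// ltW// cosweight_gt0.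
Qed.

Definition clip (M y : R) : R := Num.max (- M) (Num.min M y).

Lemma clip_bound M y : 0 <= M -> `|clip M y| <= M.
Proof.
move=> M0; rewrite /clip ler_norml le_max lexx/= ge_max ge_min lexx/= andbT.
by rewrite (le_trans _ M0)// oppr_le0.
Qed.

Lemma clip_id M y : `|y| <= M -> clip M y = y.
Proof. by rewrite ler_norml => /andP[h1 h2]; rewrite /clip min_r// max_r. Qed.

Lemma clip_lip M x y : `|clip M x - clip M y| <= `|x - y|.
Proof.
rewrite /clip /Order.max /Order.min.
by case: (ltP M x) => ?; case: (ltP M y) => ?; case: (ltP (- M) M) => ?; try (case: (ltP (- M) x) => ?); try (case: (ltP (- M) y) => ?);
 rewrite ler_norml; have := ler_norm (x - y); have := ler_norm (- (x - y));
 rewrite normrN => ? ?; apply/andP; split; lra.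
Qed.

Lemma clip_le M y : 0 <= M -> `|y - clip M y| <= `|y|.
Proof.
move=> M0; rewrite /clip /Order.max /Order.min.
by case: (ltP M y) => ?; case: (ltP (- M) M) => ?; try (case: (ltP (- M) y) => ?);
 rewrite ler_norml; have := ler_norm y; have := ler_norm (- y);
 rewrite normrN => ? ?; apply/andP; split; lra.
Qed.

Lemma continuous_clip M : continuous (clip M).
Proof.
move=> y; apply: (@continuous_max _ _ (fun=> - M) (fun y : R => Num.min M y)); first exact: cvg_cst.
by apply: (@continuous_min _ _ (fun=> M) (fun y : R => y)); [exact: cvg_cst|exact: cvg_id].
Qed.

Lemma measurable_clip M (f : R -> R) : measurable_fun E f -> measurable_fun E (fun x => clip M (f x)).
Proof.
move=> mf; apply: (@measurableT_comp _ _ _ _ _ _ (clip M)) => //.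
by apply: continuous_measurable_fun; exact: continuous_clip.
Qed.

Lemma cvg_clip : Ipi (fun x => (g x - clip n%:R (g x)) ^+ 2) @[n --> \oo] --> 0.
Proof.
have [mg Ig] := g2.
have md n : measurable_fun E (fun x => (g x - clip n%:R (g x)) ^+ 2).
  by apply: measurable_funX; apply: measurable_funB => //; exact: measurable_clip.
have cv : (\int[mu]_(x in E) ((g x - clip n%:R (g x)) ^+ 2)%:E @[n --> \oo] --> \int[mu]_(x in E) (0:R)%:E)%E.
  apply: (@dominated_cvg _ _ _ mu E _ _ _ (EFin \o (fun x => g x ^+ 2))) => //.
  - by move=> n; apply/measurable_EFinP; exact: md.
  - move=> x _; apply: cvg_near_cst; near=> n.
    rewrite clip_id ?subrr ?expr0n//; near: n; exact: nbhs_infty_ger.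
  - move=> n x _; rewrite /= lee_fin normrX -[leRHS]real_normK ?num_real//.
    by rewrite lerXn2r ?nnegrE// clip_le// ler0n.
rewrite integral0 in cv.
by apply: fine_cvg; exact: cv.
Unshelve. all: end_near. Qed.

(** Three approximations in turn: g by its clipping at height M, that by a continuous function, that
    by a cosine polynomial. Each costs less than e / 9 in squared norm, and the square of a sum of
    three is at most three times the sum of squares. *)
Lemma cospoly_dense (e : R) : 0 < e -> exists p, cospoly p /\ Ipi (fun x => (g x - p x) ^+ 2) < e.
Proof.
move=> e0; have p0 := pi_gt0 R; have [mg Ig] := g2.
have e9 : 0 < e / 9 by rewrite divr_gt0.
have [M [M0 hM]] : exists M : nat, (0 < M)%N /\ Ipi (fun x => (g x - clip M%:R (g x)) ^+ 2) < e / 9.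
  have /cvgrPdist_lt/(_ _ e9) [m _ hm] := cvg_clip.
  exists m.+1; split => //; have := hm m.+1 (leqnSn m).
  by rewrite sub0r normrN; apply: le_lt_trans; exact: ler_norm.
have M0' : 0 < M%:R :> R by rewrite ltr0n.
pose gM x := clip M%:R (g x).
have mgM : measurable_fun E gM by exact: measurable_clip.
have gMB x : `|gM x| <= M%:R by exact/clip_bound/ltW.
have igM : Lone gM by apply: Lone_bounded mgM _ => x _.
have [c_ [cc ic cv]] := approximation_continuous_integrable (measurable_itv _) muE_lty igM.
(* The continuous approximation is close in L1 only. Once both functions are clipped at M, the
   squared difference is at most 2 M times the absolute difference, which costs 2 M e1 = e / 18. *)
pose e1 := e / (36 * M%:R).
have e10 : 0 < e1 by rewrite divr_gt0// mulr_gt0.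
have [n hn] : exists n, Ipi (fun x => `|gM x - c_ n x|) < e1.
  have /fine_cvgP[[m1 _ h1] /cvgrPdist_lt/(_ _ e10) [m2 _ h2]] := cv.
  exists (maxn m1 m2); have := h2 (maxn m1 m2) (leq_maxr _ _).
  by rewrite /= sub0r normrN; apply: le_lt_trans; exact: ler_norm.
pose c x := clip M%:R (c_ n x).
have cont : continuous c.
  by move=> x; apply: (@continuous_comp _ _ _ (c_ n) (clip M%:R)); [exact: cc|exact: continuous_clip].
have mc : measurable_fun E c by apply: measurable_funTS; exact: continuous_measurable_fun.
have cB x : `|c x| <= M%:R by exact/clip_bound/ltW.
(* A uniform error e2 costs pi e2^2 = e / 36 in squared norm. *)
pose e2 := Num.sqrt (e / (9 * pi)) / 2.
have s0 : 0 < e / (9 * pi) by rewrite divr_gt0// mulr_gt0.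
have e20 : 0 < e2 by rewrite divr_gt0// sqrtr_gt0.
have [p [pc pa]] := cospoly_approx cont e20.
exists p; split => //.
have mp : measurable_fun E p.
  have [N [a pE]] := pc; rewrite (_ : p = fun x => \sum_(k < N) a k * cos (k%:R * x)); last by apply/funext.
  by apply: Lone_meas; apply: Lone_sum => k; apply: LoneZ; exact/Ltwo_one/Ltwo_cos.
have pe x : E x -> `|p x - c x| <= e2 by rewrite /= in_itv/=; exact: pa.
have L1 : Ltwo (fun x => g x - gM x) by apply: LtwoB => //; apply: (@Ltwo_bounded _ M%:R) => // x _.
have L2 : Ltwo (fun x => gM x - c x) by apply: LtwoB; apply: (@Ltwo_bounded _ M%:R).
have L3 : Ltwo (fun x => p x - c x) by apply: (@Ltwo_bounded _ e2) => //; exact: measurable_funB.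
have L4 : Ltwo (fun x => g x - p x).
  have := LtwoB (LtwoD L1 L2) L3; congr Ltwo; apply/funext => x; ring.
have i2 : Ipi (fun x => (gM x - c x) ^+ 2) < e / 9.
  have iA : Lone (fun x => `|gM x - c_ n x|).
    by have := LoneB igM (ic n); exact: integrable_norm.
  apply: (@le_lt_trans _ _ (2 * M%:R * Ipi (fun x => `|gM x - c_ n x|))).
    rewrite -IpiZ//; apply: Ipi_le; [exact: L2.2|exact: LoneZ|].
    move=> x _; rewrite -real_normK ?num_real// expr2; apply: ler_pM => //.
      by rewrite mulr_natl mulr2n; apply: le_trans (ler_normB _ _) _; apply: lerD.
    have := clip_lip M%:R (gM x) (c_ n x); rewrite [clip _ (gM x)]clip_id//.
  apply: (@lt_trans _ _ (2 * M%:R * e1)).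
    by rewrite ltr_pM2l// mulr_gt0.
  have -> : 2 * M%:R * e1 = e / 18 by rewrite /e1; field; rewrite gt_eqF.
  by rewrite ltr_pM2l// ltf_pV2 ?posrE// ltr_nat.
have i3 : Ipi (fun x => (p x - c x) ^+ 2) < e / 9.
  apply: (@le_lt_trans _ _ (Ipi (fun=> e2 ^+ 2))).
    apply: Ipi_le; [exact: L3.2|exact: Lone_cst|].
    by move=> x Ex; rewrite -real_normK ?num_real// lerXn2r ?nnegrE ?pe// ltW.
  rewrite Ipi_cst /e2 exprMn sqr_sqrtr ?(ltW s0)//.
  have eqn (q : R) : q != 0 -> e / (9 * q) * 2^-1 ^+ 2 * q = e / 36 by move=> q0; field.
  rewrite eqn; last by rewrite gt_eqF.
  by rewrite ltr_pM2l// ltf_pV2 ?posrE// ltr_nat.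
apply: (@le_lt_trans _ _ (3 * (Ipi (fun x => (g x - gM x) ^+ 2) + Ipi (fun x => (gM x - c x) ^+ 2) + Ipi (fun x => (p x - c x) ^+ 2)))).
  have l1 := LoneD L1.2 L2.2; have l2 := LoneD l1 L3.2.
  rewrite -(IpiD L1.2 L2.2) -(IpiD l1 L3.2) -(IpiZ _ l2).
  apply: Ipi_le; [exact: L4.2|exact: LoneZ|].
  move=> x _; have := sqr_ge0 ((g x - gM x) - (gM x - c x)); have := sqr_ge0 ((gM x - c x) + (p x - c x)).
  have := sqr_ge0 ((g x - gM x) + (p x - c x)).
  move: (g x) (gM x) (c x) (p x) => a b k l; nra.
lra.
Qed.

Lemma parseval : symsum (fun k => fcoef k ^+ 2) N @[N --> \oo] --> Ipi (fun x => g x ^+ 2) / pi.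
Proof.
have p0 := pi_gt0 R.
have nd : {homo symsum (fun k => fcoef k ^+ 2) : n m / (n <= m)%N >-> n <= m}.
  apply/nondecreasing_seqP => m; rewrite /symsum big_ord_recr/= lerD2l ler_wpM2l//.
  by rewrite lerDl sqr_ge0.
apply/cvgrPdist_lt => e e0.
have [p [[N [a pE]] pe]] := cospoly_dense (mulr_gt0 e0 p0).
exists N => // m /= Nm; rewrite ger0_norm; last first.
  by rewrite subr_ge0 ler_pdivlMr// mulrC bessel_le.
rewrite -(ltr_pM2r p0) mulrBl divfK ?gt_eqF// mulrC; apply: le_lt_trans pe.
apply: (@le_trans _ _ (Ipi (fun x => g x ^+ 2) - pi * symsum (fun k => fcoef k ^+ 2) N)).
  by rewrite lerD2l lerN2 ler_pM2l// nd.
apply: le_trans (bessel_min N (fun k => if (k < N)%N then a k else 0)) _.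
rewrite le_eqVlt; apply/orP; left; apply/eqP; apply: eq_Ipi => x _; congr ((_ - _) ^+ 2).
rewrite big_ord_recr/= ltnn mul0r addr0 pE; apply: eq_bigr => k _.
by rewrite ltn_ord.
Qed.

End Function.
End Parseval.

(** * The autocovariances as Fourier coefficients *)

Section SpectralDensity.
Context {R : realType}.
Local Notation mu := (@lebesgue_measure R).
Local Notation E := (`[0%R, pi]%classic : set R).
Variable H : R.
Hypotheses (H1 : 1 / 2 < H) (H2 : H < 3 / 4).
Local Notation hrad := (hrad H).

Let r0 : 0 < hrad. Proof. exact: hrad_gt0. Qed.
Let t0 : `|0 : R| <= hrad. Proof. by rewrite normr0 ltW. Qed.

Let Eabs (x : R) : E x -> `|x| <= pi.
Proof. by rewrite /= in_itv/= => /andP[x0 xp]; rewrite ger0_norm. Qed.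

Let EsubS : E `<=` (`[- pi, pi]%classic : set R).
Proof.
move=> x /= ; rewrite !in_itv/= => /andP[x0 ->]; rewrite andbT.
by rewrite (le_trans _ x0)// oppr_le0 pi_ge0.
Qed.

Let mES (f : R -> R) : measurable_fun (`[- pi, pi]%classic : set R) f -> measurable_fun E f.
Proof. by move=> mf; apply: measurable_funS mf. Qed.

Lemma Lone_powRN (g : R) : 0 <= g -> g < 1 -> Lone (fun x : R => `|x| `^ (- g)).
Proof.
move=> g0 g1; apply: Lone_le (integrable_powRN g0 g1) _.
  apply: measurable_funTS; apply: (@measurableT_comp _ _ _ _ _ _ (@powR R ^~ _)); first exact: measurable_powR.
  exact: normr_measurable.
move=> x; rewrite /= in_itv/= => /andP[x0 _].
by rewrite (ger0_norm x0) ger0_norm ?powR_ge0.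
Qed.

Lemma Ltwo_hdom : Ltwo (hdom H).
Proof.
have s0 := hsing_gt0 H1 H2; have s1 := hsing_lt H2.
have L1 : Lone (fun x : R => `|x| `^ (- hsing H)) by apply: Lone_powRN; [exact: ltW|lra].
have L2 : Lone (fun x : R => `|x| `^ (- (hsing H *+ 2))) by apply: Lone_powRN; rewrite mulr2n; lra.
have m1 : measurable_fun E (hdom H) by apply: measurable_funD; [exact: Lone_meas|exact: measurable_cst].
split => //; apply: Lone_le (LoneD (LoneZ 2 L2) (Lone_cst 2)) _; first exact: measurable_funX.
move=> x _; rewrite ger0_norm ?sqr_ge0// /hdom.
have -> : `|x| `^ (- (hsing H *+ 2)) = (`|x| `^ (- hsing H)) ^+ 2.
  by rewrite -[RHS]powR_mulrn ?powR_ge0// -powRrM mulNr mulr_natr.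
by have := sqr_ge0 (`|x| `^ (- hsing H) - 1); move: (_ `^ _) => y; nra.
Qed.

Lemma Ltwo_hdom_le (f : R -> R) (c : R) : measurable_fun (`[- pi, pi]%classic : set R) f ->
  (forall x, `|x| <= pi -> `|f x| <= c * hdom H x) -> Ltwo f.
Proof.
move=> /mES mf fc; have [m1 i1] := Ltwo_hdom; split => //.
apply: Lone_le (LoneZ (c ^+ 2) i1) _; first exact: measurable_funX.
move=> x Ex; rewrite normrX -exprMn; have fx := fc x (Eabs Ex).
by rewrite lerXn2r ?nnegrE// (le_trans _ fx).
Qed.

Lemma Ltwo_shape (t : R) : `|t| <= hrad -> Ltwo (fgn_spec_shape (H + t)).
Proof.
move=> td; apply: Ltwo_hdom_le; first exact: measurable_shape.
by move=> x; exact: shape_bound.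
Qed.

Lemma Ltwo_dshape : Ltwo (dshape H).
Proof. by apply: Ltwo_hdom_le; [exact: measurable_dshape|exact: dshape_bound]. Qed.

Definition shape_coef (h : R) (k : nat) : R := Ipi (fun x => fgn_spec_shape h x * cos (k%:R * x)).
Definition dshape_coef (k : nat) : R := Ipi (fun x => dshape H x * cos (k%:R * x)).

Lemma is_derive_shape_coef k : is_derive H 1 (fun h => shape_coef h k) (dshape_coef k).
Proof.
apply: (@is_derive_quadratic _ _ _ _ (Ipi (fun x => 68 / hrad ^+ 2 * hdom H x)) hrad r0) => t td.
have Lc := Ltwo_cos (k%:R : R).
have L1 := Ltwo_mul (Ltwo_shape td) Lc.
have L2 : Lone (fun x => fgn_spec_shape H x * cos (k%:R * x)).
  by have := Ltwo_mul (Ltwo_shape t0) Lc; rewrite addr0.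
have L3 := Ltwo_mul Ltwo_dshape Lc.
have Lh : Lone (fun x => 68 / hrad ^+ 2 * hdom H x) by apply: LoneZ; exact: (Ltwo_one Ltwo_hdom).
rewrite /shape_coef /dshape_coef -(IpiB L1 L2) -(IpiZ t L3) -(IpiB (LoneB L1 L2) (LoneZ t L3)).
rewrite mulrC -(IpiZ _ Lh).
have L4 := LoneB (LoneB L1 L2) (LoneZ t L3).
apply: le_trans (Ipi_norm L4) _; apply: Ipi_le; [exact: integrable_norm|exact: LoneZ|].
move=> x Ex.
have -> : fgn_spec_shape (H + t) x * cos (k%:R * x) - fgn_spec_shape H x * cos (k%:R * x) -
  t * (dshape H x * cos (k%:R * x)) = (fgn_spec_shape (H + t) x - fgn_spec_shape H x - t * dshape H x) * cos (k%:R * x).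
  by ring.
rewrite normrM [leLHS]mulrC; apply: le_trans (ler_piMl _ (cos_max _)) _ => //.
by rewrite [leRHS]mulrC; exact: shape_taylor (Eabs Ex).
Qed.

Section Wave.
Variable t : R.
Hypothesis td : `|t| <= hrad.

Let S := sing_sum H t.
Let wave (m : nat) (x : R) := (1 - cos (m%:R * x)) * S x.

Let mwave m : measurable_fun E (wave m).
Proof.
apply: measurable_funM; last by apply: mES; exact: measurable_sing_sum.
by apply: measurable_funB; [exact: measurable_cst|exact: (Ltwo_cos (m%:R : R)).1].
Qed.

Let wave_ge0 m x : E x -> 0 <= wave m x.
Proof.
move=> Ex; rewrite mulr_ge0 ?subr_ge0 ?cos_le1// addr_ge0 ?powR_ge0//.
exact: (pole_sum_ge0 (hrad2_gt0 H1 H2) (hexp_shift td) (Eabs Ex)).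
Qed.

Let W := (\int[mu]_(x in `]0%R, +oo[) ((1 - cos x) * x `^ (hexp H - 2 * t))%:E)%E.

Let waveE m : (0 < m)%N -> (\int[mu]_(x in E) (wave m x)%:E = (m%:R `^ (2 * (H + t)))%:E * W)%E.
Proof.
move=> m0; rewrite -integral_itv_obnd_cbnd; last first.
  apply/measurable_EFinP; apply: measurable_funS (mwave m) => //.
  by apply: subset_itvr; rewrite bnd_simp.
have := wave_integral (hrad2_gt0 H1 H2) (hexp_shift td) m0.
have -> : -1 - (hexp H - 2 * t) = 2 * (H + t) by rewrite /hexp; ring.
move=> <-; apply: eq_integral => x /set_mem /=; rewrite in_itv/= => /andP[x0 _].
by rewrite /wave /S /sing_sum gtr0_norm.
Qed.

Let shape_wave x : E x -> fgn_spec_shape (H + t) x = wave 1 x.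
Proof. by move=> Ex; rewrite fgn_spec_shapeE// ?mul1r//; [rewrite /wave mul1r|exact: Eabs]. Qed.

(** The case m = 1 identifies W with the integral of the shape over [0, pi]. Its value is never
    computed: it cancels against the normalizing constant. *)
Let W_fin : W \is a fin_num /\ fine W = Ipi (fgn_spec_shape (H + t)).
Proof.
have L1 := Ltwo_one (Ltwo_shape td).
have eW : (\int[mu]_(x in E) (fgn_spec_shape (H + t) x)%:E = W)%E.
  transitivity (\int[mu]_(x in E) (wave 1 x)%:E)%E.
    by apply: eq_integral => x /set_mem Ex; rewrite shape_wave.
  by rewrite waveE// powR1 mul1e.
split; last by rewrite -eW.
by rewrite -eW; exact: integrable_fin_num.
Qed.

Let Lone_wave m : Lone (wave m).
Proof.
have [Wf _] := W_fin.
apply/integrableP; split; first by apply/measurable_EFinP; exact: mwave.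
have -> : (\int[mu]_(x in E) `|(EFin \o wave m) x| = \int[mu]_(x in E) (wave m x)%:E)%E.
  by apply: eq_integral => x /set_mem Ex; rewrite gee0_abs// lee_fin wave_ge0.
case: m => [|m]; last first.
  by rewrite waveE// ltey_eq fin_numM.
have -> : (\int[mu]_(x in E) (wave 0 x)%:E = \int[mu]_(x in E) 0)%E.
  by apply: eq_integral => x _; rewrite /wave mul0r cos0 subrr mul0r.
by rewrite integral0 ltry.
Qed.

Let wave_Ipi m : Ipi (wave m) = m%:R `^ (2 * (H + t)) * Ipi (fgn_spec_shape (H + t)).
Proof.
have [Wf <-] := W_fin.
have h0 : 2 * (H + t) != 0.
  rewrite gt_eqF//; have := td; have := H1; rewrite ler_norml => h /andP[ht _].
  have := hexp_hrad H; have := r0; rewrite /hexp => ? ?; lra.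
case: m => [|m]; last by rewrite /Ipi /Rintegral waveE// fineM.
rewrite powR0// mul0r -[RHS](mul0r pi) -Ipi_cst; apply: eq_Ipi => x _.
by rewrite /wave mul0r cos0 subrr mul0r.
Qed.

Lemma shape_coefE k : shape_coef (H + t) k = Ipi (fgn_spec_shape (H + t)) * fgn_acov (H + t) k%:Z.
Proof.
have abs_nat (n : nat) : `|n%:R : R| = n%:R by rewrite ger0_norm.
case: k => [|k].
  rewrite /shape_coef /fgn_acov; under [X in Ipi X]eq_fun do rewrite mul0r cos0 mulr1.
  rewrite -[LHS]mulr1; congr (_ * _); rewrite [(0%:Z)%:~R]/(0 : R) add0r sub0r normrN normr1 normr0 powR1.
  have h0 : 2 * (H + t) != 0.
    rewrite gt_eqF//; have := td; have := H1; rewrite ler_norml => h /andP[ht _].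
    have := hexp_hrad H; have := r0; rewrite /hexp => ? ?; lra.
  by rewrite powR0// mulr0 subr0; field.
have -> : shape_coef (H + t) k.+1 = Ipi (fun x => 2^-1 * (wave k.+2 x + wave k x - 2 * wave k.+1 x)).
  apply: eq_Ipi => x Ex; rewrite shape_wave// /wave mul1r.
  have e1 : k.+2%:R * x = k.+1%:R * x + x by rewrite -(natr1 k.+1); ring.
  have e2 : k%:R * x = k.+1%:R * x - x by rewrite -(natr1 k); ring.
  by rewrite e1 e2 cosD cosB; field.
have L1 := LoneD (Lone_wave k.+2) (Lone_wave k); have L2 := LoneZ 2 (Lone_wave k.+1).
rewrite (IpiZ _ (LoneB L1 L2)) (IpiB L1 L2).
rewrite IpiD// IpiZ// !wave_Ipi /fgn_acov.
have -> : (k.+1%:Z)%:~R = k.+1%:R :> R by [].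
rewrite natr1 -(natr1 k) addrK !natr1 !abs_nat.
by ring.
Qed.

Lemma shape_coef0_gt0 : 0 < Ipi (fgn_spec_shape (H + t)).
Proof.
have L1 := Ltwo_one (Ltwo_shape td).
(* On [1, 2] the factor 1 - cos x is at least 1 / 3 by the quartic Taylor bound, and x^e is at least
   2^e because e <= 0. *)
pose e := hexp H - 2 * t; pose c : R := 2 `^ e / 3.
have c0 : 0 < c by rewrite divr_gt0// powR_gt0.
have e0 : e <= 0 by have := hexp_shift td; have := hrad2_gt0 H1 H2; rewrite /e => ? ?; lra.
have sub : (`[1%R, 2%R]%classic : set R) `<=` E.
  move=> x /=; rewrite !in_itv/= => /andP[x1 x2]; rewrite (le_trans ler01)//=.
  exact: le_trans x2 (pi_ge2 R).
have cb x : 1 <= x -> x <= 2 -> c <= fgn_spec_shape (H + t) x.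
  move=> x1 x2; have x0 : 0 < x by lra.
  have xp : `|x| <= pi by rewrite gtr0_norm// (le_trans x2)// pi_ge2.
  rewrite fgn_spec_shapeE// /sing_sum -/e gtr0_norm// /c mulrC; apply: ler_pM => //.
  - have := cos_le_taylor x; have x2' : x ^+ 2 <= 4 by nra.
    have x2'' : 1 <= x ^+ 2 by nra.
    have -> : x ^+ 4 = x ^+ 2 * x ^+ 2 by ring.
    by move: (x ^+ 2) x2' x2'' => y *; nra.
  - apply: ler_wpDr; first exact: (pole_sum_ge0 (hrad2_gt0 H1 H2) (hexp_shift td)).
    rewrite !powR_expR// ler_expR; have : ln x <= ln 2 by rewrite ler_ln ?posrE.
    by move=> h; rewrite -subr_ge0 -mulrBr mulr_le0// subr_le0.
have sge x : E x -> 0 <= fgn_spec_shape (H + t) x by move=> Ex; exact: shape_ge0 (Eabs Ex).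
suff : c <= Ipi (fgn_spec_shape (H + t)) by exact: lt_le_trans.
rewrite -lee_fin /Ipi /Rintegral fineK; last exact: integrable_fin_num.
apply: (@le_trans _ _ (\int[mu]_(x in `[1%R, 2%R]) (fgn_spec_shape (H + t) x)%:E)%E); last first.
  have mf : measurable_fun E (fun x => (fgn_spec_shape (H + t) x)%:E).
    by apply/measurable_EFinP; exact: Lone_meas.
  by apply: ge0_subset_integral => // x Ex; rewrite lee_fin sge.
have -> : c%:E = (\int[mu]_(x in `[1%R, 2%R]) c%:E)%E.
  rewrite integral_cst//= lebesgue_measure_itv/= lte_fin ltr1n -EFinB -EFinM; congr EFin; ring.
apply: ge0_le_integral => //.
- by move=> x _; rewrite lee_fin ltW.
- apply/measurable_EFinP; apply: measurable_funS (Lone_meas L1) => //.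
- by move=> x; rewrite /= in_itv/= => /andP[x1 x2]; rewrite lee_fin cb.
Qed.

Lemma fgn_spec_constE : fgn_spec_const (H + t) = pi / Ipi (fgn_spec_shape (H + t)).
Proof.
have L1 := Ltwo_one (Ltwo_shape td).
have J0 := shape_coef0_gt0.
rewrite /fgn_spec_const.
suff -> : \int[mu]_(x in `[- pi, pi]) fgn_spec_shape (H + t) x = 2 * Ipi (fgn_spec_shape (H + t)).
  by rewrite invfM mulrACA divff// mul1r.
have ms := measurable_shape H1 H2 td.
have sge x : `|x| <= pi -> (0 <= (fgn_spec_shape (H + t) x)%:E)%E by move=> xp; rewrite lee_fin; exact: shape_ge0.
pose f x := (fgn_spec_shape (H + t) x)%:E.
have e1 : (\int[mu]_(x in `[(- pi)%R, pi]) f x = \int[mu]_(x in `[(- pi)%R, 0%R[) f x + \int[mu]_(x in `[0%R, pi]) f x)%E.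
  rewrite -integral_setU//.
  - congr (integral _ _ _); apply/seteqP; split => x /=; rewrite !in_itv/=.
      by move=> /andP[h1 h2]; case: (ltP x 0) => h; [left; rewrite h1|right; rewrite h2].
    have p0 := pi_ge0 R.
    by case=> /andP[h1 h2]; apply/andP; split; lra.
  - apply/measurable_EFinP; apply: measurable_funS ms => // x /=; rewrite !in_itv/=; have p0 := pi_ge0 R.
    by case=> /andP[h1 h2]; apply/andP; split; lra.
  - rewrite disj_set2E; apply/eqP/seteqP; split => // x [] /=; rewrite !in_itv/= => /andP[_ h] /andP[h' _].
    by move: h; rewrite ltNge h'.
have n1 : -1 != 0 :> R by rewrite oppr_eq0 oner_neq0.
have e2 : (\int[mu]_(x in `[(- pi)%R, 0%R[) f x = \int[mu]_(x in `[0%R, pi]) f x)%E.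
  rewrite (ge0_integral_affine 0 n1)//; last 2 first.
  - apply/measurable_EFinP; apply: measurable_funS ms => // x /=; rewrite !in_itv/=; have p0 := pi_ge0 R.
    by move=> /andP[h1 h2]; apply/andP; split; lra.
  - move=> x /=; rewrite in_itv/= => /andP[h1 h2]; apply: sge; rewrite ler_norml h1/=.
    by rewrite (le_trans (ltW h2))// pi_ge0.
  rewrite normrN normr1 mul1e.
  have -> : [set x : R | `[- pi, 0%R[%classic (-1 * x + 0)] = `]0%R, pi]%classic :> set R.
    by apply/seteqP; split => x /=; rewrite !in_itv/= addr0 mulN1r => /andP[? ?]; apply/andP; split; lra.
  rewrite -[RHS]integral_itv_obnd_cbnd; last first.
    apply/measurable_EFinP; apply: measurable_funS (Lone_meas L1) => //.
    by apply: subset_itvr; rewrite bnd_simp.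
  by apply: eq_integral => x _; rewrite /f addr0 mulN1r fgn_spec_shapeN.
rewrite /Rintegral e1 e2 fineD; [|exact: integrable_fin_num|exact: integrable_fin_num].
by rewrite -mulr2n mulr_natl.
Qed.

Lemma fgn_acovE k : fgn_acov (H + t) k%:Z = shape_coef (H + t) k / shape_coef (H + t) 0.
Proof.
have J0 := shape_coef0_gt0.
have -> : shape_coef (H + t) 0 = Ipi (fgn_spec_shape (H + t)).
  by apply: eq_Ipi => x _; rewrite mul0r cos0 mulr1.
by rewrite shape_coefE mulrAC divff ?mul1r// gt_eqF.
Qed.

End Wave.

Lemma is_derive_near (f g : R -> R) (a D : R) (d : R) : 0 < d ->
  (forall s : R, `|s| <= d -> f (a + s) = g (a + s)) -> is_derive a 1 g D -> is_derive a 1 f D.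
Proof.
move=> d0 fg gD; apply: near_eq_is_derive gD; apply/nbhs_ballP; exists d => //= x xd.
have -> : x = a + (x - a) by ring.
by apply/esym/fg; rewrite distrC ltW.
Qed.

Let J0 : R := shape_coef H 0.
Let K : R := - pi * dshape_coef 0 / J0 ^+ 2.

Let shape_coef0E h : shape_coef h 0 = Ipi (fgn_spec_shape h).
Proof. by apply: eq_Ipi => x _; rewrite mul0r cos0 mulr1. Qed.

Let J0_gt0 : 0 < J0.
Proof. by have := shape_coef0_gt0 t0; rewrite addr0 -shape_coef0E. Qed.

Let dconst : is_derive H 1 (fun h => fgn_spec_const h) K.
Proof.
have dJ := is_derive_shape_coef 0.
have nz : shape_coef H 0 != 0 by rewrite gt_eqF.
have dV := @is_deriveV R (fun h => shape_coef h 0) H _ 1 nz dJ.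
have dZ := is_deriveZ pi dV.
have KE : pi *: (- shape_coef H 0 ^- 2 *: dshape_coef 0) = K.
  by rewrite /K /J0 /GRing.scale/=; ring.
rewrite -KE; refine (is_derive_near r0 _ dZ).
by move=> s sd; rewrite fgn_spec_constE// -[RHS]/(pi * (shape_coef (H + s) 0)^-1) shape_coef0E.
Qed.

Lemma fgn_dspecE x : E x -> fgn_dspec H x = K * fgn_spec_shape H x + fgn_spec_const H * dshape H x.
Proof.
move=> Ex; have ds := is_derive_shape H1 H2 (Eabs Ex).
have := is_deriveM dconst ds => -[_ e]; rewrite /fgn_dspec derive1E.
have -> : (fun h => fgn_spec h x) = (fun h => fgn_spec_const h) * (fun h => fgn_spec_shape h x) by [].
by rewrite e /GRing.scale/=; ring.
Qed.

Let Lshape : Ltwo (fgn_spec_shape H). Proof. by have := Ltwo_shape t0; rewrite addr0. Qed.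

Lemma Ltwo_fgn_spec : Ltwo (fgn_spec H).
Proof. exact: LtwoZ. Qed.

Lemma Ltwo_fgn_dspec : Ltwo (fgn_dspec H).
Proof.
have [m1 i1] := LtwoD (LtwoZ K Lshape) (LtwoZ (fgn_spec_const H) Ltwo_dshape).
split.
  by apply: eq_measurable_fun m1 => x /set_mem Ex; rewrite fgn_dspecE.
by apply: eq_integrable i1 => // x /set_mem Ex; rewrite /= fgn_dspecE.
Qed.

Let constE : fgn_spec_const H = pi / J0.
Proof. by have := fgn_spec_constE t0; rewrite addr0 -shape_coef0E. Qed.

Lemma fcoef_fgn_spec k : fcoef (fgn_spec H) k = fgn_acov H k%:Z.
Proof.
have p0 : pi != 0 :> R by rewrite gt_eqF// pi_gt0.
have := fgn_acovE t0 k; rewrite addr0 => ->; rewrite /fcoef.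
have -> : Ipi (fun x => fgn_spec H x * cos (k%:R * x)) = fgn_spec_const H * shape_coef H k.
  rewrite -IpiZ; last exact: (Ltwo_mul Lshape (Ltwo_cos _)).
  by apply: eq_Ipi => x _; rewrite /fgn_spec mulrA.
have eqn (p j a : R) : p != 0 -> j != 0 -> p / j * a / p = a / j by move=> p1 j1; field; rewrite p1 j1.
by rewrite constE eqn// gt_eqF.
Qed.

(** Near H the autocovariance is a quotient of two shape coefficients. Differentiating this
    quotient, instead of the explicit powers, identifies the derivative as a Fourier coefficient of
    the derivative of the density. *)
Lemma is_derive_fgn_acov k : is_derive H 1 (fun h => fgn_acov h k%:Z) (fcoef (fgn_dspec H) k).
Proof.
have p0 : pi != 0 :> R by rewrite gt_eqF// pi_gt0.
have nz : shape_coef H 0 != 0 by rewrite gt_eqF.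
have dV := @is_deriveV R (fun h => shape_coef h 0) H _ 1 nz (is_derive_shape_coef 0).
have dM := is_deriveM (is_derive_shape_coef k) dV.
have cE : fcoef (fgn_dspec H) k = (K * shape_coef H k + fgn_spec_const H * dshape_coef k) / pi.
  have Lc := Ltwo_cos (k%:R : R).
  have l1 := Ltwo_mul Lshape Lc; have l2 := Ltwo_mul Ltwo_dshape Lc.
  rewrite /fcoef -(IpiZ K l1) -(IpiZ _ l2) -(IpiD (LoneZ _ l1) (LoneZ _ l2)); congr (_ / _).
  by apply: eq_Ipi => x Ex; rewrite fgn_dspecE//; ring.
have eqn (p j a b c : R) : p != 0 -> j != 0 ->
    (- p * c / j ^+ 2 * a + p / j * b) / p = a * (- j ^- 2 * c) + j^-1 * b.
  by move=> p1 j1; field; rewrite p1 j1.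
have j0 : J0 != 0 by exact: nz.
rewrite cE constE /K (eqn _ _ _ _ _ p0 j0); refine (is_derive_near r0 _ dM).
by move=> s sd; exact: fgn_acovE.
Qed.

Lemma fgn_spec_ge0 x : E x -> 0 <= fgn_spec H x.
Proof.
move=> Ex; rewrite /fgn_spec constE mulr_ge0 ?divr_ge0 ?pi_ge0 ?(ltW J0_gt0)//.
by have := shape_ge0 H1 H2 t0 (Eabs Ex); rewrite addr0.
Qed.

Lemma fgn_acov0 : fgn_acov H 0 = 1.
Proof. by have := fgn_acovE t0 0; rewrite addr0 divff// gt_eqF. Qed.

Lemma fcoef_fgn_dspec0 : fcoef (fgn_dspec H) 0 = 0.
Proof.
have h1 := is_derive_fgn_acov 0.
have h2 : is_derive H 1 (fun h : R => fgn_acov h 0) 0.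
  have g1 : is_derive H 1 (fun=> 1 : R) (0 : R) by exact: is_derive_cst.
  refine (is_derive_near r0 _ g1).
  by move=> s sd; rewrite (fgn_acovE sd 0) divff// shape_coef0E gt_eqF// shape_coef0_gt0.
by have [_ <-] := h1; have [_ ->] := h2.
Qed.

(** The autocovariance at lag 1 is 2^(2h - 1) - 1, which is strictly increasing in h. *)
Lemma fcoef_fgn_dspec1 : fcoef (fgn_dspec H) 1 != 0.
Proof.
have h1 := is_derive_fgn_acov 1.
have h2 : is_derive H 1 (fun h : R => fgn_acov h 1) (ln 2 * 2 `^ (2 * H)).
  have dE : is_derive H 1 (fun h : R => 2^-1 * expR (2 * h * ln 2) - 1) (ln 2 * 2 `^ (2 * H)).
    apply: is_derive_eq; rewrite /GRing.scale/= /powR gt_eqF//.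
    by field.
  refine (is_derive_near r0 _ dE).
  move=> s sd; rewrite /fgn_acov [(1%:Z)%:~R]/(1 : R) subrr normr1 normr0 powR1.
  have h0 : 2 * (H + s) != 0.
    rewrite gt_eqF//; have := sd; have := H1; rewrite ler_norml => h /andP[ht _].
    have := hexp_hrad H; have := r0; rewrite /hexp => ? ?; lra.
  have -> : `|1 + 1| = 2 :> R by rewrite ger0_norm.
  by rewrite powR0// /powR gt_eqF//; field.
have [_ <-] := h1; have [_ ->] := h2.
by rewrite mulf_neq0// gt_eqF ?powR_gt0// ln_gt0// ltr1n.
Qed.

Lemma fgn_acov_abs (h : R) (k : int) : fgn_acov h k = fgn_acov h (`|k|%N)%:Z.
Proof.
case: (intP k) => // n; rewrite abszN /fgn_acov mulrNz normrN.
rewrite -(normrN (- _ + 1)) opprD opprK -(normrN (- _ - 1)) opprB opprK absz_nat.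
by congr (_ * _); rewrite (addrC 1); ring.
Qed.

Lemma fgn_mxE n (h : R) : fgn_mx n h = toeplitz n (fun k => fgn_acov h k%:Z).
Proof. by apply/matrixP => i j; rewrite !mxE fgn_acov_abs. Qed.

(** The quadratic form is the integral of the nonnegative spectral density against the squared
    modulus of \sum_j u_j e^(ijx), divided by pi. *)
Lemma fgn_mx_psd n (u : 'rV[R]_n) : 0 <= (u *m fgn_mx n H *m u^T) ord0 ord0.
Proof.
rewrite mulmx_trE.
under eq_bigr do rewrite mxE mulr_suml.
have -> : \sum_i \sum_j u ord0 j * fgn_mx n H j i * u ord0 i =
   (Ipi (fun x => \sum_(i < n) \sum_(j < n) (u ord0 j * u ord0 i) * (fgn_spec H x * cos ((j%:Z - i%:Z)%:~R * x)))) / pi.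
  have Lk (i j : 'I_n) : Lone (fun x => fgn_spec H x * cos ((j%:Z - i%:Z)%:~R * x)).
    exact: (Ltwo_mul Ltwo_fgn_spec (Ltwo_cos _)).
  rewrite Ipi_sum; last by move=> i; apply: Lone_sum => j; apply: LoneZ.
  rewrite mulr_suml; apply: eq_bigr => i _.
  rewrite Ipi_sum; last by move=> j; apply: LoneZ.
  rewrite mulr_suml; apply: eq_bigr => j _; rewrite IpiZ// [fgn_mx _ _ _ _]mxE fgn_acov_abs -fcoef_fgn_spec /fcoef.
  have -> : Ipi (fun x => fgn_spec H x * cos (`|j%:Z - i%:Z|%N%:R * x)) =
            Ipi (fun x => fgn_spec H x * cos ((j%:Z - i%:Z)%:~R * x)).
    by apply: eq_Ipi => x _; rewrite cos_absz.
  by ring.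
rewrite divr_ge0 ?pi_ge0//; apply: Ipi_ge0 => x Ex.
have -> : \sum_(i < n) \sum_(j < n) (u ord0 j * u ord0 i) * (fgn_spec H x * cos ((j%:Z - i%:Z)%:~R * x)) =
  fgn_spec H x * \sum_(j < n) \sum_(i < n) u ord0 j * u ord0 i * cos ((j%:Z - i%:Z)%:~R * x).
  rewrite mulr_sumr exchange_big; apply: eq_bigr => i _; rewrite mulr_sumr; apply: eq_bigr => j _.
  by rewrite mulrCA.
by rewrite mulr_ge0 ?fgn_spec_ge0// (sum_cos_diff (fun i => u ord0 i)) addr_ge0 ?sqr_ge0.
Qed.

Lemma tr_fgn_mx n : \tr (fgn_mx n H) = n%:R.
Proof.
rewrite /mxtrace; under eq_bigr do rewrite mxE subrr fgn_acov0.
by rewrite sumr_const card_ord.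
Qed.

End SpectralDensity.

(** * The central limit theorem for the score *)

Section QuadraticForms.
Context {R : realType}.

Lemma cdot_delta k (i : 'I_k) (y : 'cV[R]_k) : cdot (delta_mx i ord0) y = y i ord0.
Proof.
rewrite cdotE (bigD1 i)//= !mxE !eqxx mul1r big1 ?addr0// => j ji.
by rewrite mxE (negbTE ji) mul0r.
Qed.

(** For t <= 1 the cubic error is also of order t^2, so the approximation of the characteristic
    function itself supplies the quadratic bound at 0 behind tightness. *)
Lemma gaussian_chisq_tail d (T : measurableType d) (P : probability T R) n (X : T -> 'cV[R]_n)
    (V C : 'M[R]_n) (s : 'I_n -> R) (t : R) :
  gaussian_vector P X V -> C *m V *m C^T = 1%:M -> 0 < t -> t <= 1 ->
  1 - Ex P (fun x => cos (t * \sum_i s i * ((C *m X x) i ord0 ^+ 2 - 1)))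
    <= (\sum_i s i ^+ 2 + 6 * chi3 * \sum_i `|s i| ^+ 3) * t ^+ 2.
Proof.
move=> gX CV t0 t1.
have := gaussian_chisq (fun i => t * s i) 0 gX CV.
rewrite cos0 mulr1.
have -> : (fun x => cos (\sum_i t * s i * ((C *m X x) i ord0 ^+ 2 - 1) + 0)) =
  (fun x => cos (t * \sum_i s i * ((C *m X x) i ord0 ^+ 2 - 1))).
  by apply/funext => x; rewrite addr0 mulr_sumr; congr cos; apply: eq_bigr => i _; rewrite mulrA.
move: (Ex _ _) => E.
have -> : \sum_i (t * s i) ^+ 2 = t ^+ 2 * \sum_i s i ^+ 2.
  by rewrite mulr_sumr; apply: eq_bigr => i _; rewrite exprMn.
have -> : \sum_i `|t * s i| ^+ 3 = t ^+ 3 * \sum_i `|s i| ^+ 3.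
  by rewrite mulr_sumr; apply: eq_bigr => i _; rewrite normrM (gtr0_norm t0) exprMn.
move: (\sum_i s i ^+ 2) => a.
have : 0 <= \sum_i `|s i| ^+ 3 by apply: sumr_ge0 => i _; exact: exprn_ge0.
move: (\sum_i _) => b b0.
have h := expR_ge1Dx (- (t ^+ 2 * a)).
have c0 : 0 <= chi3 * b by rewrite mulr_ge0// (le_trans ler01)// chi3_ge1.
have h2 : t ^+ 3 * (chi3 * b) <= t ^+ 2 * (chi3 * b).
  by rewrite ler_wpM2r// exprS ler_piMl// sqr_ge0.
rewrite ler_norml => /andP[h3 _].
have e1 : 6 * chi3 * (t ^+ 3 * b) = 6 * (t ^+ 3 * (chi3 * b)) by ring.
have e2 : (a + 6 * chi3 * b) * t ^+ 2 = t ^+ 2 * a + 6 * (t ^+ 2 * (chi3 * b)) by ring.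
move: h3; rewrite e1 e2; lra.
Qed.

(** The limit of the squared weights is half the quadratic form because Z^2 - 1 has variance 2. The
    matrix C may depend on the direction u, since only one direction at a time is tested. *)
Lemma chisq_clt k (d : nat -> measure_display) (T : forall n, measurableType (d n))
    (P : forall n, probability (T n) R) (X : forall n, T n -> 'cV[R]_n) (V : forall n, 'M[R]_n)
    (Y : forall n, T n -> 'cV[R]_k) (Gam : 'M[R]_k)
    (d' : measure_display) (T' : measurableType d') (Q : probability T' R) (G : T' -> 'cV[R]_k) :
  (forall n, gaussian_vector (P n) (X n) (V n)) ->
  gaussian_vector Q G Gam ->
  (forall u : 'cV[R]_k, exists (C : forall n, 'M[R]_n) (s : forall n, 'I_n -> R),
     [/\ forall n, C n *m V n *m (C n)^T = 1%:M,
         forall n w, cdot u (Y n w) = \sum_i s n i * ((C n *m X n w) i ord0 ^+ 2 - 1),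
         \sum_i s n i ^+ 2 @[n --> \oo] --> (u^T *m Gam *m u) ord0 ord0 / 2 &
         \sum_i `|s n i| ^+ 3 @[n --> \oo] --> (0 : R)]) ->
  cvg_in_distribution P Y Q G.
Proof.
move=> gX gG hu.
(* Tightness of each coordinate: in the direction of a basis vector the sums of squares and of cubes
   converge, hence are bounded, which gives one constant for all n. *)
have bnd (i : 'I_k) : exists c : R, 0 <= c /\
    (forall n (t : R), 0 < t -> t <= 1 -> 1 - Ex (P n) (fun w => cos (t * Y n w i ord0)) <= c * t ^+ 2) /\
    (forall (t : R), 0 < t -> t <= 1 -> 1 - Ex Q (fun w => cos (t * G w i ord0)) <= c * t ^+ 2).
  pose e : 'cV[R]_k := delta_mx i ord0.
  have [C [s [CV YE c2 c3]]] := hu (e).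
  have cS : \sum_i s n i ^+ 2 + 6 * chi3 * \sum_i `|s n i| ^+ 3 @[n --> \oo] -->
      ((e)^T *m Gam *m e) ord0 ord0 / 2 + 6 * chi3 * 0.
    by apply: cvgD c2 _; apply: cvgM c3; exact: cvg_cst.
  have [M [_ MP]] : bounded_fun (fun n => \sum_i s n i ^+ 2 + 6 * chi3 * \sum_i `|s n i| ^+ 3).
    by apply: cvg_seq_bounded; apply/cvg_ex; eexists; exact: cS.
  pose M1 := `|M| + 1.
  have MM n : \sum_i s n i ^+ 2 + 6 * chi3 * \sum_i `|s n i| ^+ 3 <= M1.
    apply: le_trans (ler_norm _) _; apply: (MP M1) => //.
    by rewrite /M1 (le_lt_trans (ler_norm _))// ltrDl.
  pose g := ((e)^T *m Gam *m e) ord0 ord0.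
  have g0 : 0 <= g by case: gG => _ + _ _; apply.
  exists (M1 + g); split; first by rewrite addr_ge0// /M1 addr_ge0.
  split=> [n t t0 t1|t t0 t1].
    under [X in Ex _ X]eq_fun do rewrite -cdot_delta -/e YE.
    apply: le_trans (gaussian_chisq_tail _ (gX n) (CV n) t0 t1) _.
    by rewrite ler_wpM2r ?sqr_ge0// (le_trans (MM n))// lerDl.
  apply: (@le_trans _ _ (g * t ^+ 2)); last first.
    by rewrite ler_wpM2r ?sqr_ge0// lerDr /M1 addr_ge0.
  apply: charfun_tail => //.
  have := gaussian_vector_charfun (t *: e) 0 gG.
  rewrite cos0 mul1r.
  have -> : (fun x => cos (cdot (t *: e) (G x) + 0)) = (fun w => cos (t * G w i ord0)).
    apply/funext => w; rewrite addr0; congr cos.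
    by rewrite /cdot linearZ/= -scalemxAl mxE -/(cdot _ _) cdot_delta.
  move=> ->; congr (expR (- (_ / 2))).
  have -> : (t *: e)^T = t *: e^T by rewrite linearZ.
  rewrite -!scalemxAl -scalemxAr [in LHS]mxE [in LHS]mxE -/g; ring.
have /choice[M MP] := bnd.
have M0 i : 0 <= M i by have [] := MP i.
have Mle (i : 'I_k) : M i <= \sum_j M j.
  by rewrite (bigD1 i)//= lerDl sumr_ge0.
apply: (@levy R k d T P Y d' T' Q G (\sum_i M i)).
- move=> n i.
  have [C [s [_ YE _ _]]] := hu (delta_mx i ord0).
  under eq_fun do rewrite -cdot_delta YE.
  apply: measurable_sum => j; apply: measurable_funM => //.
  apply: measurable_funB => //; apply: measurable_funX.
  have [_ _ mX _] := gX n.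
  under eq_fun do rewrite mxE.
  by apply: measurable_sum => l; apply: measurable_funM.
- by case: gG.
- move=> u c.
  have [C [s [CV YE c2 c3]]] := hu u.
  rewrite (gaussian_vector_charfun u c gG).
  under eq_fun do under eq_fun do rewrite YE.
  have c4 : expR (- \sum_i s n i ^+ 2) * cos c @[n --> \oo] -->
      cos c * expR (- ((u^T *m Gam *m u) ord0 ord0 / 2)).
    rewrite mulrC; apply: cvgM; last exact: cvg_cst.
    apply: (@cvg_comp _ _ _ (fun n => - \sum_i s n i ^+ 2) expR _ _ _ _ (@continuous_expR R _)).
    exact: cvgN c2.
  have c5 : 6 * chi3 * \sum_i `|s n i| ^+ 3 @[n --> \oo] --> (0 : R).
    have : 6 * chi3 * \sum_i `|s n i| ^+ 3 @[n --> \oo] --> 6 * chi3 * (0 : R).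
      by apply: cvgM c3; exact: cvg_cst.
    by rewrite mulr0.
  apply/cvgrPdist_le => e e0.
  have e20 : 0 < e / 2 by rewrite divr_gt0.
  near=> n.
  have h1 := gaussian_chisq (s n) c (gX n) (CV n).
  have h2 : 6 * chi3 * \sum_i `|s n i| ^+ 3 <= e / 2.
    have : `|0 - 6 * chi3 * \sum_i `|s n i| ^+ 3| <= e / 2.
      by near: n; move/cvgrPdist_le : c5; apply.
    by rewrite sub0r normrN; apply: le_trans; exact: ler_norm.
  have h3 : `|cos c * expR (- ((u^T *m Gam *m u) ord0 ord0 / 2)) - expR (- \sum_i s n i ^+ 2) * cos c| <= e / 2.
    by near: n; move/cvgrPdist_le : c4; apply.
  move: h1 h2 h3; rewrite !ler_norml.
  move: (Ex _ _) (6 * _ * _) (cos c * _) (_ * cos c) => x1 x2 x3 x4 /andP[? ?] ? /andP[? ?].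
  by apply/andP; split; lra.
- move=> n i t t0 t1; have [_ [+ _]] := MP i => /(_ n t t0 t1) /le_trans; apply.
  by rewrite ler_wpM2r ?sqr_ge0.
- move=> i t t0 t1; have [_ [_ +]] := MP i => /(_ t t0 t1) /le_trans; apply.
  by rewrite ler_wpM2r ?sqr_ge0.
Unshelve. all: end_near. Qed.

End QuadraticForms.

Section Score.
Context {R : realType}.

Lemma det_pd_gt0 n (A : 'M[R]_n) : A^T = A ->
  (forall u : 'rV[R]_n, u != 0 -> 0 < (u *m A *m u^T) ord0 ord0) -> 0 < \det A.
Proof.
move=> sA pA; have [C [l [CA _]]] := sim_diag sA sA pA.
have := congr1 (@determinant _ _) CA; rewrite !det_mulmx det_tr det1 => h.
have c2 : 0 <= \det C ^+ 2 by exact: sqr_ge0.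
have e : \det C ^+ 2 * \det A = 1 by rewrite -h; ring.
by rewrite ltNge; apply/negP => A0; have := mulr_ge0_le0 c2 A0; rewrite e ler10.
Qed.

Lemma row_form_gt0 n (u : 'rV[R]_n) : u != 0 -> 0 < (u *m u^T) ord0 ord0.
Proof.
move=> u0; rewrite -sqr_rowE lt_neqAle sumr_ge0 ?andbT; last by move=> i _; exact: sqr_ge0.
rewrite eq_sym; apply: contraNneq u0 => /eqP; rewrite psumr_eq0; last by move=> i _; exact: sqr_ge0.
move=> /allP h; apply/eqP/rowP => i; rewrite mxE.
by have := h i (mem_index_enum i); rewrite /= sqrf_eq0 => /eqP.
Qed.

(* With [C V C^T = 1] one has [V^-1 = C^T C], and [C x] is a standard normal vector when
   [x] has law [N(0, V)]. *)
Lemma chisq_form n (V W C : 'M[R]_n) (l : 'rV[R]_n) (x : 'cV[R]_n) :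
  C *m V *m C^T = 1%:M -> C *m W *m C^T = diag_mx l ->
  (x^T *m (invmx V *m W *m invmx V) *m x) ord0 ord0 - \tr (invmx V *m W) =
  \sum_i l ord0 i * ((C *m x) i ord0 ^+ 2 - 1).
Proof.
move=> CV CW.
have e1 : V *m C^T *m C = 1%:M by apply: mulmx1C; rewrite mulmxA.
have uV : V \in unitmx.
  by have := @mulmx1_unit _ _ V (C^T *m C); rewrite mulmxA => /(_ e1) [].
have VE : invmx V = C^T *m C.
  by rewrite -[LHS]mulmx1 -e1 -(mulmxA V) mulKmx.
have -> : \tr (invmx V *m W) = \sum_i l ord0 i.
  by rewrite VE -mulmxA mxtrace_mulC CW mxtrace_diag.
have -> : x^T *m (invmx V *m W *m invmx V) *m x = (C *m x)^T *m (C *m W *m C^T) *m (C *m x).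
  by rewrite VE trmx_mul !mulmxA.
rewrite CW mxE -sumrB; apply: eq_bigr => i _.
rewrite mul_mx_diag !mxE mulrBr mulr1; congr (_ - _); ring.
Qed.

Variables (n : nat) (delta sigma H : R).
Hypotheses (H1 : 1 / 2 < H) (H2 : H < 3 / 4) (d0 : 0 < delta) (s0 : 0 < sigma).

Let gam := sigma ^+ 2 * delta `^ (2 * H - 1).
Let dfgn := toeplitz n (fcoef (fgn_dspec H)).
Let V := mfbm_cov n delta sigma H.

Lemma tr_fgn : (fgn_mx n H)^T = fgn_mx n H.
Proof. by rewrite fgn_mxE tr_toeplitz. Qed.

Lemma gam_ge0 : 0 <= gam.
Proof. by rewrite mulr_ge0 ?sqr_ge0// powR_ge0. Qed.

Lemma one_plus_fgn_pd (u : 'rV[R]_n) : u != 0 ->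
  0 < (u *m (1%:M + gam *: fgn_mx n H) *m u^T) ord0 ord0.
Proof.
move=> u0; rewrite mulmxDr mulmx1 mulmxDl -scalemxAr -scalemxAl mxE [X in _ + X]mxE.
by rewrite ltr_pwDl ?row_form_gt0// mulr_ge0 ?gam_ge0// (fgn_mx_psd H1 H2).
Qed.

Lemma tr_one_plus_fgn : (1%:M + gam *: fgn_mx n H)^T = 1%:M + gam *: fgn_mx n H.
Proof. by rewrite linearD linearZ/= trmx1 tr_fgn. Qed.

Lemma det_mfbm_cov_gt0 : 0 < \det V.
Proof.
rewrite /V /mfbm_cov detZ mulr_gt0 ?exprn_gt0//.
by apply: det_pd_gt0; [exact: tr_one_plus_fgn|exact: one_plus_fgn_pd].
Qed.

Lemma mx_derive_sigma : mx_derive sigma (fun s => mfbm_cov n delta s H)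
  ((2 / sigma * delta * gam) *: fgn_mx n H).
Proof.
move=> i j.
have -> : (fun s => mfbm_cov n delta s H i j) = (fun s : R => delta * ((1%:M : 'M[R]_n) i j + s ^+ 2 * delta `^ (2 * H - 1) * fgn_mx n H i j)).
  by apply/funext => s; rewrite /mfbm_cov mxE; congr (_ * _); rewrite mxE; congr (_ + _); rewrite mxE.
apply: is_derive_eq; rewrite [in RHS]mxE /gam /GRing.scale/=.
field; by rewrite gt_eqF.
Qed.

(** The exponent of delta depends on H, which produces the term with 2 ln delta. It equals sigma ln
    delta times the matrix of [mx_derive_sigma] and disappears in R_H. *)
Lemma mx_derive_H : mx_derive H (fun h => mfbm_cov n delta sigma h)
  ((delta * gam) *: ((2 * ln delta) *: fgn_mx n H + dfgn)).
Proof.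
move=> i j.
pose k := `|i%:Z - j%:Z|%N.
have -> : (fun h => mfbm_cov n delta sigma h i j) = (fun h : R => delta * ((1%:M : 'M[R]_n) i j + sigma ^+ 2 * (expR ((2 * h - 1) * ln delta) * fgn_acov h k%:Z))).
  apply/funext => s; rewrite /mfbm_cov mxE; congr (_ * _); rewrite mxE; congr (_ + _).
  by rewrite mxE /powR gt_eqF// fgn_mxE [toeplitz _ _ _ _]mxE mulrA.
have := is_derive_fgn_acov H1 H2 k => dk.
apply: is_derive_eq; rewrite [in RHS]mxE [in RHS]mxE [in RHS]mxE fgn_mxE [toeplitz _ _ _ _]mxE.
rewrite [dfgn _ _]mxE /gam /powR gt_eqF// -/k /GRing.scale/=.
ring.
Qed.

Lemma score_combination (a b : R) (C : 'M[R]_n) (l : 'rV[R]_n) (x : 'cV[R]_n) :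
  C *m (1%:M + gam *: fgn_mx n H) *m C^T = 1%:M ->
  C *m toeplitz n (fun k => 2 * a / sigma * fgn_acov H k%:Z + b * fcoef (fgn_dspec H) k) *m C^T = diag_mx l ->
  a * score_sigma delta sigma H x +
    b * (score_H delta sigma H x - sigma * ln delta * score_sigma delta sigma H x) =
  \sum_i gam / 2 * l ord0 i * ((((Num.sqrt delta)^-1 *: C) *m x) i ord0 ^+ 2 - 1).
Proof.
move=> CA CS.
have dV := det_mfbm_cov_gt0.
have e1 : score_sigma delta sigma H x = 2^-1 * ((x^T *m (invmx V *m ((2 / sigma * delta * gam) *: fgn_mx n H) *m invmx V) *m x) ord0 ord0 -
   \tr (invmx V *m ((2 / sigma * delta * gam) *: fgn_mx n H))).
  rewrite /score_sigma derive1E.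
  by have [_ <-] := gaussian_score (- (n%:R / 2) * ln (2 * pi)) x mx_derive_sigma dV.
have e2 : score_H delta sigma H x = 2^-1 * ((x^T *m (invmx V *m ((delta * gam) *: ((2 * ln delta) *: fgn_mx n H + dfgn)) *m invmx V) *m x) ord0 ord0 -
   \tr (invmx V *m ((delta * gam) *: ((2 * ln delta) *: fgn_mx n H + dfgn)))).
  rewrite /score_H derive1E.
  by have [_ <-] := gaussian_score (- (n%:R / 2) * ln (2 * pi)) x mx_derive_H dV.
pose S := toeplitz n (fun k => 2 * a / sigma * fgn_acov H k%:Z + b * fcoef (fgn_dspec H) k).
have SE : S = (2 * a / sigma) *: fgn_mx n H + b *: dfgn.
  by apply/matrixP => i j; rewrite fgn_mxE !mxE.
pose C' := (Num.sqrt delta)^-1 *: C.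
have sq : (Num.sqrt delta)^-1 * (Num.sqrt delta)^-1 = delta^-1 :> R.
  by rewrite -invfM -expr2 sqr_sqrtr// ltW.
have sc (M : 'M[R]_n) : C' *m (delta *: M) *m C'^T = C *m M *m C^T.
  have -> : C'^T = (Num.sqrt delta)^-1 *: C^T by rewrite linearZ.
  rewrite /C' -scalemxAr -!scalemxAl -scalemxAr -scalemxAl !scalerA.
  by rewrite sq mulVf ?scale1r// gt_eqF.
have CV : C' *m V *m C'^T = 1%:M by rewrite sc.
have CW : C' *m (delta *: (gam *: S)) *m C'^T = diag_mx (gam *: l).
  by rewrite sc -scalemxAr -scalemxAl CS linearZ.
have := chisq_form x CV CW.
have -> : \sum_i gam / 2 * l ord0 i * ((C' *m x) i ord0 ^+ 2 - 1) =
   2^-1 * \sum_i (gam *: l) ord0 i * ((C' *m x) i ord0 ^+ 2 - 1).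
  by rewrite mulr_sumr; apply: eq_bigr => i _; rewrite [(gam *: l) _ _]mxE; ring.
move=> <-; rewrite e1 e2 SE.
(* Both scores are values of this linear functional, so the claim, including the cancellation of the
   logarithm, is linear algebra in q of the covariance matrix and q of its derivative. *)
pose q (M : 'M[R]_n) := (x^T *m (invmx V *m M *m invmx V) *m x) ord0 ord0 - \tr (invmx V *m M).
have qD M N : q (M + N) = q M + q N.
  by rewrite /q !(mulmxDr, mulmxDl) mxtraceD [X in X - _ = _]mxE; ring.
have qZ (c : R) M : q (c *: M) = c * q M.
  do 4 rewrite /q -?scalemxAr -?scalemxAl; rewrite mxtraceZ [X in X - _ = _]mxE; ring.
rewrite -!/(q _) !(qZ, qD).
field; by rewrite gt_eqF.
Qed.

End Score.

Section FisherInformation.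
Context {R : realType}.

Lemma cdot_col2 (u : 'cV[R]_2) (x y : R) : cdot u (col2 x y) = u 0 ord0 * x + u 1 ord0 * y.
Proof. by rewrite cdotE big_ord_recl big_ord1 !mxE/=; congr (_ + u _ _ * _); apply/val_inj. Qed.

Lemma mx2_form (a b c d : R) (u : 'cV[R]_2) :
  (u^T *m mx2 a b c d *m u) ord0 ord0 =
  a * u 0 ord0 ^+ 2 + (b + c) * (u 0 ord0 * u 1 ord0) + d * u 1 ord0 ^+ 2.
Proof.
have e1 : lift ord0 ord0 = 1 :> 'I_2 by apply/val_inj.
rewrite mxE big_ord_recl big_ord1 !mxE !big_ord_recl !big_ord0 !mxE/= !e1/=.
by ring.
Qed.

Lemma powR_natN_cvg0 (c : R) : 0 < c -> n%:R `^ (- c) @[n --> \oo] --> (0 : R).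
Proof.
move=> c0; apply/cvgrPdist_le => e e0.
near=> n; rewrite sub0r normrN ger0_norm ?powR_ge0//.
have n0 : 0 < n%:R :> R by rewrite ltr0n; near: n; exact: nbhs_infty_gt.
have h : e `^ (- c^-1) <= n%:R by near: n; exact: nbhs_infty_ger.
rewrite powRN -[e]invrK lef_pV2 ?posrE ?invr_gt0// ?powR_gt0//.
have -> : e^-1 = (e `^ (- c^-1)) `^ c by rewrite -powRrM mulNr mulVf ?gt_eqF// powR_inv1// ltW.
by rewrite ge0_ler_powR ?nnegrE ?powR_ge0// ltW.
Unshelve. all: end_near. Qed.

Variables (sigma H : R).
Hypotheses (H1 : 1 / 2 < H) (H2 : H < 3 / 4) (s0 : 0 < sigma).

Let mix (u : 'cV[R]_2) (x : R) : R := 2 * u 0 ord0 / sigma * fgn_spec H x + u 1 ord0 * fgn_dspec H x.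

Lemma Ltwo_mix u : Ltwo (mix u).
Proof. by apply: LtwoD; apply: LtwoZ; [exact: Ltwo_fgn_spec|exact: Ltwo_fgn_dspec]. Qed.

Lemma fisher_form (u : 'cV[R]_2) :
  (u^T *m fisher_lt sigma H *m u) ord0 ord0 = sigma ^+ 4 / 2 * (Ipi (fun x => mix u x ^+ 2) / pi).
Proof.
have Lf := Ltwo_fgn_spec H1 H2; have Ld := Ltwo_fgn_dspec H1 H2.
have Lff := Ltwo_mul Lf Lf; have Lfd := Ltwo_mul Lf Ld; have Ldd := Ltwo_mul Ld Ld.
rewrite /fisher_lt mx2_form.
have -> : Ipi (fun x => mix u x ^+ 2) =
   (2 * u 0 ord0 / sigma) ^+ 2 * Ipi (fun x => fgn_spec H x * fgn_spec H x) +
   (2 * (2 * u 0 ord0 / sigma) * u 1 ord0 * Ipi (fun x => fgn_spec H x * fgn_dspec H x) +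
   u 1 ord0 ^+ 2 * Ipi (fun x => fgn_dspec H x * fgn_dspec H x)).
  rewrite -!IpiZ// -IpiD; [|exact: LoneZ|exact: LoneZ].
  rewrite -IpiD; [|exact: LoneZ|by apply: LoneD; exact: LoneZ].
  by apply: eq_Ipi => x _; rewrite /mix; ring.
have -> : (fun x => fgn_spec H x * fgn_spec H x) = (fun x => fgn_spec H x ^+ 2) by apply/funext => x; rewrite expr2.
have -> : (fun x => fgn_dspec H x * fgn_dspec H x) = (fun x => fgn_dspec H x ^+ 2) by apply/funext => x; rewrite expr2.
rewrite -/(Ipi (fun x => fgn_spec H x ^+ 2)) -/(Ipi (fun x => fgn_spec H x * fgn_dspec H x)) -/(Ipi (fun x => fgn_dspec H x ^+ 2)).
move: (Ipi _) (Ipi _) (Ipi _) => I3 I2 I1.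
have : forall q : R, q != 0 -> 2 * sigma ^+ 2 / q * I1 * u 0 ord0 ^+ 2 +
 (sigma ^+ 3 / q * I2 + sigma ^+ 3 / q * I2) * (u 0 ord0 * u 1 ord0) +
 sigma ^+ 4 / (2 * q) * I3 * u 1 ord0 ^+ 2 =
 sigma ^+ 4 / 2 *
 (((2 * u 0 ord0 / sigma) ^+ 2 * I1 +
   (2 * (2 * u 0 ord0 / sigma) * u 1 ord0 * I2 + u 1 ord0 ^+ 2 * I3)) / q).
  by move=> q q0; field; rewrite q0 gt_eqF.
by apply; rewrite gt_eqF// pi_gt0.
Qed.

Lemma tr_fisher_lt : (fisher_lt sigma H)^T = fisher_lt sigma H.
Proof.
apply/matrixP => i j; rewrite !mxE.
by case: (i == 0); case: (j == 0).
Qed.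

Lemma fcoef_mix u k :
  fcoef (mix u) k = 2 * u 0 ord0 / sigma * fgn_acov H k%:Z + u 1 ord0 * fcoef (fgn_dspec H) k.
Proof.
  have Lk (g : R -> R) : Ltwo g -> Lone (fun x => g x * cos (k%:R * x)).
  by move=> Lg; exact: (Ltwo_mul Lg (Ltwo_cos _)).
  rewrite -(fcoef_fgn_spec H1 H2) /fcoef.
  have -> : Ipi (fun x => mix u x * cos (k%:R * x)) =
  2 * u 0 ord0 / sigma * Ipi (fun x => fgn_spec H x * cos (k%:R * x)) +
  u 1 ord0 * Ipi (fun x => fgn_dspec H x * cos (k%:R * x)).
  rewrite -!IpiZ; [|exact: Lk (Ltwo_fgn_dspec H1 H2)|exact: Lk (Ltwo_fgn_spec H1 H2)].
  rewrite -IpiD; [|by apply: LoneZ; exact: Lk (Ltwo_fgn_spec H1 H2)|by apply: LoneZ; exact: Lk (Ltwo_fgn_dspec H1 H2)].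
  by apply: eq_Ipi => x _; rewrite /mix; ring.
by ring.
Qed.

Lemma fisher_lt_pd (u : 'cV[R]_2) : u != 0 -> 0 < (u^T *m fisher_lt sigma H *m u) ord0 ord0.
Proof.
move=> u0; rewrite fisher_form mulr_gt0 ?divr_gt0 ?exprn_gt0// ?pi_gt0//.
have h := bessel_le (Ltwo_mix u) 1.
(* Two Fourier coefficients suffice: [rho 0 = 1] and [rho' 0 = 0] isolate the first
   coordinate, and [rho' 1 != 0]. *)
apply: lt_le_trans h; rewrite mulr_gt0 ?pi_gt0// /symsum big_ord1.
rewrite !fcoef_mix fgn_acov0// fcoef_fgn_dspec0// mulr1 mulr0 addr0.
have [a0|a0] := eqVneq (u 0 ord0) 0; last first.
  rewrite ltr_pwDl//; last by rewrite mulr_ge0// sqr_ge0.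
  rewrite exprn_even_gt0//=; apply: mulf_neq0; last by rewrite invr_eq0 gt_eqF.
  exact: mulf_neq0.
have b0 : u 1 ord0 != 0.
  apply: contraNneq u0 => b0; apply/eqP/colP => i; rewrite mxE.
  case: i => -[|[|//]] hi; rewrite -[RHS]a0 -?[in RHS]b0; first by congr (u _ _); apply/val_inj.
  by rewrite a0 -b0; congr (u _ _); apply/val_inj.
rewrite a0 mulr0 !mul0r expr0n/= !add0r mulr_gt0// exprn_even_gt0//=.
by rewrite mulf_neq0// fcoef_fgn_dspec1.
Qed.

Lemma fisher_lt_unitmx : fisher_lt sigma H \in unitmx.
Proof.
rewrite unitmxE unitfE gt_eqF//; apply: det_pd_gt0; first exact: tr_fisher_lt.
move=> u u0; have := @fisher_lt_pd u^T; rewrite trmxK; apply.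
by apply: contraNneq u0 => /(congr1 trmx); rewrite trmxK trmx0 => ->.
Qed.

Lemma fisher_lt_psd (u : 'cV[R]_2) : 0 <= (u^T *m fisher_lt sigma H *m u) ord0 ord0.
Proof.
have [->|u0] := eqVneq u 0; last exact/ltW/fisher_lt_pd.
by rewrite mulmx0 mxE.
Qed.

Variables (alpha : R) (d : nat -> measure_display) (T : forall n, measurableType (d n))
  (P : forall n, probability (T n) R) (X : forall n, T n -> 'cV[R]_n).
Hypotheses (a0 : 0 < alpha).

Let Delta (n : nat) : R := n%:R `^ (- alpha).
Let v (n : nat) : R := Num.sqrt n%:R * Delta n `^ (2 * H - 1).
Let gam (n : nat) : R := sigma ^+ 2 * Delta n `^ (2 * H - 1).

Lemma gam_cvg0 : gam n @[n --> \oo] --> (0 : R).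
Proof.
have h : gam n @[n --> \oo] --> sigma ^+ 2 * (0 : R).
  apply: cvgM; first exact: cvg_cst.
  have -> : (fun n => Delta n `^ (2 * H - 1)) = (fun n => n%:R `^ (- (alpha * (2 * H - 1)))).
    by apply/funext => n; rewrite /Delta -powRrM mulNr.
  apply: powR_natN_cvg0; rewrite mulr_gt0//; have := H1; lra.
by rewrite mulr0 in h.
Qed.

Lemma score_cvg_to_gaussian :
  (forall n, gaussian_vector (P n) (@X n) (mfbm_cov n (Delta n) sigma H)) ->
  cvg_to_gaussian P
    (fun n w => (v n)^-1 *: col2 (score_sigma (Delta n) sigma H (X w))
       (score_H (Delta n) sigma H (X w) - sigma * ln (Delta n) * score_sigma (Delta n) sigma H (X w)))
    (fisher_lt sigma H).
Proof.
move=> gX.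
have [d' [T' [Q [G gG]]]] := gaussian_vector_exists tr_fisher_lt fisher_lt_psd.
exists d', T', Q, G; split=> //.
apply: (chisq_clt gX gG) => u.
pose s k := 2 * u 0 ord0 / sigma * fgn_acov H k%:Z + u 1 ord0 * fcoef (fgn_dspec H) k.
pose L := Ipi (fun x => mix u x ^+ 2) / pi.
have sL : symsum (fun k => s k ^+ 2) m @[m --> \oo] --> L.
  have := parseval (Ltwo_mix u).
  by under [X in symsum X]eq_fun do rewrite fcoef_mix.
have exC n : {C : 'M[R]_n & {l : 'rV[R]_n |
    C *m (1%:M + gam n *: fgn_mx n H) *m C^T = 1%:M /\ C *m toeplitz n s *m C^T = diag_mx l}}.
  have : exists C : 'M[R]_n, exists l : 'rV[R]_n,
    C *m (1%:M + gam n *: fgn_mx n H) *m C^T = 1%:M /\ C *m toeplitz n s *m C^T = diag_mx l.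
    apply: sim_diag; [exact: tr_one_plus_fgn|exact: tr_toeplitz|exact: one_plus_fgn_pd].
  by move=> /cid[C /cid[l h]]; exists C, l.
pose C n := projT1 (exC n); pose l n := sval (projT2 (exC n)).
have CA n : C n *m (1%:M + gam n *: fgn_mx n H) *m (C n)^T = 1%:M by case: (svalP (projT2 (exC n))).
have CS n : C n *m toeplitz n s *m (C n)^T = diag_mx (l n) by case: (svalP (projT2 (exC n))).
have g0 n : 0 <= gam n by rewrite mulr_ge0 ?sqr_ge0// powR_ge0.
have D0 n : (0 < n)%N -> 0 < Delta n by move=> n0; rewrite powR_gt0// ltr0n.
have c2 := @cvg_mean_sqr _ _ _ sL gam (fun n => fgn_mx n H) C l (fun n _ => g0 n) gam_cvg0
  (fun n => tr_fgn n H) (fgn_mx_psd H1 H2) (tr_fgn_mx H1 H2) (fun n _ => CA n) (fun n _ => CS n).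
have c3 := @cvg_mean_cube _ _ _ sL gam (fun n => fgn_mx n H) C l (fun n _ => g0 n)
  (fun n => tr_fgn n H) (fgn_mx_psd H1 H2) (tr_fgn_mx H1 H2) (fun n _ => CA n) (fun n _ => CS n).
(* The weights of the scores are gam / 2 times l, and gam n / v n = sigma^2 / sqrt n. *)
pose r n (i : 'I_n) : R := sigma ^+ 2 / 2 * (Num.sqrt n%:R)^-1 * l n ord0 i.
exists (fun n => (Num.sqrt (Delta n))^-1 *: C n), r; split.
(* For n = 0 the power giving [Delta 0] is 0 and cannot be inverted, but the matrices are empty. *)
- case=> [|n]; first by apply/matrixP => -[].
  have Dn : 0 < Delta n.+1 by exact: D0.
  rewrite -(CA n.+1) /mfbm_cov -/(gam n.+1).
  have -> : ((Num.sqrt (Delta n.+1))^-1 *: C n.+1)^T = (Num.sqrt (Delta n.+1))^-1 *: (C n.+1)^T by rewrite linearZ.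
  rewrite -scalemxAr -!scalemxAl -scalemxAr -scalemxAl !scalerA.
  by rewrite -invfM -expr2 sqr_sqrtr ?ltW// mulVf ?scale1r// gt_eqF.
- case=> [|n] w.
    (* [v 0 = 0], so that the junk inverse [0^-1 = 0] annihilates the score. *)
    by rewrite big_ord0 /v sqrtr0 mul0r invr0 scale0r /cdot mulmx0 mxE.
  have Dn : 0 < Delta n.+1 by exact: D0.
  have -> (k : R) (y : 'cV[R]_2) : cdot u (k *: y) = k * cdot u y by rewrite /cdot -scalemxAr mxE.
  rewrite cdot_col2 (score_combination H1 H2 Dn s0 (X w) (CA n.+1) (CS n.+1)).
  rewrite mulr_sumr; apply: eq_bigr => i _; rewrite mulrA; congr (_ * _).
  rewrite /r /v -/(gam n.+1) /gam.
  have := powR_gt0 (2 * H - 1) Dn.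
  have : 0 < Num.sqrt n.+1%:R :> R by rewrite sqrtr_gt0.
  move: (Num.sqrt _) (_ `^ _) => q1 q2 q10 q20.
  by field; rewrite !gt_eqF.
- have -> : (fun n => \sum_i r n i ^+ 2) = (fun n => sigma ^+ 4 / 4 * (n%:R^-1 * \sum_i l n ord0 i ^+ 2)).
    apply/funext => n; rewrite mulrA mulr_sumr; apply: eq_bigr => i _.
    have e : (Num.sqrt n%:R)^-1 ^+ 2 = n%:R^-1 :> R by rewrite exprVn sqr_sqrtr.
    by rewrite /r [in LHS]exprMn [in LHS]exprMn e; congr (_ * _ * _); field.
  rewrite fisher_form -/L.
  have -> : sigma ^+ 4 / 2 * L / 2 = sigma ^+ 4 / 4 * L by field.
  by apply: cvgM c2; exact: cvg_cst.
- have -> : (fun n => \sum_i `|r n i| ^+ 3) = (fun n => (sigma ^+ 2 / 2) ^+ 3 * ((n%:R * Num.sqrt n%:R)^-1 * \sum_i `|l n ord0 i| ^+ 3)).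
    apply/funext => n; rewrite mulrA mulr_sumr; apply: eq_bigr => i _.
    rewrite /r normrM [in LHS]exprMn; congr (_ * _).
    have e : (n%:R * Num.sqrt n%:R)^-1 = (Num.sqrt n%:R)^-1 ^+ 3 :> R.
      by rewrite -[X in X * _]sqr_sqrtr// -exprSr exprVn.
    by rewrite e -exprMn ger0_norm// mulr_ge0 ?invr_ge0 ?sqrtr_ge0// divr_ge0 ?sqr_ge0.
  have h : (sigma ^+ 2 / 2) ^+ 3 * ((n%:R * Num.sqrt n%:R)^-1 * \sum_i `|l n ord0 i| ^+ 3) @[n --> \oo] -->
     (sigma ^+ 2 / 2) ^+ 3 * (0 : R).
    by apply: cvgM c3; exact: cvg_cst.
  by rewrite mulr0 in h.
Qed.

End FisherInformation.

Theorem proposition7 (R : realType) (sigma H alpha : R)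
    (d : nat -> measure_display) (T : forall n, measurableType (d n))
    (P : forall n, probability (T n) R) (X : forall n, T n -> 'cV[R]_n) :
  0 < sigma -> 1 / 2 < H -> H < 3 / 4 -> 0 < alpha -> alpha < 1 ->
  let Delta (n : nat) : R := n%:R `^ (- alpha) in
  let p : R := 2 * H - 1 in
  let v (n : nat) : R := Num.sqrt n%:R * Delta n `^ p in
  (forall n, gaussian_vector (P n) (X n) (mfbm_cov n (Delta n) sigma H)) ->
  let S_sigma (n : nat) (w : T n) := score_sigma (Delta n) sigma H (X n w) in
  let S_H (n : nat) (w : T n) := score_H (Delta n) sigma H (X n w) in
  let R_H (n : nat) (w : T n) := S_H n w - sigma * ln (Delta n) * S_sigma n w in
  let M1 (n : nat) := mx2 1 0 (- sigma * ln (Delta n)) 1 in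
  [/\ cvg_to_gaussian P
        (fun n w => (v n)^-1 *: col2 (S_sigma n w) (R_H n w))
        (fisher_lt sigma H),
      cvg_to_gaussian P
        (fun n w => (v n)^-1 *: (M1 n *m col2 (S_sigma n w) (S_H n w)))
        (fisher_lt sigma H) &
      fisher_lt sigma H \in unitmx].
Proof.
move=> s0 H1 H2 a0 a1 Delta p v gX S_sigma S_H R_H M1.
have h := @score_cvg_to_gaussian R sigma H H1 H2 s0 alpha d T P X a0 gX.
have e n (w : T n) : M1 n *m col2 (S_sigma n w) (S_H n w) = col2 (S_sigma n w) (R_H n w).
  apply/colP => i; rewrite mxE big_ord_recl big_ord1 !mxE/= /R_H.
  by case: eqP => _; ring.
split; [exact: h| |exact: fisher_lt_unitmx].
suff -> : (fun n (w : T n) => (v n)^-1 *: (M1 n *m col2 (S_sigma n w) (S_H n w))) =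
  (fun n w => (v n)^-1 *: col2 (S_sigma n w) (R_H n w)) by exact: h.
by apply: functional_extensionality_dep => n; apply/funext => w; rewrite e.
Qed.
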